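(* The Poisson flow $X_r^{\mathcal H}$ of the Riemann xi function associated with the Hermite polynomials is related to the P\'olya--De Bruijn flow $(\Xi_\lambda)_{\lambda\in\mathbb{R}}$ via $$X_r^{\mathcal H}(t)=\Xi_{(r^2-1)/4}(rt)\qquad(0<r\le1,\ t\in\mathbb{C}).$$
   Context: Let $\xi(s)=\frac12 s(s-1)\pi^{-s/2}\Gamma(s/2)\zeta(s)$ (extended to an entire function) and $\Xi(t)=\xi\left(\frac12+it\right)$. For $x\in\mathbb{R}$ let $$\Phi(x)=2\sum_{n=1}^\infty\left(2\pi^2n^4e^{9x/2}-3\pi n^2e^{5x/2}\right)\exp\left(-\pi n^2e^{2x}\right),$$ so that $\Xi(t)=\int_{-\infty}^\infty\Phi(x)e^{itx}\,dx$. P\'olya--De Bruijn flow: for $\lambda\in\mathbb{R}$, $$\Xi_\lambda(t)=\int_{-\infty}^\infty e^{\lambda x^2}\Phi(x)e^{itx}\,dx .$$ Hermite polynomials: $H_n(x)=(-1)^ne^{x^2}\frac{d^n}{dx^n}\left(e^{-x^2}\right)$; they are orthogonal on $\mathbb{R}$ for the weight $e^{-x^2}$, with $\int_{\mathbb{R}}H_n(x)^2e^{-x^2}\,dx=\sqrt\pi\,2^nn!$. Their Poisson kernel is, for $|r|<1$, $$p_r^{\mathcal H}(x,y)=\sum_{n=0}^\infty\frac{r^n}{\sqrt\pi\,2^nn!}H_n(x)H_n(y).$$ Poisson flow of $\Xi$ for the Hermite polynomials: for $0<r<1$, $$X_r^{\mathcal H}(t)=\int_{-\infty}^\infty p_r^{\mathcal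 H}(t,\tau)\,\Xi(\tau)\,e^{-\tau^2}\,d\tau,$$ and $X_1^{\mathcal H}(t)=\Xi(t)$. Equivalently, if $\Xi(t)=\sum_{n=0}^\infty\gamma_nH_n(t)$ is the Hermite (Fourier) expansion of $\Xi$ in $L^2(\mathbb{R},e^{-t^2}dt)$, then $X_r^{\mathcal H}(t)=\sum_{n=0}^\infty r^n\gamma_nH_n(t)$. *)

(* Defs.v *)
(* Stdlib reals with Coquelicot. *)
From Stdlib Require Import Reals Factorial ClassicalEpsilon.
From Coquelicot Require Import Coquelicot.

Open Scope R_scope.

Definition Cexp (z : C) : C :=
  (exp (Re z) * cos (Im z), exp (Re z) * sin (Im z)).

(* Principal value a^z, meant for a > 0 only. *)
Definition Rcpow (a : R) (z : C) : C := Cexp (z * ln a)%C.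

(* Coquelicot's [Series] is real-valued; this is its analogue on C, with the
   same convention as [RInt_gen]: meaningless unless the series converges. *)
Definition CSeries (a : nat -> C) : C :=
  @iota C_CompleteNormedModule (is_series a).

Definition CRInt_line (f : R -> C) : C :=
  @RInt_gen C_R_CompleteNormedModule f
    (Rbar_locally m_infty) (Rbar_locally p_infty).

(* Euler's integral; used only where it converges, i.e. for Re z > 0. *)
Definition CGamma (z : C) : C :=
  @RInt_gen C_R_CompleteNormedModule
    (fun x : R => (Rcpow x (z - 1) * exp (- x))%C)
    (at_right 0) (Rbar_locally p_infty).

(* The Dirichlet series; used only where it converges, i.e. for Re s > 1. *)
Definition Czeta (s : C) : C :=
  CSeries (fun k : nat => Rcpow (INR (S k)) (- s)).

Definition entire (f : C -> C) : Prop :=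
  forall z : C, @ex_derive C_AbsRing C_NormedModule f z.

(* [f] is the entire extension of s(s-1) pi^(-s/2) Gamma(s/2) zeta(s) / 2 from
   the half-plane Re s > 1, where the integral for Gamma and the series for
   zeta both converge. *)
Definition is_xi (f : C -> C) : Prop :=
  entire f /\
  forall s : C, 1 < Re s ->
    f s = (/ 2 * s * (s - 1) * Rcpow PI (- (s / 2)) * CGamma (s / 2) * Czeta s)%C.

Definition xi : C -> C := epsilon (inhabits (fun _ : C => RtoC 0)) is_xi.

Definition Xi (t : C) : C := xi (/ 2 + Ci * t)%C.

Definition Phi (x : R) : R :=
  2 * Series (fun k : nat =>
        let n := INR (S k) in
        (2 * PI ^ 2 * n ^ 4 * exp (9 * x / 2) - 3 * PI * n ^ 2 * exp (5 * x / 2))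
        * exp (- (PI * n ^ 2 * exp (2 * x)))).

(* The Polya--De Bruijn flow of [Xi]. *)
Definition Xi_flow (lambda : R) (t : C) : C :=
  CRInt_line (fun x : R =>
    (exp (lambda * x ^ 2) * Phi x * Cexp (Ci * t * x))%C).

(* Rodrigues' formula with complex differentiation, so that the argument may be
   complex. *)
Definition Hermite (n : nat) (z : C) : C :=
  ((- 1) ^ n * Cexp (z ^ 2)
   * Nat.iter n C_derive (fun w : C => Cexp (- w ^ 2)) z)%C.

Definition Hermite_Poisson_kernel (r : R) (x y : C) : C :=
  CSeries (fun n : nat =>
    (r ^ n / (sqrt PI * 2 ^ n * INR (fact n)) * Hermite n x * Hermite n y)%C).

Definition Xi_Hermite_Poisson (r : R) (t : C) : C :=
  if Req_EM_T r 1 then Xi t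
  else CRInt_line (fun tau : R =>
         (Hermite_Poisson_kernel r t tau * Xi tau * exp (- tau ^ 2))%C).

(* Main.v *)
Require Import Defs.
From Stdlib Require Import Reals Lra Lia Factorial Classical ClassicalEpsilon FunctionalExtensionality.
From Coquelicot Require Import Coquelicot.
Open Scope R_scope.

(** Both flows are explicit transforms of the same kernel, because
[Xi t] is the Fourier integral of [Phi] for every complex [t] ([Xi_eq]).
Granted this, the theorem is a computation.  The Hermite function of order [n]
has Fourier transform [sqrt PI * (i x)^n * exp (- x^2 / 4)] ([laplace_herm_fun]),
so the [n]-th Hermite coefficient of [Xi] is the integral of [Phi] against
[(i x)^n exp (- x^2 / 4) / (2^n n!)].  Multiplying it by [r^n], summing over
[n] under the integral sign and using the generating function
[sum_n H_n(t) z^n / n! = exp (2 t z - z^2)] at [z = i r x / 2]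
([herm_generating]) replaces the Gaussian [exp (- x^2 / 4)] by
[exp ((r^2 - 1) x^2 / 4) * exp (i r t x)], the integrand of the Polya - De
Bruijn flow.  The exchanges of sums and integrals rest on
[|H_n(z)| <= C sqrt (2^n n!) k^(-n/2) exp (k (Re z)^2)], valid for every [k < 1]
on a horizontal line ([herm_bound]): for [k > r] the factors
[r^n] absorb the losses [k^(-n)].

The substance is the integral formula for [Xi], which is only known through
the characterisation of [xi] as an entire extension.  It has three parts.

Decay.  The Fourier integral of [Phi] is entire once [Phi] decays faster than
every exponential at both ends ([rapid_Phi]).  At plus infinity this is read
off the series.  At minus infinity one writes
[Phi u = exp (u / 2) * sum_n qker (n exp u)] with [qker] an even Schwartz
function vanishing at 0 and of integral 0.  The sum of such a function over a
grid of step [eps] is smaller than every power of [eps]: as a function of the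
shift of the grid it is periodic with mean 0, so it is bounded by its
derivative, which is [eps] times a sum of the same kind ([Euler_Maclaurin]).
This elementary argument stands in for the functional equation of the theta
function.

Identification for [Re s > 1].  Up to constant factors all terms of
[Phi] are translates of the first one, so the integral factors as a single integral times [zeta s]
([laplace_Phi_zeta]), and that single integral is Euler's integral after two
integrations by parts ([line_zeta_term0], [CGamma_eq]).

Uniqueness.  Two entire functions that agree for [Re s > 1] are equal
([entire_zero_halfplane]).  Goursat's theorem for squares gives the vanishing of
contour integrals assuming only pointwise differentiability; applied to
[g z * exp (n^2 (z - w)^2)] on a large square with [w] in the middle of its left
side, where [g] is the difference, it shows that Gaussian averages of [g] around [w] are
exponentially small, which forces [g w = 0]. *)

(** * Complex functions of a real variable *)

(** For equations whose type is a structure projecting to [R]. *)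
Ltac Rring := match goal with |- ?a = ?b => change (@eq R a b) end; ring.

(** Continuity, integrals and derivatives of functions [R -> C] are taken
componentwise, so that the real theory applies to both parts and the several
module structures on [C] stay out of the way. *)
Definition ccont (f : R -> C) : Prop := forall x,
  continuous (fun y => fst (f y)) x /\ continuous (fun y => snd (f y)) x.

Definition cint (f : R -> C) (a b : R) : C :=
  (RInt (fun x => fst (f x)) a b, RInt (fun x => snd (f x)) a b).

Definition cderive (f : R -> C) (x : R) (l : C) : Prop :=
  is_derive (fun y => fst (f y)) x (fst l) /\
  is_derive (fun y => snd (f y)) x (snd l).

Lemma cont_of_derive (f : R -> R) x : ex_derive f x -> continuous f x.
Proof. apply (ex_derive_continuous (K := R_AbsRing) (V := R_NormedModule)). Qed.

Lemma ccont_const (z : C) : ccont (fun _ => z).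
Proof. intros x; split; apply continuous_const. Qed.

Lemma ccont_RtoC (f : R -> R) : (forall x, continuous f x) -> ccont (fun x => RtoC (f x)).
Proof. intros H x; split; simpl; [apply H | apply continuous_const]. Qed.

Lemma ccont_id : ccont (fun x => RtoC x).
Proof. apply (ccont_RtoC (fun x => x)); intros; apply continuous_id. Qed.

Lemma ccont_plus f g : ccont f -> ccont g -> ccont (fun x => f x + g x)%C.
Proof.
intros Hf Hg x; destruct (Hf x), (Hg x); split; simpl;
  apply (continuous_plus (V := R_NormedModule)); assumption.
Qed.

Lemma ccont_opp f : ccont f -> ccont (fun x => - f x)%C.
Proof.
intros Hf x; destruct (Hf x); split; simpl;
  apply (continuous_opp (V := R_NormedModule)); assumption.
Qed.

Lemma ccont_minus f g : ccont f -> ccont g -> ccont (fun x => f x - g x)%C.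
Proof. intros; apply ccont_plus; [|apply ccont_opp]; assumption. Qed.

Lemma ccont_mult f g : ccont f -> ccont g -> ccont (fun x => f x * g x)%C.
Proof.
intros Hf Hg x; destruct (Hf x), (Hg x); split; simpl.
- apply (continuous_minus (V := R_NormedModule)); apply (continuous_mult (K := R_AbsRing)); assumption.
- apply (continuous_plus (V := R_NormedModule)); apply (continuous_mult (K := R_AbsRing)); assumption.
Qed.

Lemma ccont_pow f n : ccont f -> ccont (fun x => f x ^ n)%C.
Proof.
intros Hf; induction n as [|n IH]; simpl; [apply ccont_const | apply ccont_mult; assumption].
Qed.

Lemma continuous_exp_comp (f : R -> R) x : continuous f x -> continuous (fun y => exp (f y)) x.
Proof. intros H; apply (continuous_comp f exp); [exact H | apply continuous_exp]. Qed.

Lemma ccont_Cexp f : ccont f -> ccont (fun x => Cexp (f x)).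
Proof.
intros Hf x; destruct (Hf x) as [H1 H2]; split; unfold Cexp, Re, Im; simpl;
  apply (continuous_mult (K := R_AbsRing)).
- apply continuous_exp_comp, H1.
- apply (continuous_comp _ cos); [exact H2 | apply continuous_cos].
- apply continuous_exp_comp, H1.
- apply (continuous_comp _ sin); [exact H2 | apply continuous_sin].
Qed.

Lemma ccont_ext f g : (forall x, f x = g x) -> ccont f -> ccont g.
Proof.
intros E H x; destruct (H x) as [H1 H2]; split.
- apply (continuous_ext (fun y => fst (f y))); [intros; rewrite E; reflexivity | exact H1].
- apply (continuous_ext (fun y => snd (f y))); [intros; rewrite E; reflexivity | exact H2].
Qed.

Lemma continuous_Cmod f x : ccont f -> continuous (fun y => Cmod (f y)) x.
Proof.
intros Hf; unfold Cmod; destruct (Hf x) as [H1 H2].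
apply (continuous_comp (fun y => fst (f y) ^ 2 + snd (f y) ^ 2) sqrt).
- apply (continuous_plus (V := R_NormedModule));
  [ apply (continuous_comp (fun y => fst (f y)) (fun u => u ^ 2)); [exact H1|]
  | apply (continuous_comp (fun y => snd (f y)) (fun u => u ^ 2)); [exact H2|] ];
  apply cont_of_derive; auto_derive; trivial.
- apply continuous_sqrt.
Qed.

Lemma ccont_eps f : ccont f -> forall x eps, 0 < eps ->
  exists d, 0 < d /\ forall y, Rabs (y - x) < d -> Cmod (f y - f x) < eps.
Proof.
intros Hf x eps He.
pose proof (continuous_Cmod (fun y => f y - f x)%C x (ccont_minus _ _ Hf (ccont_const _))) as H.
assert (H0 : Cmod (f x - f x) = 0).
{ replace (f x - f x)%C with (RtoC 0) by ring. apply Cmod_0. }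
unfold continuous in H. rewrite H0 in H.
destruct (H (ball 0 (mkposreal eps He)) (locally_ball _ _)) as [d Hd].
exists d; split; [apply cond_pos|]. intros y Hy. specialize (Hd y Hy).
unfold ball in Hd; simpl in Hd; unfold AbsRing_ball, abs, minus, plus, opp in Hd; simpl in Hd.
rewrite Ropp_0, Rplus_0_r in Hd. rewrite Rabs_pos_eq in Hd; [exact Hd | apply Cmod_ge_0].
Qed.

Lemma ccont_of_eps f : (forall x eps, 0 < eps ->
  exists d, 0 < d /\ forall y, Rabs (y - x) < d -> Cmod (f y - f x) <= eps) -> ccont f.
Proof.
intros H x. assert (K : forall (p : C -> R), (forall z : C, Rabs (p z) <= Cmod z) ->
   (forall a b : C, p (a - b)%C = p a - p b) ->
   continuous (fun y => p (f y)) x).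
{ intros p Hp Hm. apply filterlim_locally. intros eps.
  destruct (H x (eps / 2)) as [d [Hd Hy]]; [apply is_pos_div_2|].
  exists (mkposreal d Hd). intros y By.
  unfold ball; simpl; unfold AbsRing_ball, abs, minus, plus, opp; simpl.
  change (Rabs (p (f y) - p (f x)) < eps). rewrite <- Hm.
  apply Rle_lt_trans with (1 := Hp _). apply Rle_lt_trans with (1 := Hy y By).
  destruct eps as [e he]; simpl; lra. }
split.
- apply (K fst); [apply re_le_Cmod|reflexivity].
- apply (K snd); [|reflexivity]. intros z.
  apply Rle_trans with (2 := Rmax_Cmod z). apply Rmax_r.
Qed.

Lemma ex_RInt_cont (f : R -> R) a b : (forall x, continuous f x) -> ex_RInt f a b.
Proof. intros H; apply (ex_RInt_continuous (V := R_CompleteNormedModule)); intros; apply H. Qed.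

Lemma ccont_ex_RInt f a b : ccont f ->
  ex_RInt (fun x => fst (f x)) a b /\ ex_RInt (fun x => snd (f x)) a b.
Proof.
intros H; split; apply ex_RInt_cont; intros x; [exact (proj1 (H x)) | exact (proj2 (H x))].
Qed.

(** The bridge to the integrals of the statement, which are taken in [C] as a
normed module over [R]. *)
Lemma cint_correct f a b : ccont f -> is_RInt (V := C_R_NormedModule) f a b (cint f a b).
Proof.
intros H. apply (is_RInt_fct_extend_pair (U := R_NormedModule) (V := R_NormedModule)).
- apply (RInt_correct (V := R_CompleteNormedModule)), (ccont_ex_RInt f a b H).
- apply (RInt_correct (V := R_CompleteNormedModule)), (ccont_ex_RInt f a b H).
Qed.

Lemma cint_unique f a b l : is_RInt (V := C_R_NormedModule) f a b l -> cint f a b = l.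
Proof.
intros H. unfold cint. destruct l as [l1 l2]. f_equal.
- apply (is_RInt_unique (V := R_CompleteNormedModule)).
  exact (is_RInt_fct_extend_fst (U := R_NormedModule) (V := R_NormedModule) _ _ _ _ H).
- apply (is_RInt_unique (V := R_CompleteNormedModule)).
  exact (is_RInt_fct_extend_snd (U := R_NormedModule) (V := R_NormedModule) _ _ _ _ H).
Qed.

Lemma cint_ext f g a b :
  (forall x, Rmin a b < x < Rmax a b -> f x = g x) -> cint f a b = cint g a b.
Proof.
intros E; unfold cint; f_equal; apply RInt_ext; intros x Hx; rewrite E; auto.
Qed.

Lemma cint_plus f g a b : ccont f -> ccont g ->
  cint (fun x => f x + g x)%C a b = (cint f a b + cint g a b)%C.
Proof.
intros Hf Hg; unfold cint, Cplus; simpl.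
destruct (ccont_ex_RInt f a b Hf), (ccont_ex_RInt g a b Hg).
f_equal; apply (RInt_plus (V := R_CompleteNormedModule)); assumption.
Qed.

Lemma cint_scal c f a b : ccont f ->
  cint (fun x => c * f x)%C a b = (c * cint f a b)%C.
Proof.
intros Hf. unfold cint, Cmult; simpl.
destruct (ccont_ex_RInt f a b Hf) as [E1 E2].
assert (S : forall k h, ex_RInt h a b -> RInt (fun x => k * h x) a b = k * RInt h a b).
{ intros k h Hh. apply (RInt_scal (V := R_CompleteNormedModule) h a b k Hh). }
assert (ES : forall k h, ex_RInt h a b -> ex_RInt (fun x => k * h x) a b).
{ intros k h Hh. apply (ex_RInt_scal (V := R_NormedModule)); exact Hh. }
f_equal.
- rewrite <- !S by assumption.
  apply (RInt_minus (V := R_CompleteNormedModule) (fun x => fst c * fst (f x)) (fun x => snd c * snd (f x))); auto.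
- rewrite <- !S by assumption.
  apply (RInt_plus (V := R_CompleteNormedModule) (fun x => fst c * snd (f x)) (fun x => snd c * fst (f x))); auto.
Qed.

Lemma cint_minus f g a b : ccont f -> ccont g ->
  cint (fun x => f x - g x)%C a b = (cint f a b - cint g a b)%C.
Proof.
intros Hf Hg. rewrite (cint_ext _ (fun x => f x + (-(1)) * g x)%C) by (intros; ring).
rewrite cint_plus, cint_scal; auto; [ring|]. apply ccont_mult; [apply ccont_const|exact Hg].
Qed.

Lemma cint_Chasles f a b c : ccont f -> cint f a c = (cint f a b + cint f b c)%C.
Proof.
intros Hf; unfold cint, Cplus; simpl.
destruct (ccont_ex_RInt f a b Hf), (ccont_ex_RInt f b c Hf).
f_equal; symmetry; apply (RInt_Chasles (V := R_CompleteNormedModule)); assumption.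
Qed.

Lemma cint_bound f g a b : ccont f -> a <= b -> ex_RInt g a b ->
  (forall x, a <= x <= b -> Cmod (f x) <= g x) -> Cmod (cint f a b) <= RInt g a b.
Proof.
intros Hf Hab Hg Hb. rewrite Cmod_norm.
apply (norm_RInt_le (V := C_R_NormedModule) f g a b); auto.
- intros x Hx. rewrite <- Cmod_norm. auto.
- apply cint_correct, Hf.
- apply (RInt_correct (V := R_CompleteNormedModule)), Hg.
Qed.

Lemma cint_bound_const f a b M : ccont f ->
  (forall x, Rmin a b <= x <= Rmax a b -> Cmod (f x) <= M) ->
  Cmod (cint f a b) <= Rabs (b - a) * M.
Proof.
intros Hf Hb. rewrite Cmod_norm.
apply (norm_RInt_le_const_abs (V := C_R_NormedModule) f a b).
- intros x Hx. rewrite <- Cmod_norm. auto.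
- apply cint_correct, Hf.
Qed.

Lemma cderive_const z x : cderive (fun _ => z) x 0.
Proof. split; apply (is_derive_const (K := R_AbsRing) (V := R_NormedModule)). Qed.

Lemma cderive_RtoC (f : R -> R) x l : is_derive f x l -> cderive (fun y => RtoC (f y)) x l.
Proof. intros H; split; simpl; [exact H | apply (is_derive_const (K := R_AbsRing) (V := R_NormedModule))]. Qed.

Lemma cderive_id x : cderive (fun y => RtoC y) x 1.
Proof. apply (cderive_RtoC (fun y => y)). apply (is_derive_id (K := R_AbsRing)). Qed.

Lemma cderive_plus f g x a b : cderive f x a -> cderive g x b -> cderive (fun y => f y + g y)%C x (a + b)%C.
Proof.
intros [H1 H2] [H3 H4]; split; simpl; apply (is_derive_plus (K := R_AbsRing) (V := R_NormedModule)); assumption.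
Qed.

Lemma is_derive_Rmult (f g : R -> R) x a b :
  is_derive f x a -> is_derive g x b -> is_derive (fun y => f y * g y) x (a * g x + f x * b).
Proof. intros H1 H2. apply (is_derive_mult f g x a b H1 H2). intros; apply Rmult_comm. Qed.

Lemma is_derive_eq (f : R -> R) x a b : is_derive f x a -> a = b -> is_derive f x b.
Proof. intros H E; rewrite <- E; exact H. Qed.

Lemma cderive_mult f g x a b : cderive f x a -> cderive g x b ->
  cderive (fun y => f y * g y)%C x (a * g x + f x * b)%C.
Proof.
intros [H1 H2] [H3 H4]; split; simpl.
- eapply is_derive_eq.
  + apply (is_derive_minus (K := R_AbsRing) (V := R_NormedModule)); apply is_derive_Rmult; eassumption.
  + unfold minus, plus, opp; simpl; ring.
- eapply is_derive_eq.
  + apply (is_derive_plus (K := R_AbsRing) (V := R_NormedModule)); apply is_derive_Rmult; eassumption.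
  + unfold minus, plus, opp; simpl; ring.
Qed.

Lemma cderive_eq f x a b : cderive f x a -> a = b -> cderive f x b.
Proof. intros H E; rewrite <- E; exact H. Qed.

Lemma cderive_ext f g x a : (forall y, f y = g y) -> cderive f x a -> cderive g x a.
Proof.
intros E [H1 H2]; split; [apply (is_derive_ext (fun y => fst (f y))) | apply (is_derive_ext (fun y => snd (f y)))];
 try assumption; intros; rewrite E; reflexivity.
Qed.

Lemma cderive_Cexp f x a : cderive f x a -> cderive (fun y => Cexp (f y)) x (a * Cexp (f x))%C.
Proof.
intros [H1 H2].
assert (He : is_derive (fun y => exp (fst (f y))) x (fst a * exp (fst (f x)))).
{ apply (is_derive_comp (K := R_AbsRing) (V := R_NormedModule) exp (fun y => fst (f y)) x); [apply is_derive_exp|exact H1]. }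
split; unfold Cexp, Re, Im; simpl.
- eapply is_derive_eq.
  + apply is_derive_Rmult; [exact He|].
    apply (is_derive_comp (K := R_AbsRing) (V := R_NormedModule) cos (fun y => snd (f y)) x); [apply is_derive_cos|exact H2].
  + unfold scal; simpl; unfold mult; simpl; ring.
- eapply is_derive_eq.
  + apply is_derive_Rmult; [exact He|].
    apply (is_derive_comp (K := R_AbsRing) (V := R_NormedModule) sin (fun y => snd (f y)) x); [apply is_derive_sin|exact H2].
  + unfold scal; simpl; unfold mult; simpl; ring.
Qed.

Lemma cderive_pow f x a n : cderive f x a ->
  cderive (fun y => f y ^ (S n))%C x (INR (S n) * a * f x ^ n)%C.
Proof.
intros H; induction n as [|n IH].
- apply (cderive_eq _ _ _ _ (cderive_mult _ _ _ _ _ H (cderive_const 1 x))). simpl. ring.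
- apply (cderive_eq _ _ _ _ (cderive_mult _ _ _ _ _ H IH)).
  rewrite (S_INR (S n)), RtoC_plus. change (f x ^ S n)%C with (f x * f x ^ n)%C. ring.
Qed.

Lemma cderive_ccont f f' : (forall x, cderive f x (f' x)) -> ccont f.
Proof.
intros H x; destruct (H x) as [H1 H2]; split;
  apply cont_of_derive; eexists; eassumption.
Qed.

Lemma cint_FTC F f a b : (forall x, cderive F x (f x)) -> ccont f ->
  cint f a b = (F b - F a)%C.
Proof.
intros H Hf. unfold cint, Cminus, Cplus, Copp; simpl.
f_equal; apply (is_RInt_unique (V := R_CompleteNormedModule)).
- apply (is_RInt_derive (V := R_CompleteNormedModule) (fun x => fst (F x))); intros.
  + exact (proj1 (H x)).
  + exact (proj1 (Hf x)).
- apply (is_RInt_derive (V := R_CompleteNormedModule) (fun x => snd (F x))); intros.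
  + exact (proj2 (H x)).
  + exact (proj2 (Hf x)).
Qed.

Lemma cderive_zero_const F : (forall x, cderive F x 0) -> forall a b, F a = F b.
Proof.
intros H a b. assert (E := cint_FTC F (fun _ => 0) b a H (ccont_const 0)).
assert (E2 := cint_bound_const (fun _ => 0) b a 0 (ccont_const 0)).
rewrite E in E2. rewrite Cmod_0, Rmult_0_r in E2.
specialize (E2 (fun _ _ => Rle_refl 0)).
apply Ceq_minus, Cmod_eq_0, Rle_antisym; [exact E2|apply Cmod_ge_0].
Qed.

Lemma Ci2 : (Ci * Ci)%C = (-(1))%C.
Proof. unfold Cmult, Ci, Copp, RtoC; simpl; f_equal; ring. Qed.

Lemma Cmod_Ci : Cmod Ci = 1.
Proof. unfold Cmod, Ci; simpl; transitivity (sqrt 1); [f_equal; ring|apply sqrt_1]. Qed.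

Lemma Cmod_le_2max (z : C) : Cmod z <= 2 * Rmax (Rabs (fst z)) (Rabs (snd z)).
Proof.
apply Rle_trans with (1 := Cmod_2Rmax z). apply Rmult_le_compat_r.
- apply Rle_trans with (2 := Rmax_l _ _), Rabs_pos.
- rewrite <- (sqrt_pow2 2) at 2 by lra. apply sqrt_le_1; lra.
Qed.

(** * Integrals over the line *)

(** The majorant behind every integral over the line.  Its primitive is [atan],
which makes all truncation errors explicit. *)
Definition wt (x : R) : R := / (1 + x ^ 2).

Lemma wt_pos x : 0 < wt x.
Proof. unfold wt; apply Rinv_0_lt_compat; nra. Qed.

Lemma wt_le_1 x : wt x <= 1.
Proof. unfold wt. rewrite <- Rinv_1. apply Rinv_le_contravar; nra. Qed.

Lemma is_RInt_wt a b : is_RInt wt a b (atan b - atan a).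
Proof.
apply (is_RInt_derive (V := R_CompleteNormedModule) atan wt); intros x _.
- apply is_derive_Reals. apply derivable_pt_lim_atan.
- apply cont_of_derive.
  unfold wt; auto_derive. nra.
Qed.

Lemma atan_le_id y : 0 <= y -> atan y <= y.
Proof.
intros Hy. assert (H := norm_RInt_le_const (V := R_NormedModule) wt 0 y (atan y - atan 0) 1 Hy).
specialize (fun h => H h (is_RInt_wt 0 y)).
rewrite atan_0, Rminus_0_r, Rmult_1_r, Rminus_0_r in H.
apply Rle_trans with (1 := Rle_abs _). apply H.
intros x _. change (Rabs (wt x) <= 1). rewrite Rabs_pos_eq by apply Rlt_le, wt_pos.
unfold wt. rewrite <- Rinv_1. apply Rinv_le_contravar; nra.
Qed.

Lemma atan_tail A : 0 < A -> PI / 2 - atan A <= / A.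
Proof.
intros HA. rewrite <- atan_inv by exact HA. apply atan_le_id. left; apply Rinv_0_lt_compat, HA.
Qed.

(** The constant is part of the data: it controls the size of the integral, its
tails, and the convergence of series of integrals. *)
Definition tame (f : R -> C) (c : R) : Prop := ccont f /\ forall x, Cmod (f x) <= c * wt x.

Lemma tame_nonneg f c : tame f c -> 0 <= c.
Proof.
intros [_ H]. specialize (H 0). assert (E := Cmod_ge_0 (f 0)). unfold wt in H.
rewrite pow_i, Rplus_0_r, Rinv_1 in H by lia. lra.
Qed.

Lemma cint_tame_atan f c a b : tame f c -> a <= b -> Cmod (cint f a b) <= c * (atan b - atan a).
Proof.
intros [Hc Hb] Hab.
assert (E : is_RInt (fun x => c * wt x) a b (c * (atan b - atan a)))
  by exact (is_RInt_scal (V := R_NormedModule) wt a b c _ (is_RInt_wt a b)).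
rewrite <- (is_RInt_unique (V := R_CompleteNormedModule) _ _ _ _ E).
apply cint_bound; auto. eexists; exact E.
Qed.

(** Enlarging the interval beyond the one from [- A] to [A] changes the integral by
at most [2 c / A]; this is the Cauchy criterion for the improper integral. *)
Lemma cint_tame_tail f c A a b : tame f c -> 0 < A -> a <= - A -> A <= b ->
  Cmod (cint f a b - cint f (- A) A) <= c * (2 / A).
Proof.
intros Hf HA Ha Hb. assert (Hc := proj1 Hf).
rewrite (cint_Chasles f a (- A) b Hc), (cint_Chasles f (- A) A b Hc).
replace (_ + (_ + _) - _)%C with (cint f a (- A) + cint f A b)%C by ring.
apply Rle_trans with (1 := Cmod_triangle _ _).
assert (H1 := cint_tame_atan f c _ _ Hf Ha). assert (H2 := cint_tame_atan f c _ _ Hf Hb).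
rewrite atan_opp in H1.
assert (T := atan_tail A HA). assert (B1 := atan_bound a). assert (B2 := atan_bound b).
assert (c0 := tame_nonneg f c Hf).
apply Rle_trans with (c * (- atan A - atan a) + c * (atan b - atan A)); [lra|].
rewrite <- Rmult_plus_distr_l. apply Rmult_le_compat_l; [exact c0|].
unfold Rdiv in *; lra.
Qed.

Lemma small_tail c eps : 0 <= c -> 0 < eps -> exists A, 0 < A /\ forall B, A <= B -> c * (2 / B) < eps.
Proof.
intros Hc He. exists ((2 * c + 1) / eps).
assert (HA : 0 < (2 * c + 1) / eps) by (apply Rdiv_lt_0_compat; lra).
split; [exact HA|]. intros B HB.
assert (HB0 : 0 < B) by lra.
replace (c * (2 / B)) with ((2 * c) / B) by (field; lra).
apply (Rmult_lt_reg_r B); [exact HB0|]. replace (2 * c / B * B) with (2 * c) by (field; lra).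
assert ((2 * c + 1) / eps * eps <= B * eps) by (apply Rmult_le_compat_r; lra).
replace ((2 * c + 1) / eps * eps) with (2 * c + 1) in H by (field; lra). lra.
Qed.

Lemma prod_tails A : filter_prod (Rbar_locally m_infty) (Rbar_locally p_infty)
   (fun ab => fst ab <= - A /\ A <= snd ab).
Proof.
apply (Filter_prod _ _ _ (fun x => x <= - A) (fun x => A <= x)).
- exists (- A); intros; lra.
- exists A; intros; lra.
- intros; simpl; auto.
Qed.

Lemma tame_line f c : tame f c ->
  is_RInt_gen (V := C_R_NormedModule) f (Rbar_locally m_infty) (Rbar_locally p_infty) (CRInt_line f).
Proof.
intros Hf. assert (Hc := proj1 Hf). assert (c0 := tame_nonneg f c Hf).
apply (RInt_gen_correct (V := C_R_CompleteNormedModule)).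
destruct (proj1 (filterlim_locally_cauchy (U := C_R_CompleteNormedModule)
  (F := filter_prod (Rbar_locally m_infty) (Rbar_locally p_infty)) (fun ab => cint f (fst ab) (snd ab)))) as [l Hl].
- intros eps. destruct (small_tail c (eps / 2) c0 (is_pos_div_2 eps)) as [A [HA HB]].
  exists (fun ab => fst ab <= - A /\ A <= snd ab). split; [apply prod_tails|].
  intros [a b] [a' b'] [H1 H2] [H3 H4]; simpl in *.
  apply C_NormedModule_mixin_compat1. change (Cmod (cint f a' b' - cint f a b) < eps).
  assert (K1 := cint_tame_tail f c A a b Hf HA H1 H2).
  assert (K2 := cint_tame_tail f c A a' b' Hf HA H3 H4).
  replace (cint f a' b' - cint f a b)%C with
    ((cint f a' b' - cint f (- A) A) + - (cint f a b - cint f (- A) A))%C by ring.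
  apply Rle_lt_trans with (1 := Cmod_triangle _ _). rewrite Cmod_opp.
  specialize (HB A (Rle_refl A)). lra.
- exists l. intros P HP. unfold filtermapi. generalize (Hl P HP). unfold filtermap. apply filter_imp.
  intros [a b] HPab. exists (cint f a b); split; [apply cint_correct, Hc|exact HPab].
Qed.

Lemma ball_Cmod (l y : C) (e : posreal) : ball (M := C_UniformSpace) l e y -> Cmod (y - l) < 2 * e.
Proof.
destruct y as [y1 y2], l as [l1 l2]. intros [B1 B2]; simpl in *.
unfold ball in B1, B2; simpl in B1, B2; unfold AbsRing_ball, abs, minus, plus, opp in B1, B2; simpl in B1, B2.
apply Rle_lt_trans with (1 := Cmod_le_2max _). simpl.
apply Rmult_lt_compat_l; [lra|]. apply Rmax_lub_lt; assumption.
Qed.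

Lemma is_RInt_gen_cint_eps (Fa Fb : (R -> Prop) -> Prop) f l : Filter Fa -> Filter Fb ->
  is_RInt_gen (V := C_R_NormedModule) f Fa Fb l ->
  forall eps, 0 < eps -> filter_prod Fa Fb (fun ab => Cmod (cint f (fst ab) (snd ab) - l) < eps).
Proof.
intros HFa HFb H eps He.
assert (K : filter_prod Fa Fb (fun ab => exists y, is_RInt (V := C_R_NormedModule) f (fst ab) (snd ab) y /\ ball (M := C_UniformSpace) l (mkposreal _ (is_pos_div_2 (mkposreal eps He))) y)).
{ apply (H (fun y => ball (M := C_UniformSpace) l (mkposreal _ (is_pos_div_2 (mkposreal eps He))) y)).
  eexists; intros y Hy; exact Hy. }
revert K; apply filter_imp. intros [a b] [y [H1 H2]]. simpl in *.
rewrite (cint_unique _ _ _ _ H1).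
apply (ball_Cmod l y (mkposreal _ (is_pos_div_2 (mkposreal eps He)))) in H2. simpl in H2. lra.
Qed.

Lemma line_tail f c A : tame f c -> 0 < A ->
  Cmod (CRInt_line f - cint f (- A) A) <= c * (2 / A).
Proof.
intros Hf HA. apply le_epsilon. intros eps He.
assert (K := is_RInt_gen_cint_eps _ _ _ _ _ _ (tame_line f c Hf) eps He).
assert (K2 := filter_and _ _ K (prod_tails A)).
destruct (filter_ex _ K2) as [[a b] [H1 [H2 H3]]]. simpl in *.
replace (CRInt_line f - cint f (- A) A)%C with
  (- (cint f a b - CRInt_line f) + (cint f a b - cint f (- A) A))%C by ring.
apply Rle_trans with (1 := Cmod_triangle _ _). rewrite Cmod_opp.
assert (K3 := cint_tame_tail f c A a b Hf HA H2 H3). lra.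
Qed.

Lemma line_approx f c : tame f c -> forall eps, 0 < eps ->
  exists A, 0 < A /\ forall B, A <= B -> Cmod (CRInt_line f - cint f (- B) B) < eps.
Proof.
intros Hf eps He. destruct (small_tail c eps (tame_nonneg _ _ Hf) He) as [A [HA HB]].
exists A; split; [exact HA|]. intros B HAB.
apply Rle_lt_trans with (2 := HB B HAB). apply line_tail; [exact Hf|lra].
Qed.

Lemma Cmod_eq_eps (a b : C) : (forall eps, 0 < eps -> Cmod (a - b) <= eps) -> a = b.
Proof.
intros H. apply Ceq_minus, Cmod_eq_0, Rle_antisym; [|apply Cmod_ge_0].
apply le_epsilon; intros; rewrite Rplus_0_l; apply H; assumption.
Qed.

(** As convergence is known, symmetric intervals suffice to compute the value. *)
Lemma line_char f c l : tame f c -> (forall eps, 0 < eps ->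
  exists A, 0 < A /\ forall B, A <= B -> Cmod (cint f (- B) B - l) <= eps) -> CRInt_line f = l.
Proof.
intros Hf H. apply Cmod_eq_eps. intros eps He.
destruct (H (eps / 2)) as [A [HA H1]]; [lra|].
destruct (line_approx f c Hf (eps / 2)) as [A' [HA' H2]]; [lra|].
specialize (H1 (Rmax A A') (Rmax_l _ _)). specialize (H2 (Rmax A A') (Rmax_r _ _)).
replace (CRInt_line f - l)%C with ((CRInt_line f - cint f (- Rmax A A') (Rmax A A')) + (cint f (- Rmax A A') (Rmax A A') - l))%C by ring.
apply Rle_trans with (1 := Cmod_triangle _ _). lra.
Qed.

Lemma line_bound f c : tame f c -> Cmod (CRInt_line f) <= c * PI.
Proof.
intros Hf. apply le_epsilon. intros eps He.
destruct (line_approx f c Hf eps He) as [A [HA H]]. specialize (H A (Rle_refl A)).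
replace (CRInt_line f) with ((CRInt_line f - cint f (- A) A) + cint f (- A) A)%C by ring.
apply Rle_trans with (1 := Cmod_triangle _ _).
assert (K := cint_tame_atan f c (- A) A Hf ltac:(lra)).
assert (B1 := atan_bound A). rewrite atan_opp in K.
assert (c * (atan A - - atan A) <= c * PI); [|lra].
apply Rmult_le_compat_l; [exact (tame_nonneg _ _ Hf)|lra].
Qed.

Lemma tame_ext f g c : (forall x, f x = g x) -> tame f c -> tame g c.
Proof. intros E [H1 H2]; split; [exact (ccont_ext f g E H1)|]; intros; rewrite <- E; apply H2. Qed.

Lemma line_ext f g : (forall x, f x = g x) -> CRInt_line f = CRInt_line g.
Proof.
intros E. unfold CRInt_line. f_equal. apply functional_extensionality. exact E.
Qed.

Lemma tame_plus f g c d : tame f c -> tame g d -> tame (fun x => f x + g x)%C (c + d).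
Proof.
intros [H1 H2] [H3 H4]; split; [apply ccont_plus; assumption|]. intros x.
apply Rle_trans with (1 := Cmod_triangle _ _). specialize (H2 x); specialize (H4 x). lra.
Qed.

Lemma tame_scal a f c : tame f c -> tame (fun x => a * f x)%C (Cmod a * c).
Proof.
intros [H1 H2]; split; [apply ccont_mult; [apply ccont_const|assumption]|]. intros x.
rewrite Cmod_mult, Rmult_assoc. apply Rmult_le_compat_l; [apply Cmod_ge_0|apply H2].
Qed.

Lemma line_plus f g c d : tame f c -> tame g d ->
  CRInt_line (fun x => f x + g x)%C = (CRInt_line f + CRInt_line g)%C.
Proof.
intros Hf Hg. apply (line_char _ _ _ (tame_plus _ _ _ _ Hf Hg)). intros eps He.
destruct (line_approx f c Hf (eps / 2)) as [A [HA H1]]; [lra|].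
destruct (line_approx g d Hg (eps / 2)) as [A' [HA' H2]]; [lra|].
exists (Rmax A A'). split; [apply Rlt_le_trans with (1 := HA), Rmax_l|]. intros B HB.
specialize (H1 B (Rle_trans _ _ _ (Rmax_l _ _) HB)). specialize (H2 B (Rle_trans _ _ _ (Rmax_r _ _) HB)).
rewrite cint_plus; [|exact (proj1 Hf)|exact (proj1 Hg)].
replace (_ + _ - _)%C with (- ((CRInt_line f - cint f (- B) B) + (CRInt_line g - cint g (- B) B)))%C by ring.
rewrite Cmod_opp. apply Rle_trans with (1 := Cmod_triangle _ _). lra.
Qed.

Lemma line_scal a f c : tame f c -> CRInt_line (fun x => a * f x)%C = (a * CRInt_line f)%C.
Proof.
intros Hf. apply (line_char _ _ _ (tame_scal a _ _ Hf)). intros eps He.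
assert (HM : 0 < Cmod a + 1) by (assert (H := Cmod_ge_0 a); lra).
destruct (line_approx f c Hf (eps / (Cmod a + 1))) as [A [HA H1]]; [apply Rdiv_lt_0_compat; lra|].
exists A; split; [exact HA|]. intros B HB. specialize (H1 B HB).
rewrite cint_scal by exact (proj1 Hf).
replace (_ - _)%C with (- (a * (CRInt_line f - cint f (- B) B)))%C by ring.
rewrite Cmod_opp, Cmod_mult.
apply Rle_trans with ((Cmod a + 1) * (eps / (Cmod a + 1))); [|right; field; lra].
apply Rmult_le_compat; try apply Cmod_ge_0; lra.
Qed.

Lemma line_minus f g c d : tame f c -> tame g d ->
  CRInt_line (fun x => f x - g x)%C = (CRInt_line f - CRInt_line g)%C.
Proof.
intros Hf Hg. rewrite (line_ext _ (fun x => f x + (-(1)) * g x)%C) by (intros; ring).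
rewrite (line_plus _ _ _ _ Hf (tame_scal _ _ _ Hg)), (line_scal _ _ _ Hg). ring.
Qed.

Lemma tame_minus f g c d : tame f c -> tame g d -> tame (fun x => f x - g x)%C (c + d).
Proof.
intros Hf Hg. apply tame_ext with (fun x => f x + (-(1)) * g x)%C; [intros; ring|].
replace d with (Cmod (-(1)) * d) by (rewrite Cmod_opp, Cmod_1; ring).
apply tame_plus; [|apply tame_scal]; assumption.
Qed.

Lemma line_FTC F f : (exists c, tame F c) -> (exists c, tame f c) ->
  (forall x, cderive F x (f x)) -> CRInt_line f = 0.
Proof.
intros [c' [_ HF']] [c Hf] HF. apply (line_char _ _ _ Hf). intros eps He.
assert (c0 : 0 <= c').
{ specialize (HF' 0). assert (P := wt_pos 0). assert (Q := Cmod_ge_0 (F 0)). nra. }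
destruct (small_tail c' eps c0 He) as [A [HA HAB]]. exists A. split; [exact HA|]. intros B HB.
specialize (HAB B HB). assert (B0 : 0 < B) by lra.
assert (W : wt B <= / B). { unfold wt. apply Rinv_le_contravar; [exact B0|nra]. }
assert (M1 := HF' B). assert (M2 := HF' (- B)).
replace (wt (- B)) with (wt B) in M2 by (unfold wt; f_equal; ring).
rewrite (cint_FTC F f _ _ HF (proj1 Hf)).
replace (_ - _)%C with (F B + - F (- B)%R)%C by ring.
apply Rle_trans with (1 := Cmod_triangle _ _). rewrite Cmod_opp.
replace (c' * (2 / B)) with (2 * (c' * / B)) in HAB by (field; lra).
assert (c' * wt B <= c' * / B) by (apply Rmult_le_compat_l; lra). lra.
Qed.

(** The form in which integration by parts is used: a relation between two
integrals whose combination is an exact derivative. *)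
Lemma line_FTC2 F f g a b : (exists c, tame F c) -> (exists c, tame f c) -> (exists c, tame g c) ->
  (forall x, cderive F x (a * f x + b * g x)%C) -> (a * CRInt_line f + b * CRInt_line g)%C = 0.
Proof.
intros HF [c Hf] [d Hg] HD. rewrite <- (line_scal _ _ _ Hf), <- (line_scal _ _ _ Hg).
rewrite <- (line_plus _ _ _ _ (tame_scal a _ _ Hf) (tame_scal b _ _ Hg)).
apply (line_FTC F); [exact HF| |exact HD].
eexists. exact (tame_plus _ _ _ _ (tame_scal a _ _ Hf) (tame_scal b _ _ Hg)).
Qed.

Lemma cint_comp_lin f (k v a b : R) : ccont f ->
  cint (fun x : R => k * f (k * x + v)%R)%C a b = cint f (k * a + v) (k * b + v).
Proof.
intros Hf. apply cint_unique.
apply (is_RInt_ext (V := C_R_NormedModule) (fun x => scal k (f (k * x + v)))).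
- intros; apply scal_R_Cmult.
- apply (is_RInt_comp_lin (V := C_R_NormedModule)), cint_correct, Hf.
Qed.

Lemma line_comp_lin f c (k v : R) c' : tame f c -> 0 < k -> tame (fun x : R => k * f (k * x + v)%R)%C c' ->
  CRInt_line (fun x : R => k * f (k * x + v)%R)%C = CRInt_line f.
Proof.
intros Hf Hk Hg. apply (line_char _ _ _ Hg). intros eps He.
assert (c0 := tame_nonneg _ _ Hf).
destruct (small_tail c (eps / 2) c0 ltac:(lra)) as [A [HA HB]].
exists ((A + Rabs v) / k). split.
{ apply Rdiv_lt_0_compat; [|exact Hk]. assert (H := Rabs_pos v). lra. }
intros B HAB. rewrite cint_comp_lin by exact (proj1 Hf).
assert (K : A + Rabs v <= k * B).
{ replace (A + Rabs v) with (k * ((A + Rabs v) / k)) by (field; lra). apply Rmult_le_compat_l; lra. }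
assert (Hv1 := Rle_abs v). assert (Hv2 := Rle_abs (- v)). rewrite Rabs_Ropp in Hv2.
assert (T1 := cint_tame_tail f c A (k * - B + v) (k * B + v) Hf HA ltac:(lra) ltac:(lra)).
assert (T2 := line_tail f c A Hf HA). specialize (HB A (Rle_refl A)).
replace (_ - _)%C with ((cint f (k * - B + v) (k * B + v) - cint f (- A) A) + - (CRInt_line f - cint f (- A) A))%C by ring.
apply Rle_trans with (1 := Cmod_triangle _ _). rewrite Cmod_opp. lra.
Qed.

(** * Series of integrals, and Fubini on rectangles *)

Definition csum_n (a : nat -> C) (n : nat) : C := sum_n (G := C_AbelianMonoid) a n.

(** Convergence in epsilon form, without reference to a module structure on [C]. *)
Definition csum (a : nat -> C) (l : C) : Prop :=
  forall eps, 0 < eps -> exists N, forall n, (N <= n)%nat -> Cmod (csum_n a n - l) <= eps.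

Lemma csum_n_O a : csum_n a 0 = a 0%nat.
Proof. unfold csum_n; apply sum_O. Qed.

Lemma csum_n_S a n : csum_n a (S n) = (csum_n a n + a (S n))%C.
Proof. unfold csum_n; apply (sum_Sn (G := C_AbelianMonoid)). Qed.

Lemma csum_is_series a l : csum a l <-> is_series (K := C_AbsRing) (V := C_NormedModule) a l.
Proof.
split; intros H.
- intros P [eps HP]. destruct (H (eps / 2) (is_pos_div_2 eps)) as [N HN].
  exists N. intros n Hn. apply HP. apply C_NormedModule_mixin_compat1.
  specialize (HN n Hn). change (Cmod (csum_n a n - l) < eps).
  assert (K := cond_pos eps). lra.
- intros eps He.
  set (e := mkposreal _ (is_pos_div_2 (mkposreal eps He))).
  assert (L : locally (T := C_UniformSpace) l (ball (M := C_UniformSpace) l e)) by apply locally_ball.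
  destruct (H _ L) as [N HN].
  exists N. intros n Hn. specialize (HN n Hn). fold (csum_n a n) in HN.
  apply ball_Cmod in HN. simpl in HN. change (Cmod (csum_n a n - l) < 2 * (eps / 2)) in HN. lra.
Qed.

Lemma csum_unique a l l' : csum a l -> csum a l' -> l = l'.
Proof.
intros H H'. apply Cmod_eq_eps. intros eps He.
destruct (H (eps / 2)) as [N HN]; [lra|]. destruct (H' (eps / 2)) as [N' HN']; [lra|].
specialize (HN (N + N')%nat ltac:(lia)). specialize (HN' (N + N')%nat ltac:(lia)).
replace (l - l')%C with (- (csum_n a (N + N') - l) + (csum_n a (N + N') - l'))%C by ring.
apply Rle_trans with (1 := Cmod_triangle _ _). rewrite Cmod_opp. lra.
Qed.

Lemma CSeries_eq a l : csum a l -> CSeries a = l.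
Proof.
intros H. unfold CSeries. apply (iota_unique (V := C_CompleteNormedModule)).
- intros y Hy. apply csum_unique with a; [apply csum_is_series; exact Hy|exact H].
- apply csum_is_series, H.
Qed.

Lemma csum_ext a b l : (forall n, a n = b n) -> csum a l -> csum b l.
Proof.
intros E H eps He. destruct (H eps He) as [N HN]; exists N; intros n Hn.
replace (csum_n b n) with (csum_n a n); [auto|].
apply (sum_n_ext (G := C_AbelianMonoid)), E.
Qed.

Lemma csum_n_scal c a n : csum_n (fun k => c * a k)%C n = (c * csum_n a n)%C.
Proof.
induction n as [|n IH]; [rewrite !csum_n_O; reflexivity|].
rewrite !csum_n_S, IH. ring.
Qed.

Lemma csum_scal c a l : csum a l -> csum (fun n => c * a n)%C (c * l)%C.
Proof.
intros H eps He.
assert (HM : 0 < Cmod c + 1) by (assert (K := Cmod_ge_0 c); lra).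
destruct (H (eps / (Cmod c + 1))) as [N HN]; [apply Rdiv_lt_0_compat; lra|].
exists N; intros n Hn. rewrite csum_n_scal.
replace (_ - _)%C with (c * (csum_n a n - l))%C by ring. rewrite Cmod_mult.
apply Rle_trans with ((Cmod c + 1) * (eps / (Cmod c + 1))); [|right; field; lra].
apply Rmult_le_compat; try apply Cmod_ge_0; auto; lra.
Qed.

Lemma csum_fst a l : csum a l -> is_series (K := R_AbsRing) (V := R_NormedModule) (fun n => fst (a n)) (fst l).
Proof.
intros H. assert (E : forall n, sum_n (G := R_AbelianMonoid) (fun k => fst (a k)) n = fst (csum_n a n)).
{ intros n; induction n as [|n IH]; [rewrite csum_n_O, sum_O; reflexivity|].
  rewrite csum_n_S, sum_Sn, IH. reflexivity. }
intros P [eps HP]. destruct (H (eps / 2) (is_pos_div_2 eps)) as [N HN].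
exists N. intros n Hn. apply HP. rewrite E.
unfold ball; simpl; unfold AbsRing_ball, abs, minus, plus, opp; simpl.
change (Rabs (fst (csum_n a n - l)%C) < eps).
apply Rle_lt_trans with (1 := re_le_Cmod _).
apply Rle_lt_trans with (1 := HN n Hn). assert (K := cond_pos eps). lra.
Qed.

Lemma sum_n_le_series (b : nat -> R) n m : (forall k, 0 <= b k) -> (n <= m)%nat -> sum_n b n <= sum_n b m.
Proof.
intros Hb Hnm. induction Hnm as [|m Hnm IH]; [lra|].
rewrite sum_Sn. unfold plus; simpl. specialize (Hb (S m)). lra.
Qed.

Lemma sum_n_le_Series (b : nat -> R) n : (forall k, 0 <= b k) -> ex_series b -> sum_n b n <= Series b.
Proof.
intros Hb Hex. assert (H := Series_correct b Hex).
apply (is_lim_seq_le_loc (fun _ => sum_n b n) (sum_n b) (sum_n b n) (Series b)).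
- exists n. intros m Hm. apply sum_n_le_series; assumption.
- apply is_lim_seq_const.
- exact H.
Qed.

Lemma csum_n_diff (u : nat -> C) (b : nat -> R) n m : (forall k, Cmod (u k) <= b k) -> (n <= m)%nat ->
  Cmod (csum_n u m - csum_n u n) <= sum_n b m - sum_n b n.
Proof.
intros Hu Hnm. induction Hnm as [|m Hnm IH].
- replace (csum_n u n - csum_n u n)%C with (RtoC 0) by ring. rewrite Cmod_0. lra.
- rewrite csum_n_S, sum_Sn. unfold plus; simpl.
  replace (_ + _ - _)%C with ((csum_n u m - csum_n u n) + u (S m))%C by ring.
  apply Rle_trans with (1 := Cmod_triangle _ _). specialize (Hu (S m)). lra.
Qed.

(** Weierstrass's test together with its estimate of the remainder. *)
Lemma csum_dominated (u : nat -> C) (b : nat -> R) : (forall k, Cmod (u k) <= b k) -> ex_series b ->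
  exists l, csum u l /\ forall n, Cmod (l - csum_n u n) <= Series b - sum_n b n.
Proof.
intros Hu Hb.
assert (b0 : forall k, 0 <= b k) by (intros k; apply Rle_trans with (2 := Hu k), Cmod_ge_0).
destruct (ex_series_le (K := C_AbsRing) (V := C_CompleteNormedModule) u b) as [l Hl].
- intros n. change (Cmod (u n) <= b n). apply Hu.
- exact Hb.
- assert (Hc : csum u l) by (apply csum_is_series; exact Hl).
  exists l. split; [exact Hc|]. intros n. apply le_epsilon. intros eps He.
  destruct (Hc eps He) as [N HN]. specialize (HN (N + n)%nat ltac:(lia)).
  assert (K := csum_n_diff u b n (N + n) Hu ltac:(lia)).
  assert (K2 := sum_n_le_Series b (N + n) b0 Hb).
  replace (l - csum_n u n)%C with (- (csum_n u (N + n) - l) + (csum_n u (N + n) - csum_n u n))%C by ring.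
  apply Rle_trans with (1 := Cmod_triangle _ _). rewrite Cmod_opp. lra.
Qed.

Lemma Series_tail_small (b : nat -> R) : ex_series b -> forall eps, 0 < eps ->
  exists N, forall n, (N <= n)%nat -> Series b - sum_n b n < eps.
Proof.
intros Hb eps He. assert (H := Series_correct b Hb).
destruct (H (ball (Series b) (mkposreal eps He)) (locally_ball _ _)) as [N HN].
exists N. intros n Hn. specialize (HN n Hn).
unfold ball in HN; simpl in HN; unfold AbsRing_ball, abs, minus, plus, opp in HN; simpl in HN.
change (Rabs (sum_n b n + - Series b) < eps) in HN. apply Rabs_def2 in HN. lra.
Qed.

Lemma ccont_csum_n (f : nat -> R -> C) n : (forall k, ccont (f k)) -> ccont (fun x => csum_n (fun k => f k x) n).
Proof.
intros H; induction n as [|n IH].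
- apply (ccont_ext (f 0%nat)); [intros; rewrite csum_n_O; reflexivity|apply H].
- apply (ccont_ext (fun x => csum_n (fun k => f k x) n + f (S n) x)%C); [intros; rewrite csum_n_S; reflexivity|].
  apply ccont_plus; [exact IH|apply H].
Qed.

Lemma ex_series_scal_Rr (c : R) (b : nat -> R) : ex_series b -> ex_series (fun n => b n * c).
Proof. intros [l H]. exists (l * c). apply is_series_scal_r, H. Qed.

Lemma line_csum_n (f : nat -> R -> C) (b : nat -> R) n : (forall k, tame (f k) (b k)) ->
  tame (fun x => csum_n (fun k => f k x) n) (sum_n b n) /\
  CRInt_line (fun x => csum_n (fun k => f k x) n) = csum_n (fun k => CRInt_line (f k)) n.
Proof.
intros H; induction n as [|n [IH1 IH2]].
- rewrite sum_O, csum_n_O. split.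
  + apply (tame_ext (f 0%nat)); [intros; rewrite csum_n_O; reflexivity|apply H].
  + apply line_ext; intros; apply csum_n_O.
- rewrite sum_Sn, csum_n_S. split.
  + apply (tame_ext (fun x => csum_n (fun k => f k x) n + f (S n) x)%C); [intros; rewrite csum_n_S; reflexivity|].
    apply tame_plus; [exact IH1|apply H].
  + rewrite <- IH2. rewrite <- (line_plus _ _ _ _ IH1 (H (S n))). apply line_ext; intros; apply csum_n_S.
Qed.

(** Termwise integration.  The remainder of the series at [x] is at most the
remainder of [sum b] times [wt x]: this yields the continuity of the sum, and
the convergence of the integrals after integrating the weight. *)
Lemma line_series (f : nat -> R -> C) (b : nat -> R) : (forall n, tame (f n) (b n)) -> ex_series b ->
  exists F, (forall x, csum (fun n => f n x) (F x)) /\ tame F (Series b) /\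
    csum (fun n => CRInt_line (f n)) (CRInt_line F).
Proof.
intros Hf Hb.
assert (b0 : forall k, 0 <= b k) by (intros k; apply (tame_nonneg _ _ (Hf k))).
assert (D : forall x, exists l, csum (fun n => f n x) l /\
   forall n, Cmod (l - csum_n (fun k => f k x) n) <= (Series b - sum_n b n) * wt x).
{ intros x. destruct (csum_dominated (fun n => f n x) (fun n => b n * wt x)) as [l [H1 H2]].
  - intros k; apply Hf.
  - apply ex_series_scal_Rr, Hb.
  - exists l; split; [exact H1|]. intros n. apply Rle_trans with (1 := H2 n).
    right. rewrite Rmult_minus_distr_r. f_equal.
    + apply Series_scal_r.
    + induction n as [|n IH]; [rewrite !sum_O; reflexivity|].
      rewrite !sum_Sn, IH. unfold plus; simpl. ring. }
assert (EF : exists F : R -> C, forall x, csum (fun n => f n x) (F x) /\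
   forall n, Cmod (F x - csum_n (fun k => f k x) n) <= (Series b - sum_n b n) * wt x).
{ exists (fun x => epsilon (inhabits (RtoC 0)) (fun l => csum (fun n => f n x) l /\
   forall n, Cmod (l - csum_n (fun k => f k x) n) <= (Series b - sum_n b n) * wt x)).
  intros x. apply epsilon_spec, D. }
destruct EF as [F HF]. exists F.
assert (CF : ccont F).
{ apply ccont_of_eps. intros x eps He.
  destruct (Series_tail_small b Hb (eps / 3)) as [N HN]; [lra|].
  specialize (HN N (Nat.le_refl N)).
  destruct (ccont_eps _ (ccont_csum_n f N (fun k => proj1 (Hf k))) x (eps / 3)) as [d [Hd Hy]]; [lra|].
  exists d; split; [exact Hd|]. intros y Hyd. specialize (Hy y Hyd).
  assert (K1 := proj2 (HF x) N). assert (K2 := proj2 (HF y) N).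
  assert (P : 0 <= Series b - sum_n b N) by (assert (Q := sum_n_le_Series b N b0 Hb); lra).
  assert (M : forall z, (Series b - sum_n b N) * wt z <= eps / 3).
  { intros z. assert (Q1 := wt_le_1 z). assert (Q := wt_pos z). nra. }
  specialize (M x) as M1; specialize (M y) as M2.
  replace (F y - F x)%C with ((F y - csum_n (fun k => f k y) N) + ((csum_n (fun k => f k y) N - csum_n (fun k => f k x) N)
     + - (F x - csum_n (fun k => f k x) N)))%C by ring.
  apply Rle_trans with (1 := Cmod_triangle _ _).
  assert (T := Cmod_triangle (csum_n (fun k => f k y) N - csum_n (fun k => f k x) N) (- (F x - csum_n (fun k => f k x) N))).
  rewrite Cmod_opp in T. lra. }
assert (TD : forall n, tame (fun x => F x - csum_n (fun k => f k x) n)%C (Series b - sum_n b n)).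
{ intros n; split.
  - apply ccont_minus; [exact CF|]. apply ccont_csum_n. intros k; apply (proj1 (Hf k)).
  - intros x. apply HF. }
assert (TF : tame F (Series b)).
{ assert (K := tame_plus _ _ _ _ (TD 0%nat) (proj1 (line_csum_n f b 0 Hf))).
  replace (Series b - sum_n b 0 + sum_n b 0) with (Series b) in K by ring.
  revert K. apply tame_ext. intros; ring. }
split; [intros x; apply HF|]. split; [exact TF|].
intros eps He. destruct (Series_tail_small b Hb (eps / PI)) as [N HN].
{ apply Rdiv_lt_0_compat; [exact He|apply PI_RGT_0]. }
exists N. intros n Hn. specialize (HN n Hn).
destruct (line_csum_n f b n Hf) as [T E]. rewrite <- E.
replace (_ - _)%C with (- (CRInt_line F - CRInt_line (fun x => csum_n (fun k => f k x) n)))%C by ring.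
rewrite Cmod_opp, <- (line_minus _ _ _ _ TF T).
apply Rle_trans with (1 := line_bound _ _ (TD n)).
assert (PP := PI_RGT_0).
apply Rle_trans with (eps / PI * PI); [|right; field; lra].
apply Rmult_le_compat_r; lra.
Qed.

Definition cont2 (F : R -> R -> R) := forall x y, continuity_2d_pt F x y.

Lemma cont2_l F y : cont2 F -> forall x, continuous (fun x => F x y) x.
Proof.
intros H x. apply filterlim_locally. intros eps. destruct (H x y eps) as [d Hd].
exists d. intros z Hz. apply Hd; [exact Hz|]. replace (y - y) with 0 by ring. rewrite Rabs_R0. apply cond_pos.
Qed.

Lemma cont2_r F x : cont2 F -> forall y, continuous (fun y => F x y) y.
Proof.
intros H y. apply filterlim_locally. intros eps. destruct (H x y eps) as [d Hd].
exists d. intros z Hz. apply Hd; [|exact Hz]. replace (x - x) with 0 by ring. rewrite Rabs_R0. apply cond_pos.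
Qed.

Lemma cont2_RInt F c d : cont2 F -> forall x, continuous (fun x => RInt (fun y => F x y) c d) x.
Proof.
intros HF x0. apply filterlim_locally. intros eps.
assert (Hm : 0 < Rabs (d - c) + 1) by (assert (K := Rabs_pos (d - c)); lra).
assert (He : 0 < eps / (Rabs (d - c) + 1)) by (apply Rdiv_lt_0_compat; [apply cond_pos|exact Hm]).
destruct (uniform_continuity_2d_1d' F (Rmin c d) (Rmax c d) x0 (fun x _ => HF x0 x) (mkposreal _ He)) as [del Hdel].
exists del. intros x Hx.
unfold ball in *; simpl in *; unfold AbsRing_ball, abs, minus, plus, opp in *; simpl in *.
assert (X1 : forall x, ex_RInt (fun y => F x y) c d) by (intros; apply ex_RInt_cont; intros; apply cont2_r, HF).
assert (E : RInt (fun y => F x y) c d + - RInt (fun y => F x0 y) c d = RInt (fun y => F x y - F x0 y) c d).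
{ symmetry. apply (RInt_minus (V := R_CompleteNormedModule)); apply X1. }
rewrite E.
apply Rle_lt_trans with (Rabs (d - c) * (eps / (Rabs (d - c) + 1))).
- apply (norm_RInt_le_const_abs (V := R_NormedModule) (fun y => F x y - F x0 y) c d).
  + intros y Hy. left. change (Rabs (F x y - F x0 y) < eps / (Rabs (d - c) + 1)).
    assert (P := cond_pos del). apply Rabs_def2 in Hx.
    apply (Hdel y x0 y x); try assumption; try lra.
    replace (y - y) with 0 by ring. rewrite Rabs_R0. exact P.
  + apply (RInt_correct (V := R_CompleteNormedModule)).
    apply (ex_RInt_minus (V := R_NormedModule)); apply X1.
- assert (P := cond_pos eps). apply (Rmult_lt_reg_r (Rabs (d - c) + 1)); [exact Hm|].
  replace (Rabs (d - c) * (eps / (Rabs (d - c) + 1)) * (Rabs (d - c) + 1)) with (Rabs (d - c) * eps) by (field; lra).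
  lra.
Qed.

(** Both sides vanish for [b = a] and have the same derivative in [b]. *)
Lemma Fubini_rect F a b c d : cont2 F ->
  RInt (fun x => RInt (fun y => F x y) c d) a b = RInt (fun y => RInt (fun x => F x y) a b) c d.
Proof.
intros HF.
set (phi := fun b => RInt (fun x => RInt (fun y => F x y) c d) a b).
set (psi := fun b => RInt (fun y => RInt (fun x => F x y) a b) c d).
assert (D1 : forall b, is_derive phi b (RInt (fun y => F b y) c d)).
{ intros z. apply (is_derive_RInt (V := R_NormedModule) (fun x => RInt (fun y => F x y) c d) _ a z).
  - apply filter_forall; intros z'. apply (RInt_correct (V := R_CompleteNormedModule)), ex_RInt_cont.
    apply cont2_RInt, HF.
  - apply cont2_RInt, HF. }
assert (D0 : forall y z, is_derive (fun u => RInt (fun x => F x y) a u) z (F z y)).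
{ intros y z. apply (is_derive_RInt (V := R_NormedModule) (fun x => F x y) _ a z).
  - apply filter_forall; intros z'. apply (RInt_correct (V := R_CompleteNormedModule)), ex_RInt_cont.
    apply cont2_l, HF.
  - apply (cont2_l F y HF). }
assert (D2 : forall b, is_derive psi b (RInt (fun y => F b y) c d)).
{ intros z. eapply is_derive_eq.
  - apply (is_derive_RInt_param (fun u y => RInt (fun x => F x y) a u) c d z).
    + apply filter_forall; intros u y _. eexists; apply D0.
    + intros y _. apply (continuity_2d_pt_ext F); [|apply HF].
      intros u v. symmetry. apply is_derive_unique, D0.
    + apply filter_forall; intros u. apply ex_RInt_cont. intros y.
      apply (cont2_RInt (fun y x => F x y) a u). intros p q eps. destruct (HF q p eps) as [de Hde].
      exists de. intros; apply Hde; assumption.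
  - apply RInt_ext. intros y _. apply is_derive_unique, D0. }
assert (E : RtoC (phi b - psi b) = RtoC (phi a - psi a)).
{ apply (cderive_zero_const (fun z => RtoC (phi z - psi z))). intros z. apply cderive_RtoC.
  eapply is_derive_eq; [apply (is_derive_minus (K := R_AbsRing) (V := R_NormedModule)); [apply D1|apply D2]|].
  unfold minus, plus, opp; simpl; ring. }
apply RtoC_inj in E. revert E. unfold phi, psi.
rewrite (RInt_point (V := R_CompleteNormedModule) a (fun x => RInt (fun y => F x y) c d)).
rewrite (RInt_ext (fun y => RInt (fun x => F x y) a a) (fun _ => 0)).
- rewrite (RInt_const (V := R_CompleteNormedModule)). unfold scal, zero; simpl. unfold mult; simpl. lra.
- intros. apply (RInt_point (V := R_CompleteNormedModule)).
Qed.

Definition ccont2 (F : R -> R -> C) := cont2 (fun x y => fst (F x y)) /\ cont2 (fun x y => snd (F x y)).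

Lemma cFubini_rect F a b c d : ccont2 F ->
  cint (fun x => cint (fun y => F x y) c d) a b = cint (fun y => cint (fun x => F x y) a b) c d.
Proof.
intros [H1 H2]. unfold cint; simpl. f_equal.
- apply (Fubini_rect (fun x y => fst (F x y))), H1.
- apply (Fubini_rect (fun x y => snd (F x y))), H2.
Qed.

(** * Fubini on the line, and the complex exponential *)

Lemma ccont2_swap F : ccont2 F -> ccont2 (fun y x => F x y).
Proof.
intros [H1 H2]; split; intros p q eps;
 [destruct (H1 q p eps) as [de Hde] | destruct (H2 q p eps) as [de Hde]]; exists de; intros; apply Hde; assumption.
Qed.

Lemma ccont2_l F y : ccont2 F -> ccont (fun x => F x y).
Proof.
intros [H1 H2] x. split; [apply (cont2_l (fun x y => fst (F x y)) y H1)|apply (cont2_l (fun x y => snd (F x y)) y H2)].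
Qed.

Lemma ccont2_r F x : ccont2 F -> ccont (fun y => F x y).
Proof. intros H. apply (ccont2_l (fun y x => F x y)), ccont2_swap, H. Qed.

Lemma ccont2_cint F c d : ccont2 F -> ccont (fun x => cint (fun y => F x y) c d).
Proof.
intros [H1 H2] x. split; [apply (cont2_RInt (fun x y => fst (F x y)) c d H1)|apply (cont2_RInt (fun x y => snd (F x y)) c d H2)].
Qed.

Section FubiniLine.
Variables (F : R -> R -> C) (c : R).
Hypothesis HC : ccont2 F.
Hypothesis HB : forall x y, Cmod (F x y) <= c * (wt x * wt y).

Let Ht x : tame (fun y => F x y) (c * wt x).
Proof. split; [apply ccont2_r, HC|]. intros y. apply Rle_trans with (1 := HB x y). right; ring. Qed.

Let c0 : 0 <= c.
Proof.
assert (K := HB 0 0). assert (K2 := Cmod_ge_0 (F 0 0)). assert (K3 := wt_pos 0).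
assert (0 < wt 0 * wt 0) by nra. nra.
Qed.

Lemma inner_tail x A : 0 < A ->
  Cmod (CRInt_line (fun y => F x y) - cint (fun y => F x y) (- A) A) <= c * (2 / A) * wt x.
Proof. intros HA. apply Rle_trans with (1 := line_tail _ _ A (Ht x) HA). right; ring. Qed.

Lemma inner_tame : tame (fun x => CRInt_line (fun y => F x y)) (c * PI).
Proof.
split.
- apply ccont_of_eps. intros x eps He.
  destruct (small_tail c (eps / 3) c0) as [A [HA HAB]]; [lra|]. specialize (HAB A (Rle_refl A)).
  destruct (ccont_eps _ (ccont2_cint F (- A) A HC) x (eps / 3)) as [d [Hd Hy]]; [lra|].
  exists d; split; [exact Hd|]. intros y Hyd. specialize (Hy y Hyd).
  assert (K : forall z, Cmod (CRInt_line (fun y => F z y) - cint (fun y => F z y) (- A) A) <= eps / 3).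
  { intros z. apply Rle_trans with (1 := inner_tail z A HA).
    assert (T := wt_le_1 z). assert (T2 := wt_pos z).
    assert (0 <= c * (2 / A)). { apply Rmult_le_pos; [exact c0|]. left; apply Rdiv_lt_0_compat; lra. }
    nra. }
  assert (K1 := K x). assert (K2 := K y).
  replace (CRInt_line (fun y0 => F y y0) - CRInt_line (fun y0 => F x y0))%C with
    ((CRInt_line (fun y0 => F y y0) - cint (fun y0 => F y y0) (- A) A) +
     ((cint (fun y0 => F y y0) (- A) A - cint (fun y0 => F x y0) (- A) A) +
      - (CRInt_line (fun y0 => F x y0) - cint (fun y0 => F x y0) (- A) A)))%C by ring.
  apply Rle_trans with (1 := Cmod_triangle _ _).
  assert (T := Cmod_triangle (cint (fun y0 => F y y0) (- A) A - cint (fun y0 => F x y0) (- A) A)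
      (- (CRInt_line (fun y0 => F x y0) - cint (fun y0 => F x y0) (- A) A))).
  rewrite Cmod_opp in T. lra.
- intros x. apply Rle_trans with (1 := line_bound _ _ (Ht x)). right; ring.
Qed.

(** The iterated integral over the plane is close to the one over a large square,
at a rate that does not depend on the order of integration. *)
Lemma iterated_approx A : 0 < A ->
  Cmod (CRInt_line (fun x => CRInt_line (fun y => F x y)) -
        cint (fun x => cint (fun y => F x y) (- A) A) (- A) A) <= (2 * c * PI) * (2 / A).
Proof.
intros HA.
assert (T2 : tame (fun x => cint (fun y => F x y) (- A) A) (c * PI)).
{ split; [apply ccont2_cint, HC|]. intros x.
  apply Rle_trans with (1 := cint_tame_atan _ _ (- A) A (Ht x) ltac:(lra)).
  rewrite atan_opp. assert (B1 := atan_bound A).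
  replace (c * PI * wt x) with (c * wt x * PI) by ring.
  apply Rmult_le_compat_l; [|lra]. apply Rmult_le_pos; [exact c0|left; apply wt_pos]. }
assert (T3 : tame (fun x => CRInt_line (fun y => F x y) - cint (fun y => F x y) (- A) A)%C (c * (2 / A))).
{ split; [apply ccont_minus; [apply inner_tame|apply T2]|]. intros x; apply inner_tail, HA. }
assert (K1 := line_bound _ _ T3). rewrite (line_minus _ _ _ _ inner_tame T2) in K1.
assert (K2 := line_tail _ _ A T2 HA).
set (a := CRInt_line (fun x => CRInt_line (fun y => F x y))) in *.
set (b := CRInt_line (fun x => cint (fun y => F x y) (- A) A)) in *.
replace (a - _)%C with ((a - b) + (b - cint (fun x => cint (fun y => F x y) (- A) A) (- A) A))%C by ring.
apply Rle_trans with (1 := Cmod_triangle _ _). lra.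
Qed.
End FubiniLine.

Lemma Fubini_line (F : R -> R -> C) c : ccont2 F ->
  (forall x y, Cmod (F x y) <= c * (wt x * wt y)) ->
  CRInt_line (fun x => CRInt_line (fun y => F x y)) = CRInt_line (fun y => CRInt_line (fun x => F x y)).
Proof.
intros HC HB. apply Cmod_eq_eps. intros eps He.
assert (c0 : 0 <= c).
{ assert (K := HB 0 0). assert (K2 := Cmod_ge_0 (F 0 0)). assert (K3 := wt_pos 0).
  assert (0 < wt 0 * wt 0) by nra. nra. }
destruct (small_tail (2 * c * PI) (eps / 2)) as [A [HA HAB]].
{ assert (P := PI_RGT_0). apply Rmult_le_pos; lra. } { lra. }
specialize (HAB A (Rle_refl A)).
assert (K1 := iterated_approx F c HC HB A HA).
assert (K2 := iterated_approx (fun y x => F x y) c (ccont2_swap F HC)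
  (fun x y => Rle_trans _ _ _ (HB y x) (Req_le _ _ (f_equal (Rmult c) (Rmult_comm _ _)))) A HA).
rewrite <- (cFubini_rect F _ _ _ _ HC) in K2.
set (m := cint (fun x => cint (fun y => F x y) (- A) A) (- A) A) in *.
set (a := CRInt_line (fun x => CRInt_line (fun y => F x y))) in *.
set (b := CRInt_line (fun y => CRInt_line (fun x => F x y))) in *.
replace (a - b)%C with ((a - m) + - (b - m))%C by ring.
apply Rle_trans with (1 := Cmod_triangle _ _). rewrite Cmod_opp. lra.
Qed.

Lemma Cexp_plus a b : Cexp (a + b) = (Cexp a * Cexp b)%C.
Proof.
destruct a as [a1 a2], b as [b1 b2]; unfold Cexp, Re, Im, Cmult; simpl.
rewrite exp_plus, cos_plus, sin_plus. f_equal; ring.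
Qed.

Lemma Cexp_RtoC x : Cexp (RtoC x) = RtoC (exp x).
Proof. unfold Cexp, Re, Im, RtoC; simpl. rewrite cos_0, sin_0. f_equal; ring. Qed.

Lemma Cexp_0 : Cexp 0 = 1.
Proof. rewrite Cexp_RtoC, exp_0. reflexivity. Qed.

Lemma Cmod_Cexp z : Cmod (Cexp z) = exp (Re z).
Proof.
unfold Cmod, Cexp; simpl.
replace (_ + _) with ((exp (Re z)) ^ 2 * (sin (Im z) ^ 2 + cos (Im z) ^ 2)) by ring.
rewrite <- !Rsqr_pow2, sin2_cos2, Rmult_1_r, Rsqr_pow2. apply sqrt_pow2. left; apply exp_pos.
Qed.

Lemma Cexp_nz z : Cexp z <> 0.
Proof. apply Cmod_gt_0. rewrite Cmod_Cexp. apply exp_pos. Qed.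

(** The Taylor polynomial of the exponential with [n] terms. *)
Fixpoint expT (z : C) (n : nat) : C :=
  match n with O => 0 | S m => (expT z m + z ^ m / INR (fact m))%C end.

Lemma INR_fact_C n : RtoC (INR (fact n)) <> 0.
Proof. intros H. apply RtoC_inj in H. exact (INR_fact_neq_0 n H). Qed.

Lemma ccont_expT f n : ccont f -> ccont (fun x => expT (f x) n).
Proof.
intros Hf; induction n as [|n IH]; simpl; [apply ccont_const|].
apply ccont_plus; [exact IH|]. apply ccont_mult; [apply ccont_pow, Hf|apply ccont_const].
Qed.

Lemma cderive_expT z n x : cderive (fun s : R => expT (s * z) (S n)) x (z * expT (x * z) n)%C.
Proof.
assert (Hsz : cderive (fun s : R => s * z)%C x z).
{ apply (cderive_eq _ _ _ _ (cderive_mult _ _ _ _ _ (cderive_id x) (cderive_const z x))). ring. }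
induction n as [|n IH].
- simpl. apply (cderive_eq _ _ 0); [|ring]. apply (cderive_ext (fun _ => 0 + 1 / 1)%C); [intros; reflexivity|].
  apply cderive_const.
- change (fun s : R => expT (s * z) (S (S n))) with (fun s : R => expT (s * z) (S n) + (s * z) ^ (S n) / INR (fact (S n)))%C.
  apply (cderive_eq _ _ _ _ (cderive_plus _ _ _ _ _ IH (cderive_mult _ _ _ _ _ (cderive_pow _ _ _ n Hsz) (cderive_const (/ INR (fact (S n)))%C x)))).
  change (expT (x * z) (S n)) with (expT (x * z) n + (x * z) ^ n / INR (fact n))%C.
  change (fact (S n)) with (S n * fact n)%nat. rewrite mult_INR, RtoC_mult.
  assert (N1 := INR_fact_C n).
  assert (N2 : RtoC (INR (S n)) <> 0). { intros E; apply RtoC_inj in E. apply (not_0_INR (S n)); [lia|exact E]. }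
  revert N1 N2. generalize (RtoC (INR (S n))) (RtoC (INR (fact n))) ((x * z) ^ n)%C ((x * z) ^ S n)%C (expT (x * z) n).
  intros p q r t v Hq Hp. field. split; assumption.
Qed.

(** Induction on [n] along the ray from 0 to [z]: the remainder of order [n + 1]
is a primitive of [z] times the remainder of order [n]. *)
Lemma Cexp_Taylor_aux z n : forall s, 0 <= s ->
  Cmod (Cexp (s * z) - expT (s * z) n) <= (s * Cmod z) ^ n / INR (fact n) * exp (s * Cmod z).
Proof.
induction n as [|n IH]; intros s Hs.
- simpl. replace (Cexp (s * z) - 0)%C with (Cexp (s * z)) by ring. rewrite Cmod_Cexp.
  unfold Rdiv; rewrite Rinv_1, !Rmult_1_l.
  assert (Re (s * z) <= s * Cmod z).
  { rewrite re_scal_l. apply Rmult_le_compat_l; [exact Hs|]. apply Rle_trans with (1 := Rle_abs _), re_le_Cmod. }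
  destruct H as [H|H]; [left; apply exp_increasing, H|right; rewrite H; reflexivity].
- set (g := fun u : R => (z * (Cexp (u * z) - expT (u * z) n))%C).
  assert (Cg : ccont g).
  { unfold g. apply ccont_mult; [apply ccont_const|]. apply ccont_minus; [apply ccont_Cexp|apply ccont_expT];
    (apply ccont_mult; [apply ccont_id|apply ccont_const]). }
  assert (E : cint g 0 s = (Cexp (s * z) - expT (s * z) (S n))%C).
  { rewrite (cint_FTC (fun u : R => Cexp (u * z) - expT (u * z) (S n))%C g); [| |exact Cg].
    - assert (T0 : expT 0 (S n) = 1).
      { clear. induction n as [|n IH]; [simpl; field; intros E; apply RtoC_inj in E; lra|].
        change (expT 0 (S n) + 0 ^ (S n) / INR (fact (S n)) = 1)%C. rewrite IH, Cpow_S, Cmult_0_l.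
        unfold Cdiv. rewrite Cmult_0_l, Cplus_0_r. reflexivity. }
      replace (0 * z)%C with (RtoC 0) by ring. rewrite Cexp_0, T0. ring.
    - intros x. unfold g.
      assert (Hsz : cderive (fun s : R => s * z)%C x z).
      { apply (cderive_eq _ _ _ _ (cderive_mult _ _ _ _ _ (cderive_id x) (cderive_const z x))). ring. }
      apply (cderive_ext (fun u : R => Cexp (u * z) + (-(1)) * expT (u * z) (S n))%C); [intros; ring|].
      apply (cderive_eq _ _ _ _ (cderive_plus _ _ _ _ _ (cderive_Cexp _ _ _ Hsz) (cderive_mult _ _ _ _ _ (cderive_const (-(1)) x) (cderive_expT z n x)))).
      ring. }
  rewrite <- E.
  set (h := fun u : R => exp (s * Cmod z) * / INR (fact n) * Cmod z ^ S n * u ^ n).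
  assert (If : is_RInt h 0 s (exp (s * Cmod z) * / INR (fact n) * Cmod z ^ S n * (s ^ S n / INR (S n)) -
       exp (s * Cmod z) * / INR (fact n) * Cmod z ^ S n * (0 ^ S n / INR (S n)))).
  { apply (is_RInt_derive (V := R_CompleteNormedModule) (fun u => exp (s * Cmod z) * / INR (fact n) * Cmod z ^ S n * (u ^ S n / INR (S n)))).
    - intros x _. unfold h. auto_derive; [trivial|].
      rewrite <- !Rmult_assoc. replace (match n with O => 1 | S _ => INR n + 1 end) with (INR (S n)) by reflexivity.
      change (Cmod z ^ S n) with (Cmod z * Cmod z ^ n). assert (N1 := INR_fact_neq_0 n). assert (N2 := not_0_INR (S n) ltac:(lia)). revert N1 N2. generalize (INR (S n)) (INR (fact n)). intros; field; split; assumption.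
    - intros x _. apply cont_of_derive. unfold h. auto_derive; trivial. }
  apply Rle_trans with (RInt h 0 s).
  + apply cint_bound; [exact Cg|exact Hs|eexists; exact If|].
    intros u Hu. unfold g, h. rewrite Cmod_mult.
    apply Rle_trans with (Cmod z * ((u * Cmod z) ^ n / INR (fact n) * exp (s * Cmod z))).
    * apply Rmult_le_compat_l; [apply Cmod_ge_0|].
      apply Rle_trans with (1 := IH u (proj1 Hu)).
      apply Rmult_le_compat_l.
      { apply Rmult_le_pos; [|left; apply Rinv_0_lt_compat, INR_fact_lt_0].
        apply pow_le, Rmult_le_pos; [apply Hu|apply Cmod_ge_0]. }
      assert (u * Cmod z <= s * Cmod z) by (apply Rmult_le_compat_r; [apply Cmod_ge_0|apply Hu]).
      destruct H as [H|H]; [left; apply exp_increasing, H|right; rewrite H; reflexivity].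
    * right. rewrite Rpow_mult_distr. simpl. unfold Rdiv. ring.
  + rewrite (is_RInt_unique (V := R_CompleteNormedModule) _ _ _ _ If).
    right. rewrite pow_i by lia. rewrite Rpow_mult_distr.
    change (fact (S n)) with (S n * fact n)%nat. rewrite mult_INR. field.
    split; first [apply INR_fact_neq_0 | apply not_0_INR; lia].
Qed.

Lemma Cexp_Taylor z n : Cmod (Cexp z - expT z n) <= Cmod z ^ n / INR (fact n) * exp (Cmod z).
Proof.
assert (K := Cexp_Taylor_aux z n 1 Rle_0_1).
rewrite Cmult_1_l, Rmult_1_l in K. exact K.
Qed.

Lemma Cexp_series z : csum (fun n => z ^ n / INR (fact n))%C (Cexp z).
Proof.
assert (E : forall n, csum_n (fun n => z ^ n / INR (fact n))%C n = expT z (S n)).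
{ induction n as [|n IH]; [rewrite csum_n_O; simpl; ring|]. rewrite csum_n_S, IH. reflexivity. }
intros eps He.
destruct (cv_speed_pow_fact (Cmod z) (eps / exp (Cmod z))) as [N HN].
{ apply Rdiv_lt_0_compat; [exact He|apply exp_pos]. }
exists N. intros n Hn. rewrite E.
replace (expT z (S n) - Cexp z)%C with (- (Cexp z - expT z (S n)))%C by ring. rewrite Cmod_opp.
apply Rle_trans with (1 := Cexp_Taylor z (S n)).
specialize (HN (S n) ltac:(lia)). unfold R_dist in HN. rewrite Rminus_0_r in HN.
apply Rle_lt_trans with (1 := Rle_abs _) in HN.
assert (P := exp_pos (Cmod z)).
apply Rle_trans with (eps / exp (Cmod z) * exp (Cmod z)); [|right; field; lra].
apply Rmult_le_compat_r; lra.
Qed.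

(** One term of the exponential series is at most its sum. *)
Lemma pow_le_exp x n : 0 <= x -> x ^ n <= INR (fact n) * exp x.
Proof.
intros Hx.
assert (N1 := INR_fact_lt_0 n).
assert (H : x ^ n / INR (fact n) <= exp x).
{ assert (S1 := csum_fst _ _ (Cexp_series (RtoC x))). rewrite Cexp_RtoC in S1. change (fst (RtoC (exp x))) with (exp x) in S1.
  assert (E : forall k, fst (RtoC x ^ k / INR (fact k))%C = x ^ k / INR (fact k)).
  { intros k. rewrite <- RtoC_pow, <- RtoC_div by apply INR_fact_neq_0. reflexivity. }
  assert (P : forall k, 0 <= fst (RtoC x ^ k / INR (fact k))%C).
  { intros k. rewrite E. apply Rmult_le_pos; [apply pow_le, Hx|left; apply Rinv_0_lt_compat, INR_fact_lt_0]. }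
  rewrite <- E.
  assert (K := sum_n_le_Series _ n P (ex_intro _ _ S1)).
  rewrite (is_series_unique _ _ S1) in K.
  apply Rle_trans with (2 := K).
  destruct n as [|n]; [rewrite sum_O; lra|]. rewrite sum_Sn. unfold plus; simpl plus.
  assert (Q : 0 <= sum_n (fun k => fst (RtoC x ^ k / INR (fact k))%C) n).
  { clear - P. induction n as [|n IH]; [rewrite sum_O; apply P|]. rewrite sum_Sn. specialize (P (S n)).
    unfold plus; simpl plus. change (0 <= sum_n (fun k => fst (RtoC x ^ k / INR (fact k))%C) n + fst (RtoC x ^ (S n) / INR (fact (S n)))%C). lra. }
  change (fst (RtoC x ^ S n / INR (fact (S n)))%C <= sum_n (fun k => fst (RtoC x ^ k / INR (fact k))%C) n + fst (RtoC x ^ (S n) / INR (fact (S n)))%C). lra. }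
apply (Rmult_le_compat_l (INR (fact n))) in H; [|lra].
replace (INR (fact n) * (x ^ n / INR (fact n))) with (x ^ n) in H by (field; lra). exact H.
Qed.

Lemma exp_le_mono x y : x <= y -> exp x <= exp y.
Proof. intros [H|H]; [left; apply exp_increasing, H|right; rewrite H; reflexivity]. Qed.

(** * Complex derivatives and Laplace transforms *)

(** Complex differentiability with explicit estimates, the common form of
[is_derive] for the two normed-module structures of [C] over itself. *)
Definition hol (f : C -> C) (z l : C) : Prop := forall eps, 0 < eps ->
  exists d, 0 < d /\ forall h : C, Cmod h < d -> Cmod (f (z + h)%C - f z - l * h) <= eps * Cmod h.

(** Gives access to the rules for sums, products and composition. *)
Lemma hol_is_derive f z l : hol f z l -> is_derive (K := C_AbsRing) (V := AbsRing_NormedModule C_AbsRing) f z l.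
Proof.
intros H. split.
- apply (is_linear_scal_l (K := C_AbsRing) (V := AbsRing_NormedModule C_AbsRing)).
- intros x Hx. assert (E := is_filter_lim_locally_unique (V := AbsRing_NormedModule C_AbsRing) z x Hx). subst x. intros eps.
  destruct (H eps (cond_pos eps)) as [d [Hd Hh]].
  exists (mkposreal d Hd). intros y Hy.
  change (Cmod (y - z) < d) in Hy.
  specialize (Hh (y - z)%C Hy).
  change (Cmod ((f y - f z) - (y - z) * l) <= eps * Cmod (y - z)).
  assert (E : forall a b c : C, (a + (b - a))%C = b /\ ((f b - f a) - (b - a) * c = f b - f a - c * (b - a))%C)
    by (intros; split; ring).
  rewrite (proj1 (E z y l)) in Hh. rewrite (proj2 (E z y l)). exact Hh.
Qed.

(** The passage to the structure used in the definitions of [entire] and [C_derive]. *)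
Lemma hol_is_C_derive f z l : hol f z l -> is_derive (K := C_AbsRing) (V := C_NormedModule) f z l.
Proof.
intros H. split; [apply (is_linear_scal_l (K := C_AbsRing) (V := C_NormedModule))|].
exact (proj2 (hol_is_derive f z l H)).
Qed.

Lemma is_C_derive_hol f z l : is_derive (K := C_AbsRing) (V := C_NormedModule) f z l -> hol f z l.
Proof.
intros [_ H] eps He.
destruct (H z (fun P HP => HP) (mkposreal eps He)) as [d Hd].
exists d. split; [apply cond_pos|]. intros h Hh.
specialize (Hd (z + h)%C).
assert (E : (z + h - z)%C = h) by ring.
assert (B : ball (M := AbsRing_UniformSpace C_AbsRing) z d (z + h)%C).
{ change (Cmod (z + h - z) < d). rewrite E. exact Hh. }
specialize (Hd B).
change (Cmod ((f (z + h)%C - f z) - (z + h - z) * l) <= eps * Cmod (z + h - z)) in Hd.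
rewrite E in Hd. replace (f (z + h)%C - f z - l * h)%C with ((f (z + h)%C - f z) - h * l)%C by ring. exact Hd.
Qed.

Lemma is_derive_hol f z l : is_derive (K := C_AbsRing) (V := AbsRing_NormedModule C_AbsRing) f z l -> hol f z l.
Proof.
intros H. apply is_C_derive_hol.
split; [apply (is_linear_scal_l (K := C_AbsRing) (V := C_NormedModule))|exact (proj2 H)].
Qed.

Lemma hol_eq f z a b : hol f z a -> a = b -> hol f z b.
Proof. intros H E; rewrite <- E; exact H. Qed.

Lemma hol_ext f g z a : (forall y, f y = g y) -> hol f z a -> hol g z a.
Proof. intros E H eps He. destruct (H eps He) as [d [Hd Hh]]. exists d; split; [exact Hd|]. intros h Hhd. rewrite <- !E. auto. Qed.

Lemma hol_const c z : hol (fun _ => c) z 0.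
Proof. apply is_derive_hol. exact (is_derive_const (K := C_AbsRing) (V := AbsRing_NormedModule C_AbsRing) c z). Qed.

Lemma hol_id z : hol (fun y => y) z 1.
Proof. apply is_derive_hol. exact (is_derive_id (K := C_AbsRing) z). Qed.

Lemma hol_plus f g z a b : hol f z a -> hol g z b -> hol (fun y => f y + g y)%C z (a + b)%C.
Proof.
intros Hf Hg. apply is_derive_hol.
exact (is_derive_plus (K := C_AbsRing) (V := AbsRing_NormedModule C_AbsRing) f g z a b
  (hol_is_derive _ _ _ Hf) (hol_is_derive _ _ _ Hg)).
Qed.

Lemma hol_mult f g z a b : hol f z a -> hol g z b -> hol (fun y => f y * g y)%C z (a * g z + f z * b)%C.
Proof.
intros Hf Hg. apply is_derive_hol.
exact (is_derive_mult (K := C_AbsRing) f g z a b (hol_is_derive _ _ _ Hf) (hol_is_derive _ _ _ Hg) Cmult_comm).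
Qed.

Lemma hol_minus f g z a b : hol f z a -> hol g z b -> hol (fun y => f y - g y)%C z (a - b)%C.
Proof.
intros Hf Hg. apply (hol_ext (fun y => f y + (-(1)) * g y)%C); [intros; ring|].
apply (hol_eq _ _ (a + (0 * g z + -(1) * b))%C); [|ring].
apply hol_plus; [exact Hf|]. apply (hol_mult (fun _ => -(1))%C); [apply hol_const|exact Hg].
Qed.

Lemma hol_comp f g z a b : hol g z a -> hol f (g z) b -> hol (fun y => f (g y)) z (b * a)%C.
Proof.
intros Hg Hf. apply (hol_eq _ _ (a * b)%C); [|apply Cmult_comm]. apply is_derive_hol.
exact (is_derive_comp (K := C_AbsRing) (V := AbsRing_NormedModule C_AbsRing) f g z b a
  (hol_is_derive _ _ _ Hf) (hol_is_derive _ _ _ Hg)).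
Qed.

Lemma hol_Cexp z : hol Cexp z (Cexp z).
Proof.
intros eps He.
set (K := Cmod (Cexp z) * 3).
assert (P : 0 < Cmod (Cexp z)) by (rewrite Cmod_Cexp; apply exp_pos).
exists (Rmin 1 (eps / K)). split.
{ apply Rmin_glb_lt; [lra|]. apply Rdiv_lt_0_compat; [exact He|]. unfold K; lra. }
intros h Hh.
assert (h1 : Cmod h < 1) by (apply Rlt_le_trans with (1 := Hh), Rmin_l).
assert (h2 : Cmod h < eps / K) by (apply Rlt_le_trans with (1 := Hh), Rmin_r).
rewrite Cexp_plus. replace (_ - _ - _)%C with (Cexp z * (Cexp h - expT h 2))%C by (simpl; field; intros E; apply RtoC_inj in E; lra).
rewrite Cmod_mult.
assert (T := Cexp_Taylor h 2). simpl in T. rewrite Rmult_1_r in T.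
assert (E3 : exp (Cmod h) <= 3).
{ apply Rle_trans with (exp 1); [apply exp_le_mono; lra|apply exp_le_3]. }
assert (Ph := Cmod_ge_0 h). assert (Pe := exp_pos (Cmod h)).
apply Rle_trans with (Cmod (Cexp z) * (Cmod h * Cmod h * 3)).
- apply Rmult_le_compat_l; [lra|]. apply Rle_trans with (1 := T).
  replace (1 + 1) with 2 by ring.
  assert (0 <= Cmod h * Cmod h) by nra. nra.
- replace (Cmod (Cexp z) * (Cmod h * Cmod h * 3)) with (K * Cmod h * Cmod h) by (unfold K; ring).
  apply Rmult_le_compat_r; [lra|].
  apply Rle_trans with (K * (eps / K)); [|right; field; unfold K; lra].
  apply Rmult_le_compat_l; [unfold K; lra|lra].
Qed.

Lemma cderive_of_eps f (x : R) l : (forall eps, 0 < eps -> exists d, 0 < d /\ forall h, Rabs h < d ->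
  Cmod (f (x + h)%R - f x - h * l) <= eps * Rabs h) -> cderive f x l.
Proof.
intros H. assert (K : forall (p : C -> R), (forall z : C, Rabs (p z) <= Cmod z) ->
   (forall a b : C, p (a - b)%C = p a - p b) -> (forall (a : R) b, p (a * b)%C = a * p b) ->
   is_derive (fun y => p (f y)) x (p l)).
{ intros p Hp Hm Hs. apply is_derive_Reals. intros eps He.
  destruct (H (eps / 2)) as [d [Hd Hh]]; [lra|]. exists (mkposreal d Hd). intros h Hn Hhd. simpl in Hhd.
  specialize (Hh h Hhd). assert (T := Hp (f (x + h)%R - f x - h * l)%C).
  rewrite !Hm, Hs in T.
  assert (Pa : 0 < Rabs h) by (apply Rabs_pos_lt, Hn).
  replace ((p (f (x + h)) - p (f x)) / h - p l) with ((p (f (x + h)) - p (f x) - h * p l) / h) by (field; exact Hn).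
  unfold Rdiv. rewrite Rabs_mult, Rabs_inv.
  apply (Rmult_lt_reg_r (Rabs h)); [exact Pa|]. rewrite Rmult_assoc, Rinv_l, Rmult_1_r by lra. nra. }
split.
- apply (K fst); [apply re_le_Cmod|reflexivity|]. intros a [b1 b2]; simpl; ring.
- apply (K snd); [|reflexivity|].
  + intros z. apply Rle_trans with (2 := Rmax_Cmod z). apply Rmax_r.
  + intros a [b1 b2]; simpl; ring.
Qed.

(** The chain rule along a line in the plane. *)
Lemma hol_cderive f (p d l : C) (x : R) : hol f (p + x * d)%C l -> cderive (fun s : R => f (p + s * d)%C) x (l * d)%C.
Proof.
intros H. apply cderive_of_eps. intros eps He.
assert (Pd := Cmod_ge_0 d).
destruct (H (eps / (Cmod d + 1))) as [e [Hep Hh]]; [apply Rdiv_lt_0_compat; lra|].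
exists (e / (Cmod d + 1)). split; [apply Rdiv_lt_0_compat; lra|].
intros h Hhd.
assert (E : Cmod (h * d) = Rabs h * Cmod d) by (rewrite Cmod_mult, Cmod_R; reflexivity).
assert (Pa := Rabs_pos h).
assert (K : Cmod (h * d) < e).
{ rewrite E. apply Rle_lt_trans with (Rabs h * (Cmod d + 1)); [apply Rmult_le_compat_l; lra|].
  apply Rlt_le_trans with (e / (Cmod d + 1) * (Cmod d + 1)); [apply Rmult_lt_compat_r; lra|right; field; lra]. }
specialize (Hh _ K). rewrite RtoC_plus.
replace (p + (x + h) * d)%C with (p + x * d + h * d)%C by ring.
replace (_ - _ - _)%C with (f (p + x * d + h * d)%C - f (p + x * d) - l * (h * d))%C by ring.
apply Rle_trans with (1 := Hh). rewrite E.
apply Rle_trans with (eps / (Cmod d + 1) * (Rabs h * (Cmod d + 1))); [|right; field; lra].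
apply Rmult_le_compat_l; [left; apply Rdiv_lt_0_compat; lra|]. apply Rmult_le_compat_l; lra.
Qed.

Lemma hol_zero_const f : (forall z, hol f z 0) -> forall a b, f a = f b.
Proof.
intros H a b.
assert (E := cderive_zero_const (fun s : R => f (a + s * (b - a))%C)).
specialize (fun h => E h 0 1). cbv beta in E.
replace (a + 0 * (b - a))%C with a in E by ring. replace (a + 1 * (b - a))%C with b in E by ring.
apply E. intros x. apply (cderive_eq _ _ (0 * (b - a))%C); [|ring]. apply hol_cderive, H.
Qed.

(** Decay faster than every exponential, the condition under which the two-sided
Laplace transform is entire. *)
Definition rapid (k : R -> C) : Prop :=
  ccont k /\ forall A, exists M, forall u, Cmod (k u) <= M * exp (- A * Rabs u).

Lemma rapid_bound k A : rapid k -> exists M, 0 <= M /\ forall u, Cmod (k u) <= M * exp (- A * Rabs u).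
Proof.
intros [_ H]. destruct (H A) as [M HM]. exists M. split; [|exact HM].
specialize (HM 0). assert (K := Cmod_ge_0 (k 0)). rewrite Rabs_R0, Rmult_0_r, exp_0 in HM. lra.
Qed.

Lemma rapid_tame k : rapid k -> exists c, tame k c.
Proof.
intros H. destruct (rapid_bound k 1 H) as [M [M0 HM]]. exists (4 * M). split; [apply H|]. intros u.
apply Rle_trans with (1 := HM u).
replace (4 * M * wt u) with (M * (4 * wt u)) by ring. apply Rmult_le_compat_l; [exact M0|].
replace (Ropp 1 * Rabs u) with (- (Rabs u)) by ring. rewrite exp_Ropp. unfold wt.
assert (Pe := exp_pos (Rabs u)).
replace (4 * / (1 + u ^ 2)) with (/ ((1 + u ^ 2) / 4)) by (field; nra).
apply Rinv_le_contravar; [nra|].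
replace (exp (Rabs u)) with (exp (Rabs u / 2) * exp (Rabs u / 2)) by (rewrite <- exp_plus; f_equal; lra).
assert (Pa := Rabs_pos u). assert (Q := exp_ineq1_le (Rabs u / 2)).
assert (Rabs u ^ 2 = u ^ 2) by (rewrite pow2_abs; reflexivity). nra.
Qed.

Lemma rapid_ext f g : (forall x, f x = g x) -> rapid f -> rapid g.
Proof. intros E [H1 H2]; split; [exact (ccont_ext f g E H1)|]. intros A; destruct (H2 A) as [M HM]; exists M; intros; rewrite <- E; apply HM. Qed.

(** The multipliers that preserve [rapid]. *)
Definition expbd (m : R -> C) : Prop :=
  ccont m /\ exists M B, 0 <= M /\ 0 <= B /\ forall u, Cmod (m u) <= M * exp (B * Rabs u).

Lemma rapid_mult k m : rapid k -> expbd m -> rapid (fun u => k u * m u)%C.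
Proof.
intros [H1 H2] [H3 [M [B [M0 [B0 HM]]]]]. split; [apply ccont_mult; assumption|].
intros A. destruct (H2 (A + B)) as [M' HM']. exists (M' * M). intros u. rewrite Cmod_mult.
apply Rle_trans with (M' * exp (- (A + B) * Rabs u) * (M * exp (B * Rabs u))).
- apply Rmult_le_compat; try apply Cmod_ge_0; auto.
- right. replace (- A * Rabs u) with (- (A + B) * Rabs u + B * Rabs u) by ring. rewrite exp_plus. ring.
Qed.

Lemma expbd_mult k m : expbd k -> expbd m -> expbd (fun u => k u * m u)%C.
Proof.
intros [H1 [M [B [M0 [B0 HM]]]]] [H3 [M' [B' [M0' [B0' HM']]]]]. split; [apply ccont_mult; assumption|].
exists (M * M'), (B + B'). split; [apply Rmult_le_pos; assumption|]. split; [lra|].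
intros u. rewrite Cmod_mult, Rmult_plus_distr_r, exp_plus.
apply Rle_trans with ((M * exp (B * Rabs u)) * (M' * exp (B' * Rabs u))); [|right; ring].
apply Rmult_le_compat; try apply Cmod_ge_0; auto.
Qed.

Lemma expbd_plus k m : expbd k -> expbd m -> expbd (fun u => k u + m u)%C.
Proof.
intros [H1 [M [B [M0 [B0 HM]]]]] [H3 [M' [B' [M0' [B0' HM']]]]]. split; [apply ccont_plus; assumption|].
exists (M + M'), (B + B'). split; [lra|]. split; [lra|].
intros u. apply Rle_trans with (1 := Cmod_triangle _ _).
specialize (HM u). specialize (HM' u). assert (Pa := Rabs_pos u).
assert (exp (B * Rabs u) <= exp ((B + B') * Rabs u)) by (apply exp_le_mono; nra).
assert (exp (B' * Rabs u) <= exp ((B + B') * Rabs u)) by (apply exp_le_mono; nra).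
nra.
Qed.

Lemma expbd_const c : expbd (fun _ => c).
Proof.
split; [apply ccont_const|]. exists (Cmod c), 0. split; [apply Cmod_ge_0|]. split; [lra|].
intros u. rewrite Rmult_0_l, exp_0. lra.
Qed.

Lemma expbd_id : expbd (fun u => RtoC u).
Proof.
split; [apply ccont_id|]. exists 1, 1. split; [lra|]. split; [lra|].
intros u. rewrite Cmod_R. assert (K := exp_ineq1_le (Rabs u)). rewrite !Rmult_1_l. lra.
Qed.

Lemma expbd_pow f n : expbd f -> expbd (fun u => f u ^ n)%C.
Proof. intros H; induction n as [|n IH]; simpl; [apply expbd_const|apply expbd_mult; assumption]. Qed.

Lemma Re_mult_R_le z u : Re (z * RtoC u)%C <= Cmod z * Rabs u.
Proof.
rewrite re_scal_r. apply Rle_trans with (1 := Rle_abs _). rewrite Rabs_mult.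
apply Rmult_le_compat_r; [apply Rabs_pos|apply re_le_Cmod].
Qed.

Lemma expbd_Cexp z : expbd (fun u => Cexp (z * RtoC u)).
Proof.
split; [apply ccont_Cexp, ccont_mult; [apply ccont_const|apply ccont_id]|].
exists 1, (Cmod z). split; [lra|]. split; [apply Cmod_ge_0|].
intros u. rewrite Cmod_Cexp, Rmult_1_l. apply exp_le_mono, Re_mult_R_le.
Qed.

Lemma rapid_gauss : rapid (fun u => RtoC (exp (- u ^ 2))).
Proof.
split.
- apply ccont_RtoC. intros x. apply cont_of_derive. auto_derive; trivial.
- intros A. exists (exp (A ^ 2 / 4)). intros u. rewrite Cmod_R, Rabs_pos_eq by (left; apply exp_pos).
  rewrite <- exp_plus. apply exp_le_mono.
  assert (H : Rabs u ^ 2 = u ^ 2) by (rewrite pow2_abs; reflexivity). assert (Q := pow2_ge_0 (A / 2 - Rabs u)). lra.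
Qed.

(** Fourier transforms are the values at imaginary arguments. *)
Definition laplace (k : R -> C) (s : C) : C := CRInt_line (fun u => k u * Cexp (s * RtoC u))%C.

Lemma rapid_laplace k s : rapid k -> rapid (fun u => k u * Cexp (s * RtoC u))%C.
Proof. intros H. apply rapid_mult; [exact H|apply expbd_Cexp]. Qed.

(** Differentiation under the integral sign: for [|h| <= 1] the second-order
remainder of [exp (h u)] is at most [|h|^2] times a function of exponential
growth in [u]. *)
Lemma hol_laplace k s : rapid k -> hol (laplace k) s (laplace (fun u => k u * RtoC u)%C s).
Proof.
intros Hk.
set (m := fun u => (k u * Cexp (s * RtoC u))%C).
assert (Rm : rapid m) by (apply rapid_laplace; exact Hk).
assert (Rk' : rapid (fun u => k u * RtoC u)%C) by (apply rapid_mult; [exact Hk|apply expbd_id]).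
destruct Hk as [Ck Hk0]. assert (Hk : rapid k) by (split; assumption).
destruct (rapid_bound m 4 Rm) as [M [M0 HM]].
(* the remainder of the exponential is O(|h|^2) uniformly against the decay *)
assert (R2 : forall h : C, Cmod h <= 1 ->
   tame (fun u => m u * (Cexp (h * RtoC u) - expT (h * RtoC u) 2))%C (4 * M * Cmod h ^ 2)).
{ intros h Hh. split.
  - apply ccont_mult; [apply Rm|]. apply ccont_minus; [apply ccont_Cexp|apply ccont_expT]; (apply ccont_mult; [apply ccont_const|apply ccont_id]).
  - intros u. rewrite Cmod_mult.
    assert (T := Cexp_Taylor (h * RtoC u) 2). rewrite Cmod_mult, Cmod_R in T.
    simpl fact in T. replace (INR 2) with 2 in T by (simpl; ring).
    assert (Ph := Cmod_ge_0 h). assert (Pa := Rabs_pos u).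
    assert (E1 : exp (Cmod h * Rabs u) <= exp (Rabs u)) by (apply exp_le_mono; nra).
    assert (E2 : Rabs u ^ 2 <= 2 * exp (Rabs u)) by (apply (pow_le_exp (Rabs u) 2 Pa) || (assert (K := pow_le_exp (Rabs u) 2 Pa); simpl in K; simpl; lra)).
    assert (Pe := exp_pos (Rabs u)).
    apply Rle_trans with (M * exp (Ropp 4 * Rabs u) * (Cmod h ^ 2 * exp (Rabs u) * exp (Rabs u))).
    + apply Rmult_le_compat; try apply Cmod_ge_0; [apply HM|].
      apply Rle_trans with (1 := T). rewrite Rpow_mult_distr.
      assert (0 <= Cmod h ^ 2) by (apply pow_le; lra).
      assert (0 < exp (Cmod h * Rabs u)) by apply exp_pos.
      assert (0 <= Rabs u ^ 2) by (apply pow_le; lra).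
      apply Rle_trans with (Cmod h ^ 2 * (2 * exp (Rabs u)) / 2 * exp (Rabs u)).
      * apply Rmult_le_compat; try lra.
        -- apply Rmult_le_pos; [apply Rmult_le_pos; lra|lra].
        -- apply Rmult_le_compat_r; [lra|]. apply Rmult_le_compat_l; lra.
      * right; field.
    + replace (M * exp (Ropp 4 * Rabs u) * (Cmod h ^ 2 * exp (Rabs u) * exp (Rabs u))) with
        (M * Cmod h ^ 2 * (exp (Ropp 4 * Rabs u) * exp (Rabs u) * exp (Rabs u))) by ring.
      rewrite <- !exp_plus.
      replace (4 * M * Cmod h ^ 2 * wt u) with (M * Cmod h ^ 2 * (4 * wt u)) by ring.
      apply Rmult_le_compat_l; [apply Rmult_le_pos; [exact M0|apply pow_le; lra]|].
      replace (Ropp 4 * Rabs u + Rabs u + Rabs u) with (- (2 * Rabs u)) by ring.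
      rewrite exp_Ropp. unfold wt.
      replace (4 * / (1 + u ^ 2)) with (/ ((1 + u ^ 2) / 4)) by (field; nra).
      apply Rinv_le_contravar; [nra|].
      replace (exp (2 * Rabs u)) with (exp (Rabs u) * exp (Rabs u)) by (rewrite <- exp_plus; f_equal; lra).
      assert (Q := exp_ineq1_le (Rabs u)).
      assert (Rabs u ^ 2 = u ^ 2) by (rewrite pow2_abs; reflexivity). nra. }
intros eps He.
set (K := 4 * M * PI + 1). assert (PP := PI_RGT_0).
assert (K0 : 0 < K) by (unfold K; nra).
exists (Rmin 1 (eps / K)). split; [apply Rmin_glb_lt; [lra|apply Rdiv_lt_0_compat; assumption]|].
intros h Hh.
assert (h1 : Cmod h < 1) by (apply Rlt_le_trans with (1 := Hh), Rmin_l).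
assert (h2 : Cmod h < eps / K) by (apply Rlt_le_trans with (1 := Hh), Rmin_r).
assert (Ph := Cmod_ge_0 h).
destruct (rapid_tame _ (rapid_laplace k (s + h)%C Hk)) as [c1 T1].
destruct (rapid_tame _ Rm) as [c2 T2].
destruct (rapid_tame _ (rapid_laplace _ s Rk')) as [c3 T3].
unfold laplace. change (CRInt_line (fun u => k u * Cexp (s * RtoC u))%C) with (CRInt_line m).
rewrite <- (line_minus _ _ _ _ T1 T2).
replace (CRInt_line (fun u => k u * RtoC u * Cexp (s * RtoC u))%C * h)%C with
  (h * CRInt_line (fun u => k u * RtoC u * Cexp (s * RtoC u))%C)%C by ring.
rewrite <- (line_scal h _ _ T3).
rewrite <- (line_minus _ _ _ _ (tame_minus _ _ _ _ T1 T2) (tame_scal h _ _ T3)).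
rewrite (line_ext _ (fun u => m u * (Cexp (h * RtoC u) - expT (h * RtoC u) 2))%C).
- apply Rle_trans with (1 := line_bound _ _ (R2 h (Rlt_le _ _ h1))).
  apply Rle_trans with (K * Cmod h * Cmod h).
  + unfold K. nra.
  + apply Rmult_le_compat_r; [exact Ph|]. apply Rle_trans with (K * (eps / K)); [|right; field; lra].
    apply Rmult_le_compat_l; lra.
- intros u. unfold m. replace ((s + h) * u)%C with (s * u + h * u)%C by ring. rewrite Cexp_plus.
  simpl. field.
Qed.

(** * The Gaussian integral *)

Lemma cont_gauss x : continuous (fun t => exp (- t ^ 2)) x.
Proof. apply cont_of_derive. auto_derive; trivial. Qed.

(** Together with [gauss_comp] this is the classical pair: the derivative of the
square of [gauss_prim] is opposite to that of [gauss_comp], while [gauss_comp]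
tends to 0 at infinity and equals [atan 1] at 0. *)
Definition gauss_prim (x : R) : R := RInt (fun t => exp (- t ^ 2)) 0 x.
Definition gauss_comp (x : R) : R := RInt (fun t => exp (- x ^ 2 * (1 + t ^ 2)) / (1 + t ^ 2)) 0 1.

Lemma is_derive_gauss_prim x : is_derive gauss_prim x (exp (- x ^ 2)).
Proof.
apply (is_derive_RInt (V := R_NormedModule) (fun t => exp (- t ^ 2)) gauss_prim 0 x); [|apply cont_gauss].
apply filter_forall; intros b. apply (RInt_correct (V := R_CompleteNormedModule)), ex_RInt_cont, cont_gauss.
Qed.

Lemma cont_gauss_comp_integrand x t : continuous (fun t => exp (- x ^ 2 * (1 + t ^ 2)) / (1 + t ^ 2)) t.
Proof.
apply cont_of_derive. auto_derive. nra.
Qed.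

(** Under the integral sign the denominator cancels; the substitution [x t] then
produces [gauss_prim]. *)
Lemma is_derive_gauss_comp x : is_derive gauss_comp x (- (2 * gauss_prim x * exp (- x ^ 2))).
Proof.
assert (D : forall u t, is_derive (fun z => exp (- z ^ 2 * (1 + t ^ 2)) / (1 + t ^ 2)) u (- (2 * u) * exp (- u ^ 2 * (1 + t ^ 2)))).
{ intros u t. auto_derive; [trivial|]. simpl. field. nra. }
eapply is_derive_eq.
- apply (is_derive_RInt_param (fun x t => exp (- x ^ 2 * (1 + t ^ 2)) / (1 + t ^ 2)) 0 1 x).
  + apply filter_forall; intros u t _. eexists; apply D.
  + intros t _. apply (continuity_2d_pt_ext (fun u t => - (2 * u) * exp (- u ^ 2 * (1 + t ^ 2)))).
    { intros u v. symmetry. apply is_derive_unique, D. }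
    assert (C1 := continuity_2d_pt_id1 x t). assert (C2 := continuity_2d_pt_id2 x t).
    assert (K : forall c, continuity_2d_pt (fun _ _ => c) x t) by (intros; apply continuity_2d_pt_const).
    apply continuity_2d_pt_mult.
    * apply continuity_2d_pt_opp, continuity_2d_pt_mult; auto.
    * apply (continuity_1d_2d_pt_comp exp).
      { apply derivable_continuous_pt, derivable_pt_exp. }
      apply continuity_2d_pt_mult.
      { apply continuity_2d_pt_opp. simpl. apply continuity_2d_pt_mult; [exact C1|]. apply continuity_2d_pt_mult; auto. }
      apply continuity_2d_pt_plus; [auto|]. simpl. apply continuity_2d_pt_mult; [exact C2|]. apply continuity_2d_pt_mult; auto.
  + apply filter_forall; intros u. apply ex_RInt_cont, cont_gauss_comp_integrand.
- rewrite (RInt_ext _ (fun t => (-2 * exp (- x ^ 2)) * (x * exp (- (x * t + 0) ^ 2)))).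
  + transitivity (-2 * exp (- x ^ 2) * RInt (fun t => x * exp (- (x * t + 0) ^ 2)) 0 1).
    * apply (RInt_scal (V := R_CompleteNormedModule) (fun t => x * exp (- (x * t + 0) ^ 2)) 0 1 (-2 * exp (- x ^ 2))).
      apply ex_RInt_cont. intros t. apply cont_of_derive. auto_derive; trivial.
    * assert (E : RInt (fun t => x * exp (- (x * t + 0) ^ 2)) 0 1 = RInt (fun t => exp (- t ^ 2)) (x * 0 + 0) (x * 1 + 0)).
      { apply (RInt_comp_lin (V := R_CompleteNormedModule) (fun t => exp (- t ^ 2)) x 0 0 1).
        apply ex_RInt_cont, cont_gauss. }
      rewrite E, Rmult_0_r, Rplus_0_r, Rmult_1_r, Rplus_0_r.
      unfold gauss_prim. Rring.
  + intros t _. etransitivity; [apply (is_derive_unique _ _ _ (D x t))|].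
    replace (- x ^ 2 * (1 + t ^ 2)) with (- x ^ 2 + - (x * t + 0) ^ 2) by ring. rewrite exp_plus. Rring.
Qed.

Lemma gauss_prim_sq x : gauss_prim x ^ 2 + gauss_comp x = PI / 4.
Proof.
assert (E : RtoC (gauss_prim x ^ 2 + gauss_comp x) = RtoC (gauss_prim 0 ^ 2 + gauss_comp 0)).
{ apply (cderive_zero_const (fun x => RtoC (gauss_prim x ^ 2 + gauss_comp x))). intros z. apply cderive_RtoC.
  eapply is_derive_eq.
  - apply (is_derive_plus (K := R_AbsRing) (V := R_NormedModule)).
    + apply (is_derive_ext (fun x => gauss_prim x * gauss_prim x)); [intros; Rring|].
      apply is_derive_Rmult; apply is_derive_gauss_prim.
    + apply is_derive_gauss_comp.
  - unfold plus; simpl. ring. }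
apply RtoC_inj in E. rewrite E. unfold gauss_prim, gauss_comp.
rewrite (RInt_point (V := R_CompleteNormedModule)).
rewrite (RInt_ext _ wt).
- rewrite (is_RInt_unique _ _ _ _ (is_RInt_wt 0 1)), atan_1, atan_0. unfold zero; simpl. ring.
- intros t _. replace (- 0 ^ 2 * (1 + t ^ 2)) with 0 by ring. rewrite exp_0. unfold wt. match goal with |- ?a = ?b => change (@eq R a b) end. field. nra.
Qed.

Lemma exp_neg_sq_le x : exp (- x ^ 2) <= / (1 + x ^ 2).
Proof.
rewrite exp_Ropp. apply Rinv_le_contravar; [nra|]. apply exp_ineq1_le.
Qed.

Lemma gauss_comp_bound x : 0 <= gauss_comp x <= wt x.
Proof.
assert (Ex : ex_RInt (fun t => exp (- x ^ 2 * (1 + t ^ 2)) / (1 + t ^ 2)) 0 1)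
  by (apply ex_RInt_cont, cont_gauss_comp_integrand).
assert (P : forall t, 0 <= exp (- x ^ 2 * (1 + t ^ 2)) / (1 + t ^ 2) <= wt x).
{ intros t. assert (Pe := exp_pos (- x ^ 2 * (1 + t ^ 2))). assert (0 < 1 + t ^ 2) by nra. split.
  - left; apply Rdiv_lt_0_compat; assumption.
  - apply Rle_trans with (2 := exp_neg_sq_le x).
    apply Rle_trans with (exp (- x ^ 2 * (1 + t ^ 2))).
    + apply (Rmult_le_reg_r (1 + t ^ 2)); [assumption|]. unfold Rdiv. rewrite Rmult_assoc, Rinv_l, Rmult_1_r by lra. nra.
    + apply exp_le_mono. nra. }
split.
- apply RInt_ge_0; [lra|exact Ex|]. intros; apply P.
- apply Rle_trans with ((1 - 0) * wt x); [|lra].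
  apply Rle_trans with (1 := Rle_abs _).
  apply (norm_RInt_le_const (V := R_NormedModule) (fun t => exp (- x ^ 2 * (1 + t ^ 2)) / (1 + t ^ 2))); [lra| |].
  + intros t _. change (Rabs (exp (- x ^ 2 * (1 + t ^ 2)) / (1 + t ^ 2)) <= wt x). rewrite Rabs_pos_eq; apply P.
  + apply (RInt_correct (V := R_CompleteNormedModule)), Ex.
Qed.

Lemma gauss_prim_pos x : 0 <= x -> 0 <= gauss_prim x.
Proof.
intros Hx. apply RInt_ge_0; [exact Hx|apply ex_RInt_cont, cont_gauss|]. intros; left; apply exp_pos.
Qed.

Lemma gauss_prim_odd x : gauss_prim (- x) = - gauss_prim x.
Proof.
assert (E : RtoC (gauss_prim (- x) + gauss_prim x) = RtoC (gauss_prim (- 0) + gauss_prim 0)).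
{ apply (cderive_zero_const (fun x => RtoC (gauss_prim (- x) + gauss_prim x))). intros z. apply cderive_RtoC.
  eapply is_derive_eq.
  - apply (is_derive_plus (K := R_AbsRing) (V := R_NormedModule)).
    + apply (is_derive_comp (K := R_AbsRing) (V := R_NormedModule) gauss_prim Ropp z); [apply is_derive_gauss_prim|].
      apply (is_derive_opp (K := R_AbsRing) (V := R_NormedModule) (fun y => y)). apply (is_derive_id (K := R_AbsRing)).
    + apply is_derive_gauss_prim.
  - unfold plus, scal, opp, one; simpl. unfold mult; simpl.
    replace (- z * (- z * 1)) with (z * (z * 1)) by ring. ring. }
apply RtoC_inj in E. rewrite Ropp_0 in E. unfold gauss_prim in E at 3 4.
rewrite (RInt_point (V := R_CompleteNormedModule)) in E. unfold zero in E; simpl in E. lra.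
Qed.

Lemma gauss_integral : CRInt_line (fun u => RtoC (exp (- u ^ 2))) = RtoC (sqrt PI).
Proof.
destruct (rapid_tame _ rapid_gauss) as [c Hc].
apply (line_char _ _ _ Hc). intros eps He.
assert (PP := PI_RGT_0). assert (SP := sqrt_lt_R0 _ PP). assert (SS := sqrt_sqrt PI (Rlt_le _ _ PP)).
exists (4 / sqrt PI / eps). split; [apply Rdiv_lt_0_compat; [apply Rdiv_lt_0_compat|]; lra|].
intros B HB.
assert (B0 : 0 < B).
{ apply Rlt_le_trans with (2 := HB). apply Rdiv_lt_0_compat; [apply Rdiv_lt_0_compat|]; lra. }
assert (E : cint (fun u => RtoC (exp (- u ^ 2))) (- B) B = RtoC (2 * gauss_prim B)).
{ rewrite (cint_FTC (fun u => RtoC (gauss_prim u)) _ (- B) B).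
  - rewrite gauss_prim_odd, <- RtoC_minus. f_equal. ring.
  - intros x. apply (cderive_RtoC gauss_prim), is_derive_gauss_prim.
  - apply (proj1 Hc). }
rewrite E, <- RtoC_minus, Cmod_R.
assert (H1 := gauss_prim_sq B). destruct (gauss_comp_bound B) as [H2 H3]. assert (H4 := gauss_prim_pos B (Rlt_le _ _ B0)).
assert (H5 : (2 * gauss_prim B - sqrt PI) * (2 * gauss_prim B + sqrt PI) = - (4 * gauss_comp B)) by nra.
assert (H6 : Rabs (2 * gauss_prim B - sqrt PI) * (2 * gauss_prim B + sqrt PI) = 4 * gauss_comp B).
{ rewrite <- (Rabs_pos_eq (2 * gauss_prim B + sqrt PI)) by lra. rewrite <- Rabs_mult, H5, Rabs_Ropp, Rabs_pos_eq; lra. }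
assert (H7 := Rabs_pos (2 * gauss_prim B - sqrt PI)).
apply (Rmult_le_reg_r (sqrt PI)); [exact SP|].
apply Rle_trans with (4 * wt B); [nra|].
assert (H8 : wt B <= / B). { unfold wt. apply Rinv_le_contravar; nra. }
apply Rle_trans with (4 * / B); [lra|].
apply (Rmult_le_reg_r B); [exact B0|]. rewrite Rmult_assoc, Rinv_l, Rmult_1_r by lra.
apply Rle_trans with (eps * sqrt PI * (4 / sqrt PI / eps)); [right; field; lra|].
apply Rmult_le_compat_l; [nra|exact HB].
Qed.

Lemma cderive_gauss u : cderive (fun u => RtoC (exp (- u ^ 2))) u (- (2 * u) * RtoC (exp (- u ^ 2)))%C.
Proof.
eapply cderive_eq.
- apply cderive_RtoC. instantiate (1 := - (2 * u) * exp (- u ^ 2)). auto_derive; [trivial|simpl; ring].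
- rewrite !RtoC_mult, RtoC_opp, RtoC_mult. reflexivity.
Qed.

(** Integration by parts gives [L' = (s / 2) L] for the transform [L], hence
[L s * exp (- s^2 / 4)] is constant. *)
Lemma gauss_laplace s : laplace (fun u => RtoC (exp (- u ^ 2))) s = (sqrt PI * Cexp (s ^ 2 / 4))%C.
Proof.
set (k := fun u : R => RtoC (exp (- u ^ 2))).
assert (Rk : rapid k) by apply rapid_gauss.
assert (Rk1 : rapid (fun u => k u * RtoC u)%C) by (apply rapid_mult; [exact Rk|apply expbd_id]).
assert (D : forall z, laplace (fun u => k u * RtoC u)%C z = (z / 2 * laplace k z)%C).
{ intros z.
  assert (E : (z * laplace k z + (-(2)) * laplace (fun u => k u * RtoC u)%C z)%C = 0).
  { apply (line_FTC2 (fun u => k u * Cexp (z * RtoC u))%C); try (apply rapid_tame, rapid_laplace; assumption).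
    intros x. eapply cderive_eq; [apply cderive_mult; [apply (cderive_gauss x)|apply cderive_Cexp, cderive_mult; [apply cderive_const|apply cderive_id]]|].
    unfold k; ring. }
  set (a := laplace (fun u => k u * RtoC u)%C z) in *. set (b := laplace k z) in *.
  replace a with (/ 2 * (z * b - (z * b + (-(2)) * a)))%C by field. rewrite E. field. }
assert (Cst : forall z, (laplace k z * Cexp (- (/ 4) * (z * z)))%C = (laplace k 0 * Cexp (- (/ 4) * (0 * 0)))%C).
{ intros z. apply (hol_zero_const (fun z => laplace k z * Cexp (- (/ 4) * (z * z)))%C). clear z. intros z.
  eapply hol_eq.
  - apply hol_mult; [apply hol_laplace, Rk|].
    apply (hol_comp Cexp (fun z => - (/ 4) * (z * z))%C); [|apply hol_Cexp].
    apply hol_mult; [apply hol_const|]. apply hol_mult; apply hol_id.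
  - rewrite D. simpl. field. }
assert (L0 : laplace k 0 = RtoC (sqrt PI)).
{ unfold laplace. rewrite <- gauss_integral. apply line_ext. intros u. replace (0 * u)%C with (RtoC 0) by ring.
  rewrite Cexp_0. unfold k. ring. }
specialize (Cst s). rewrite L0 in Cst. replace (- / 4 * (0 * 0))%C with (RtoC 0) in Cst by ring.
rewrite Cexp_0, Cmult_1_r in Cst. rewrite <- Cst, <- Cmult_assoc, <- Cexp_plus.
replace (- / 4 * (s * s) + s ^ 2 / 4)%C with (RtoC 0).
- rewrite Cexp_0. ring.
- simpl. field.
Qed.

(** * Goursat's theorem for squares *)

Definition holo (f : C -> C) : Prop := forall z, exists l, hol f z l.

Lemma hol_cderive_x f (x c : R) l : hol f (x, c) l -> cderive (fun s => f (s, c)) x l.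
Proof.
intros H. apply (cderive_ext (fun s : R => f ((0, c) + s * 1)%C)).
- intros y. f_equal. unfold Cplus, Cmult, RtoC; simpl. f_equal; ring.
- replace l with (l * 1)%C by ring. apply hol_cderive.
  replace ((0, c) + x * 1)%C with ((x, c) : C); [exact H|].
  unfold Cplus, Cmult, RtoC; simpl. f_equal; ring.
Qed.

Lemma hol_cderive_y f (a y : R) l : hol f (a, y) l -> cderive (fun s => f (a, s)) y (l * Ci)%C.
Proof.
intros H. apply (cderive_ext (fun s : R => f ((a, 0) + s * Ci)%C)).
- intros s. f_equal. unfold Cplus, Cmult, RtoC, Ci; simpl. f_equal; ring.
- apply hol_cderive.
  replace ((a, 0) + y * Ci)%C with ((a, y) : C); [exact H|].
  unfold Cplus, Cmult, RtoC, Ci; simpl. f_equal; ring.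
Qed.

Lemma cderive_ex_ccont f : (forall x, exists l, cderive f x l) -> ccont f.
Proof.
intros H x. destruct (H x) as [l [H1 H2]].
split; apply cont_of_derive; eexists; eassumption.
Qed.

Lemma holo_ccont_x f c : holo f -> ccont (fun x => f (x, c)).
Proof. intros H. apply cderive_ex_ccont. intros x. destruct (H (x, c)) as [l Hl]. exists l. apply hol_cderive_x, Hl. Qed.

Lemma holo_ccont_y f a : holo f -> ccont (fun y => f (a, y)).
Proof. intros H. apply cderive_ex_ccont. intros x. destruct (H (a, x)) as [l Hl]. eexists. apply hol_cderive_y, Hl. Qed.

(** The integral along the boundary of [[a, b] x [c, d]], anticlockwise. *)
Definition rect_int (f : C -> C) (a b c d : R) : C :=
  (cint (fun x => f (x, c)) a b - cint (fun x => f (x, d)) a b +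
   Ci * (cint (fun y => f (b, y)) c d - cint (fun y => f (a, y)) c d))%C.

Lemma rect_int_split f a m b c n d : holo f ->
  rect_int f a b c d = (rect_int f a m c n + rect_int f m b c n + rect_int f a m n d + rect_int f m b n d)%C.
Proof.
intros H. unfold rect_int.
rewrite (cint_Chasles (fun x => f (x, c)) a m b), (cint_Chasles (fun x => f (x, d)) a m b) by (apply holo_ccont_x, H).
rewrite (cint_Chasles (fun x => f (b, x)) c n d), (cint_Chasles (fun x => f (a, x)) c n d) by (apply holo_ccont_y, H).
ring.
Qed.

Lemma rect_int_primitive G g a b c d : (forall z, hol G z (g z)) -> holo g -> rect_int g a b c d = 0.
Proof.
intros HG Hg. unfold rect_int.
assert (Y : forall a, (Ci * cint (fun y => g (a, y)) c d = G (a, d) - G (a, c))%C).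
{ intros x. rewrite <- (cint_FTC (fun y => G (x, y)) (fun y => g (x, y) * Ci)%C c d).
  - rewrite <- cint_scal by (apply holo_ccont_y, Hg). apply cint_ext. intros; ring.
  - intros y. apply hol_cderive_y, HG.
  - apply ccont_mult; [apply holo_ccont_y, Hg|apply ccont_const]. }
rewrite (cint_FTC (fun x => G (x, c)) (fun x => g (x, c)) a b); [|intros x; apply hol_cderive_x, HG|apply holo_ccont_x, Hg].
rewrite (cint_FTC (fun x => G (x, d)) (fun x => g (x, d)) a b); [|intros x; apply hol_cderive_x, HG|apply holo_ccont_x, Hg].
replace (Ci * (cint (fun y => g (b, y)) c d - cint (fun y => g (a, y)) c d))%C with
  (Ci * cint (fun y => g (b, y)) c d - Ci * cint (fun y => g (a, y)) c d)%C by ring.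
rewrite !Y. ring.
Qed.

Lemma rect_int_minus f g a b c d : holo f -> holo g ->
  rect_int (fun z => f z - g z)%C a b c d = (rect_int f a b c d - rect_int g a b c d)%C.
Proof.
intros Hf Hg. unfold rect_int.
rewrite (cint_minus (fun x => f (x, c)) (fun x => g (x, c))), (cint_minus (fun x => f (x, d)) (fun x => g (x, d))) by (apply holo_ccont_x; assumption).
rewrite (cint_minus (fun x => f (a, x)) (fun x => g (a, x))), (cint_minus (fun x => f (b, x)) (fun x => g (b, x))) by (apply holo_ccont_y; assumption).
ring.
Qed.

Lemma rect_int_bound f a b c d M : holo f -> a <= b -> c <= d ->
  (forall x y, a <= x <= b -> c <= y <= d -> Cmod (f (x, y)) <= M) ->
  Cmod (rect_int f a b c d) <= 2 * ((b - a) + (d - c)) * M.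
Proof.
intros Hf Hab Hcd HM. unfold rect_int.
assert (X : forall y, c <= y <= d -> Cmod (cint (fun x => f (x, y)) a b) <= (b - a) * M).
{ intros y Hy. rewrite <- (Rabs_pos_eq (b - a)) by lra. apply cint_bound_const; [apply holo_ccont_x, Hf|].
  intros x. rewrite Rmin_left, Rmax_right by lra. auto. }
assert (Y : forall x, a <= x <= b -> Cmod (cint (fun y => f (x, y)) c d) <= (d - c) * M).
{ intros y Hy. rewrite <- (Rabs_pos_eq (d - c)) by lra. apply cint_bound_const; [apply holo_ccont_y, Hf|].
  intros x. rewrite Rmin_left, Rmax_right by lra. auto. }
assert (X1 := X c ltac:(lra)). assert (X2 := X d ltac:(lra)).
assert (Y1 := Y a ltac:(lra)). assert (Y2 := Y b ltac:(lra)).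
apply Rle_trans with (1 := Cmod_triangle _ _). rewrite Cmod_mult.
rewrite Cmod_Ci, Rmult_1_l. unfold Cminus.
assert (T1 := Cmod_triangle (cint (fun x => f (x, c)) a b) (- cint (fun x => f (x, d)) a b)).
assert (T2 := Cmod_triangle (cint (fun y => f (b, y)) c d) (- cint (fun y => f (a, y)) c d)).
rewrite Cmod_opp in T1, T2. lra.
Qed.

Section Bisection.
Variable Q : R -> R -> R -> R.
Hypothesis HQ : forall a c h, 0 < h ->
  Q a c h <= Q a c (h / 2) + Q (a + h / 2) c (h / 2) + Q a (c + h / 2) (h / 2) + Q (a + h / 2) (c + h / 2) (h / 2).

(** The corner of a quarter of the square that carries at least a quarter of [Q]. *)
Definition bisect_step (p : R * R) (h : R) : R * R :=
  let a := fst p in let c := snd p in let k := h / 2 in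
  if Rle_dec (Q a c h) (4 * Q a c k) then (a, c)
  else if Rle_dec (Q a c h) (4 * Q (a + k) c k) then (a + k, c)
  else if Rle_dec (Q a c h) (4 * Q a (c + k) k) then (a, c + k) else (a + k, c + k).

Lemma bisect_step_spec p h : 0 < h ->
  Q (fst p) (snd p) h <= 4 * Q (fst (bisect_step p h)) (snd (bisect_step p h)) (h / 2) /\
  fst p <= fst (bisect_step p h) <= fst p + h / 2 /\ snd p <= snd (bisect_step p h) <= snd p + h / 2.
Proof.
intros Hh. assert (K := HQ (fst p) (snd p) h Hh). unfold bisect_step.
destruct (Rle_dec _ _); [simpl; repeat split; lra|].
destruct (Rle_dec _ _); [simpl; repeat split; lra|].
destruct (Rle_dec _ _); simpl; repeat split; lra.
Qed.

Fixpoint bisect_seq (a c h : R) (n : nat) : R * R :=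
  match n with O => (a, c) | S m => bisect_step (bisect_seq a c h m) (h / 2 ^ m) end.

Lemma nested_limit (u : nat -> R) h : 0 < h ->
  (forall n, u n <= u (S n) <= u n + h / 2 ^ n / 2) -> exists A, forall n, u n <= A <= u n + h / 2 ^ n.
Proof.
intros Hh Hu.
assert (P : forall n, 0 < 2 ^ n) by (intros; apply pow_lt; lra).
assert (Inc : forall n k, u n <= u (k + n)%nat).
{ intros n k; induction k as [|k IH]; simpl; [lra|]. destruct (Hu (k + n)%nat); lra. }
assert (Dec : forall n k, u (k + n)%nat + h / 2 ^ (k + n) <= u n + h / 2 ^ n).
{ intros n k; induction k as [|k IH]; simpl; [lra|]. destruct (Hu (k + n)%nat) as [_ H1].
  specialize (P (k + n)%nat). replace (h / (2 * 2 ^ (k + n))) with (h / 2 ^ (k + n) / 2) by (field; lra). lra. }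
assert (Up : forall n m, u n <= u m + h / 2 ^ m).
{ intros n m. assert (0 < h / 2 ^ n) by (apply Rdiv_lt_0_compat; auto). assert (0 < h / 2 ^ m) by (apply Rdiv_lt_0_compat; auto).
  destruct (Nat.le_gt_cases n m) as [L|L].
  - replace m with ((m - n) + n)%nat by lia. assert (K := Inc n (m - n)%nat).
    replace (m - n + n)%nat with m in * by lia. lra.
  - assert (K := Dec m (n - m)%nat). replace (n - m + m)%nat with n in * by lia. lra. }
destruct (completeness (fun x => exists n, x = u n)) as [A [HA1 HA2]].
- exists (u 0%nat + h / 2 ^ 0). intros x [n ->]. apply Up.
- exists (u 0%nat). exists 0%nat. reflexivity.
- exists A. intros n. split; [apply HA1; exists n; reflexivity|].
  apply HA2. intros x [m ->]. apply Up.
Qed.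

(** Repeated bisection of a square for a subadditive quantity [Q]: the retained
squares shrink to a point [(A, C)] while [Q] loses at most the factor 4 that
the area loses. *)
Lemma bisection a c h : 0 < h -> exists A C, forall n, exists a' c',
  a' <= A <= a' + h / 2 ^ n /\ c' <= C <= c' + h / 2 ^ n /\ Q a c h <= 4 ^ n * Q a' c' (h / 2 ^ n).
Proof.
intros Hh.
assert (Ph : forall n, 0 < h / 2 ^ n) by (intros; apply Rdiv_lt_0_compat; [exact Hh|apply pow_lt; lra]).
destruct (nested_limit (fun n => fst (bisect_seq a c h n)) h Hh) as [A HA].
{ intros n. apply (bisect_step_spec (bisect_seq a c h n) (h / 2 ^ n) (Ph n)). }
destruct (nested_limit (fun n => snd (bisect_seq a c h n)) h Hh) as [C HC].
{ intros n. apply (bisect_step_spec (bisect_seq a c h n) (h / 2 ^ n) (Ph n)). }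
exists A, C. intros n. exists (fst (bisect_seq a c h n)), (snd (bisect_seq a c h n)).
split; [apply HA|]. split; [apply HC|].
induction n as [|n IH].
- simpl. unfold Rdiv. rewrite Rinv_1, Rmult_1_r, Rmult_1_l. lra.
- apply Rle_trans with (1 := IH). simpl.
  destruct (bisect_step_spec (bisect_seq a c h n) (h / 2 ^ n) (Ph n)) as [K _].
  assert (P : 0 < 2 ^ n) by (apply pow_lt; lra). assert (P4 : 0 < 4 ^ n) by (apply pow_lt; lra).
  replace (h / (2 * 2 ^ n)) with (h / 2 ^ n / 2) by (field; lra).
  rewrite (Rmult_comm 4), Rmult_assoc. apply Rmult_le_compat_l; [lra|exact K].
Qed.
End Bisection.

(** Near the limit point of the bisection [f] is affine up to [e |z - z0|].  The affine
part integrates to 0, the error to at most a constant times [e] times the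
area, and this is the scale kept by the bisection. *)
Theorem Goursat f a c h : holo f -> 0 < h -> rect_int f a (a + h) c (c + h) = 0.
Proof.
intros Hf Hh.
destruct (bisection (fun a c h => Cmod (rect_int f a (a + h) c (c + h)))) with (a := a) (c := c) (h := h) as [A [B HAB]]; [|exact Hh|].
{ clear a c h Hh. intros a c h Hh.
  rewrite (rect_int_split f a (a + h / 2) (a + h) c (c + h / 2) (c + h) Hf).
  replace (a + h / 2 + h / 2) with (a + h) by field. replace (c + h / 2 + h / 2) with (c + h) by field.
  apply Rle_trans with (1 := Cmod_triangle _ _). apply Rplus_le_compat_r.
  apply Rle_trans with (1 := Cmod_triangle _ _). apply Rplus_le_compat_r. apply Cmod_triangle. }
apply Cmod_eq_0, Rle_antisym; [|apply Cmod_ge_0]. apply le_epsilon. intros eps He. rewrite Rplus_0_l.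
destruct (Hf (A, B)) as [l Hl].
(* a square of side k has perimeter 4 k, and its points are within 2 k of z0 *)
set (e := eps / (8 * h ^ 2)). assert (h2 : 0 < h ^ 2) by (apply pow_lt, Hh).
assert (e0 : 0 < e) by (apply Rdiv_lt_0_compat; lra).
destruct (Hl e e0) as [d [Hd Hb]].
assert (En : exists n, 2 * (h / 2 ^ n) < d).
{ destruct (pow_lt_1_zero (/ 2)) with (y := d / (2 * h)) as [N HN].
  - rewrite Rabs_pos_eq; lra.
  - apply Rdiv_lt_0_compat; lra.
  - exists N. specialize (HN N (Nat.le_refl _)). rewrite pow_inv, Rabs_pos_eq in HN.
    + unfold Rdiv. apply (Rmult_lt_compat_l (2 * h)) in HN; [|lra].
      replace (2 * h * (d / (2 * h))) with d in HN by (field; lra). lra.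
    + left; apply Rinv_0_lt_compat, pow_lt; lra. }
destruct En as [n Hn]. destruct (HAB n) as [a' [c' [Ha [Hc HQ]]]].
apply Rle_trans with (1 := HQ).
set (k := h / 2 ^ n) in *. assert (P2 : 0 < 2 ^ n) by (apply pow_lt; lra).
assert (k0 : 0 < k) by (apply Rdiv_lt_0_compat; assumption).
set (z0 := ((A, B) : C)).
set (g := fun z : C => (f z0 + l * (z - z0))%C).
assert (Hg : holo g).
{ intros z. eexists. unfold g. apply hol_plus; [apply hol_const|]. apply hol_mult; [apply hol_const|].
  apply (hol_plus (fun z => z)); [apply hol_id|apply hol_const]. }
assert (Rg : rect_int g a' (a' + k) c' (c' + k) = 0).
{ apply (rect_int_primitive (fun z => (f z0 - l * z0) * z + l * / 2 * (z * z))%C); [|exact Hg].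
  intros z. eapply hol_eq.
  - apply hol_plus; [apply hol_mult; [apply hol_const|apply hol_id]|].
    apply hol_mult; [apply hol_const|apply hol_mult; apply hol_id].
  - unfold g. field. }
assert (Hr : holo (fun z => f z - g z)%C).
{ intros z. destruct (Hf z) as [l1 H1]. destruct (Hg z) as [l2 H2]. eexists.
  apply hol_minus; eassumption. }
assert (E := rect_int_minus f g a' (a' + k) c' (c' + k) Hf Hg). rewrite Rg in E.
replace (rect_int f a' (a' + k) c' (c' + k)) with (rect_int (fun z => f z - g z)%C a' (a' + k) c' (c' + k)) by (rewrite E; ring).
apply Rle_trans with (4 ^ n * (2 * ((a' + k - a') + (c' + k - c')) * (e * (2 * k)))).
- apply Rmult_le_compat_l; [apply pow_le; lra|].
  apply rect_int_bound; [exact Hr|lra|lra|].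
  intros x y Hx Hy.
  set (u := (((x, y) : C) - z0)%C).
  assert (Hu : Cmod u <= 2 * k).
  { apply Rle_trans with (1 := Cmod_le_2max u). unfold u, z0; simpl.
    apply Rmult_le_compat_l; [lra|]. apply Rmax_lub; apply Rabs_le; lra. }
  specialize (Hb u ltac:(lra)). fold z0 in Hb.
  replace (z0 + u)%C with ((x, y) : C) in Hb by (unfold u, z0, Cplus, Cminus, Cplus, Copp; simpl; f_equal; ring).
  unfold g. fold u. replace (f (x, y) - (f z0 + l * u))%C with (f (x, y) - f z0 - l * u)%C by (simpl; generalize (f (x, y)) (f z0) (l * u)%C; intros; ring).
  apply Rle_trans with (1 := Hb). apply Rmult_le_compat_l; lra.
- right. replace (4 ^ n) with (2 ^ n * 2 ^ n) by (rewrite <- Rpow_mult_distr; f_equal; ring).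
  unfold e, k. field. lra.
Qed.

(** * Unique continuation from a half-plane *)

Lemma cont_bounded (p : R -> R) a b : (forall x, continuous p x) ->
  exists M, 0 <= M /\ forall x, a <= x <= b -> Rabs (p x) <= M.
Proof.
intros Hp. destruct (Rle_dec a b) as [H|H].
- destruct (continuity_ab_maj (fun x => Rabs (p x)) a b H) as [Mx [H1 H2]].
  { intros c _. apply continuity_pt_filterlim.
    apply (continuous_comp p Rabs); [apply Hp|apply continuous_Rabs]. }
  exists (Rabs (p Mx)). split; [apply Rabs_pos|exact H1].
- exists 0. split; [lra|]. intros x Hx. lra.
Qed.

(** Around a point where [p] is positive the Gaussian of width [1 / n] collects an
amount of order [1 / n], which exceeds [K exp (- n^2)] for large [n]. *)
Lemma gauss_concentration (p : R -> R) v b K : (forall x, continuous p x) -> 0 < b -> 0 < p v ->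
  (forall n, (0 < n)%nat ->
    Rabs (RInt (fun y => p y * exp (- (INR n ^ 2 * (y - v) ^ 2))) (v - b) (v + b)) <= K * exp (- INR n ^ 2)) -> False.
Proof.
intros Hp Hb Hv HK.
assert (Loc : exists eta, 0 < eta /\ forall y, Rabs (y - v) <= eta -> p v / 2 <= p y).
{ assert (He : 0 < p v / 2) by lra.
  destruct (proj1 (filterlim_locally p (p v)) (Hp v) (mkposreal _ He)) as [d Hd].
  exists (d / 2). assert (Pd := cond_pos d). split; [lra|]. intros y Hy.
  assert (Q : Rabs (y - v) < d) by lra. specialize (Hd y Q).
  unfold ball in Hd; simpl in Hd; unfold AbsRing_ball, abs, minus, plus, opp in Hd; simpl in Hd.
  apply Rabs_def2 in Hd. lra. }
destruct Loc as [eta [He Hloc]].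
destruct (cont_bounded p (v - b) (v + b) Hp) as [M [M0 HM]].
assert (K0 : 0 <= K).
{ specialize (HK 1%nat ltac:(lia)). assert (P := exp_pos (- INR 1 ^ 2)).
  assert (Q := Rabs_pos (RInt (fun y => p y * exp (- (INR 1 ^ 2 * (y - v) ^ 2))) (v - b) (v + b))).
  destruct (Rle_lt_dec 0 K); [assumption|]. nra. }
set (mu := p v / 2) in *. assert (mu0 : 0 < mu) by (unfold mu; lra).
(* for n > Z the lower bound of order 1 / n wins *)
set (Z := (K + 2 * b * M / eta ^ 2) / (2 * mu / 3)).
assert (e2 : 0 < eta ^ 2) by (apply pow_lt, He).
destruct (INR_unbounded (Rmax (Rmax (/ eta) (/ b)) Z)) as [n Hn].
assert (Hn1 : / eta < INR n) by (apply Rle_lt_trans with (2 := Hn); eapply Rle_trans; [apply Rmax_l|apply Rmax_l]).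
assert (Hn2 : / b < INR n) by (apply Rle_lt_trans with (2 := Hn); eapply Rle_trans; [apply Rmax_r|apply Rmax_l]).
assert (Hn3 : Z < INR n) by (apply Rle_lt_trans with (2 := Hn); apply Rmax_r).
assert (n0 : 0 < INR n) by (apply Rlt_trans with (2 := Hn1), Rinv_0_lt_compat, He).
specialize (HK n ltac:(apply INR_lt; simpl; exact n0)).
set (m := INR n) in *.
assert (i0 : 0 < / m) by (apply Rinv_0_lt_compat, n0).
assert (ie : / m < eta). { rewrite <- (Rinv_inv eta). apply Rinv_lt_contravar; [|exact Hn1]. apply Rmult_lt_0_compat; [apply Rinv_0_lt_compat|]; lra. }
assert (ib : / m < b). { rewrite <- (Rinv_inv b). apply Rinv_lt_contravar; [|exact Hn2]. apply Rmult_lt_0_compat; [apply Rinv_0_lt_compat|]; lra. }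
set (q := fun y => p y * exp (- (m ^ 2 * (y - v) ^ 2))) in *.
assert (Cq : forall x, continuous q x).
{ intros x. apply (continuous_mult (K := R_AbsRing)); [apply Hp|].
  apply cont_of_derive. auto_derive; trivial. }
set (s := M * exp (- (m ^ 2 * eta ^ 2))).
assert (s0 : 0 <= s) by (apply Rmult_le_pos; [exact M0|left; apply exp_pos]).
(* away from the centre the integrand is at least -s, close to it at least mu/3 *)
assert (Q1 : forall y, v - b <= y <= v + b -> - s <= q y).
{ intros y Hy. unfold q. assert (Pe := exp_pos (- (m ^ 2 * (y - v) ^ 2))).
  destruct (Rle_dec (Rabs (y - v)) eta) as [L|L].
  - specialize (Hloc y L). nra.
  - specialize (HM y Hy). apply Rabs_le_between in HM.
    apply Rle_trans with (- (M * exp (- (m ^ 2 * (y - v) ^ 2)))); [|nra].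
    apply Ropp_le_contravar, Rmult_le_compat_l; [exact M0|]. apply exp_le_mono.
    apply Ropp_le_contravar, Rmult_le_compat_l; [apply pow_le; lra|].
    rewrite <- (pow2_abs (y - v)). apply pow_incr. lra. }
assert (Q2 : forall y, v - / m <= y <= v + / m -> mu / 3 <= q y).
{ intros y Hy. unfold q. assert (L : Rabs (y - v) <= / m) by (apply Rabs_le; lra).
  specialize (Hloc y ltac:(lra)).
  apply Rle_trans with (mu * exp (Ropp 1)).
  - unfold Rdiv. apply Rmult_le_compat_l; [lra|]. rewrite exp_Ropp. apply Rinv_le_contravar; [apply exp_pos|apply exp_le_3].
  - apply Rmult_le_compat; [lra|left; apply exp_pos|exact Hloc|]. apply exp_le_mono.
    rewrite <- (pow2_abs (y - v)). assert (A0 := Rabs_pos (y - v)).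
    assert (m * Rabs (y - v) <= 1). { apply Rle_trans with (m * / m); [apply Rmult_le_compat_l; lra|right; field; lra]. }
    assert (0 <= m * Rabs (y - v)) by (apply Rmult_le_pos; lra).
    replace (m ^ 2 * Rabs (y - v) ^ 2) with ((m * Rabs (y - v)) * (m * Rabs (y - v))) by ring. nra. }
assert (LB : forall a c k, a <= c -> (forall y, a <= y <= c -> k <= q y) -> (c - a) * k <= RInt q a c).
{ intros a c k Hac Hk. rewrite <- (RInt_const (V := R_CompleteNormedModule)).
  apply RInt_le; [exact Hac|apply ex_RInt_const|apply ex_RInt_cont, Cq|]. intros; apply Hk; lra. }
assert (L1 := LB (v - b) (v - / m) (- s) ltac:(lra) ltac:(intros; apply Q1; lra)).
assert (L2 := LB (v - / m) (v + / m) (mu / 3) ltac:(lra) Q2).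
assert (L3 := LB (v + / m) (v + b) (- s) ltac:(lra) ltac:(intros; apply Q1; lra)).
assert (EX : forall a c, ex_RInt q a c) by (intros; apply ex_RInt_cont, Cq).
assert (S1 := RInt_Chasles (V := R_CompleteNormedModule) q (v - b) (v - / m) (v + b) (EX _ _) (EX _ _)).
assert (S2 := RInt_Chasles (V := R_CompleteNormedModule) q (v - / m) (v + / m) (v + b) (EX _ _) (EX _ _)).
unfold plus in S1, S2; simpl in S1, S2.
assert (Tot : 2 * / m * (mu / 3) - 2 * b * s <= K * exp (- m ^ 2)).
{ apply Rle_trans with (2 := HK). apply Rle_trans with (2 := Rle_abs _). nra. }
assert (m2 : 0 < m ^ 2) by (apply pow_lt, n0).
assert (U : forall x, 0 < x -> exp (- x) <= / x).
{ intros x Hx. rewrite exp_Ropp. apply Rinv_le_contravar; [exact Hx|]. assert (T := exp_ineq1_le x). lra. }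
assert (U1 := U (m ^ 2) m2). assert (U2 := U (m ^ 2 * eta ^ 2) ltac:(nra)).
assert (Tot2 : 2 * mu / 3 * m <= K + 2 * b * M / eta ^ 2).
{ assert (E1 : K * exp (- m ^ 2) <= K * / m ^ 2) by (apply Rmult_le_compat_l; lra).
  assert (E2 : 2 * b * s <= 2 * b * (M * / (m ^ 2 * eta ^ 2))).
  { apply Rmult_le_compat_l; [lra|]. unfold s. apply Rmult_le_compat_l; lra. }
  assert (E3 : 2 * / m * (mu / 3) <= K * / m ^ 2 + 2 * b * (M * / (m ^ 2 * eta ^ 2))) by lra.
  apply (Rmult_le_compat_l (m ^ 2)) in E3; [|lra].
  replace (m ^ 2 * (2 * / m * (mu / 3))) with (2 * mu / 3 * m) in E3 by (field; lra).
  replace (m ^ 2 * (K * / m ^ 2 + 2 * b * (M * / (m ^ 2 * eta ^ 2)))) with (K + 2 * b * M / eta ^ 2) in E3 by (field; lra).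
  exact E3. }
assert (ZZ : 2 * mu / 3 * Z < 2 * mu / 3 * m) by (apply Rmult_lt_compat_l; lra).
unfold Z in ZZ. replace (2 * mu / 3 * ((K + 2 * b * M / eta ^ 2) / (2 * mu / 3))) with (K + 2 * b * M / eta ^ 2) in ZZ by (field; lra).
lra.
Qed.

(** Let [g] be nonzero at [w].  On the square of side [2 b] whose left side is centred
at [w], the factor [exp (n^2 (z - w)^2)] is a Gaussian on the left side and is at
most [exp (- n^2)] on the horizontal sides up to the abscissa 1, beyond which
[g] vanishes.  By Goursat's theorem the Gaussian averages of [g] over the left side are
[O (exp (- n^2))], contradicting [gauss_concentration]. *)
Theorem entire_zero_halfplane g : holo g -> (forall z, 1 < Re z -> g z = 0) -> forall z, g z = 0.
Proof.
intros Hg H0 [a v]. destruct (Rlt_le_dec 1 a) as [Ha|Ha]; [apply H0; exact Ha|].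
destruct (classic (g (a, v) = 0)) as [|NZ]; [assumption|exfalso].
set (b := 2 - a). assert (b1 : 1 <= b) by (unfold b; lra).
set (w := ((a, v) : C)) in *.
assert (Bd : exists M, 0 <= M /\ forall x, a <= x <= a + 2 * b -> Cmod (g (x, v - b)) <= M /\ Cmod (g (x, v + b)) <= M).
{ destruct (cont_bounded (fun x => Cmod (g (x, v - b))) a (a + 2 * b)) as [M1 [P1 H1]].
  { intros x. apply (continuous_Cmod (fun x => g (x, v - b))), holo_ccont_x, Hg. }
  destruct (cont_bounded (fun x => Cmod (g (x, v + b))) a (a + 2 * b)) as [M2 [P2 H2]].
  { intros x. apply (continuous_Cmod (fun x => g (x, v + b))), holo_ccont_x, Hg. }
  exists (M1 + M2). split; [lra|]. intros x Hx. specialize (H1 x Hx). specialize (H2 x Hx).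
  rewrite Rabs_pos_eq in H1, H2 by apply Cmod_ge_0. lra. }
destruct Bd as [M [M0 HM]].
set (phi := fun (n : nat) (z : C) => Cexp (RtoC (INR n ^ 2) * ((z - w) * (z - w)))%C).
set (F := fun (n : nat) (z : C) => (g z * phi n z)%C).
assert (Hphi : forall n, holo (phi n)).
{ intros n z. eexists. unfold phi.
  apply (hol_comp Cexp (fun z => RtoC (INR n ^ 2) * ((z - w) * (z - w)))%C); [|apply hol_Cexp].
  apply hol_mult; [apply hol_const|].
  apply hol_mult; apply (hol_plus (fun z => z)); first [apply hol_id|apply hol_const]. }
assert (HF : forall n, holo (F n)).
{ intros n z. destruct (Hg z) as [l1 H1]. destruct (Hphi n z) as [l2 H2]. eexists. apply hol_mult; eassumption. }
assert (mphi : forall n x y, Cmod (phi n (x, y)) = exp (INR n ^ 2 * ((x - a) ^ 2 - (y - v) ^ 2))).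
{ intros n x y. unfold phi. rewrite Cmod_Cexp, re_scal_l. f_equal. f_equal. unfold w; simpl. ring. }
(* horizontal sides: the Gaussian factor is at most exp (- n^2) where g does not vanish *)
assert (Hor : forall n y, (y = v - b \/ y = v + b) ->
  Cmod (cint (fun x => F n (x, y)) a (a + 2 * b)) <= 2 * b * (M * exp (- INR n ^ 2))).
{ intros n y Hy. replace (2 * b) with (Rabs (a + 2 * b - a)) at 2 by (rewrite Rabs_pos_eq; lra).
  apply cint_bound_const; [apply holo_ccont_x, HF|]. rewrite Rmin_left, Rmax_right by lra. intros x Hx.
  assert (Pe := exp_pos (- INR n ^ 2)).
  destruct (Rlt_le_dec 1 x) as [L|L].
  - unfold F. rewrite H0 by exact L. rewrite Cmult_0_l, Cmod_0. apply Rmult_le_pos; lra.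
  - unfold F. rewrite Cmod_mult, mphi. apply Rmult_le_compat; [apply Cmod_ge_0|left; apply exp_pos| |].
    + destruct Hy as [-> | ->]; apply HM, Hx.
    + apply exp_le_mono. assert (Pn : 0 <= INR n ^ 2) by (apply pow_le, pos_INR).
      assert (Eb : (y - v) ^ 2 = b ^ 2) by (destruct Hy as [-> | ->]; ring).
      rewrite Eb. assert ((x - a) ^ 2 - b ^ 2 <= -1) by (unfold b in *; nra). nra. }
assert (Ver : forall n, Cmod (cint (fun y => F n (a, y)) (v - b) (v + b)) <= 4 * b * M * exp (- INR n ^ 2)).
{ intros n. assert (G := Goursat (F n) a (v - b) (2 * b) (HF n) ltac:(lra)).
  replace (v - b + 2 * b) with (v + b) in G by ring. unfold rect_int in G.
  rewrite (cint_ext (fun y => F n (a + 2 * b, y)) (fun _ => 0)) in G.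
  2: { intros y _. unfold F. rewrite H0; [ring|]. simpl. unfold b; lra. }
  replace (cint (fun _ => 0) (v - b) (v + b)) with (RtoC 0) in G.
  2: { symmetry. rewrite (cint_FTC (fun _ => 0) (fun _ => 0)); [ring|intros; apply cderive_const|apply ccont_const]. }
  assert (E : cint (fun y => F n (a, y)) (v - b) (v + b) =
    (- Ci * (cint (fun x => F n (x, (v - b)%R)) a (a + 2 * b)%R - cint (fun x => F n (x, (v + b)%R)) a (a + 2 * b)%R))%C).
  { set (I := cint (fun y => F n (a, y)) (v - b) (v + b)) in *.
    set (J := cint (fun x => F n (x, v - b)) a (a + 2 * b)) in *.
    set (L := cint (fun x => F n (x, v + b)) a (a + 2 * b)) in *.
    replace (J - L)%C with ((J - L + Ci * (0 - I)) + Ci * I)%C by ring. rewrite G.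
    replace (- Ci * (0 + Ci * I))%C with (- (Ci * Ci) * I)%C by ring. rewrite Ci2. ring. }
  rewrite E, Cmod_mult, Cmod_opp.
  rewrite Cmod_Ci, Rmult_1_l. apply Rle_trans with (1 := Cmod_triangle _ _). rewrite Cmod_opp.
  assert (T1 := Hor n (v - b) ltac:(auto)). assert (T2 := Hor n (v + b) ltac:(auto)). lra. }
set (k := Cmod (g w)). assert (k0 : 0 < k) by (apply Cmod_gt_0, NZ).
set (p := fun y => fst (Cconj (g w) * g (a, y))%C).
assert (Cp : ccont (fun y => Cconj (g w) * g (a, y))%C) by (apply ccont_mult; [apply ccont_const|apply holo_ccont_y, Hg]).
apply (gauss_concentration p v b (k * (4 * b * M))).
- intros x. apply (proj1 (Cp x)).
- lra.
- unfold p. fold w. destruct (g w) as [g1 g2] eqn:Eg. simpl.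
  assert (Q : 0 < k ^ 2) by (apply pow_lt, k0). unfold k in Q. rewrite Cmod2_alt in Q. simpl in Q. lra.
- intros n _.
  assert (E : fst (Cconj (g w) * cint (fun y => F n (a, y)) (v - b) (v + b))%C =
     RInt (fun y => p y * exp (- (INR n ^ 2 * (y - v) ^ 2))) (v - b) (v + b)).
  { rewrite <- cint_scal by (apply holo_ccont_y, HF). unfold cint. apply RInt_ext. intros y _.
    unfold p, F. assert (Ph : phi n (a, y) = RtoC (exp (- (INR n ^ 2 * (y - v) ^ 2)))).
    { unfold phi. rewrite <- Cexp_RtoC. f_equal. unfold w, Cmult, Cminus, Cplus, Copp, RtoC; simpl. f_equal; ring. }
    change (fst (Cconj (g w) * (g (a, y) * phi n (a, y)))%C = fst (Cconj (g w) * g (a, y))%C * exp (- (INR n ^ 2 * (y - v) ^ 2))).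
    rewrite Ph. destruct (g w), (g (a, y)). simpl. Rring. }
  rewrite <- E. apply Rle_trans with (1 := re_le_Cmod _). rewrite Cmod_mult, Cmod_conj. fold k.
  rewrite Rmult_assoc. apply Rmult_le_compat_l; [lra|apply Ver].
Qed.

(** * Grid sums of Schwartz functions *)

(** Syntactic polynomials: they keep all derivatives of a polynomial times a
Gaussian within one family, with a computable differentiation. *)
Inductive pexp := PC (c : R) | PX | PA (p q : pexp) | PM (p q : pexp).

Fixpoint peval (p : pexp) (y : R) : R :=
  match p with PC c => c | PX => y | PA p q => peval p y + peval q y | PM p q => peval p y * peval q y end.

Fixpoint pder (p : pexp) : pexp :=
  match p with PC c => PC 0 | PX => PC 1 | PA p q => PA (pder p) (pder q)
  | PM p q => PA (PM (pder p) q) (PM p (pder q)) end.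

Lemma is_derive_peval p y : is_derive (peval p) y (peval (pder p) y).
Proof.
induction p as [c| |p IHp q IHq|p IHp q IHq]; simpl.
- apply (is_derive_const (K := R_AbsRing) (V := R_NormedModule)).
- apply (is_derive_id (K := R_AbsRing)).
- apply (is_derive_plus (K := R_AbsRing) (V := R_NormedModule)); assumption.
- apply is_derive_Rmult; assumption.
Qed.

Lemma expbd_peval p : expbd (fun y => RtoC (peval p y)).
Proof.
induction p as [c| |p [Hp1 Hp2] q [Hq1 Hq2]|p Hp q Hq]; simpl.
- apply expbd_const.
- apply expbd_id.
- destruct (expbd_plus _ _ (conj Hp1 Hp2) (conj Hq1 Hq2)) as [H1 [M [B H2]]].
  split; [apply (ccont_ext _ _ (fun y => eq_sym (RtoC_plus (peval p y) (peval q y))) H1)|].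
  exists M, B. destruct H2 as [HM [HB H2]]. repeat split; try assumption.
  intros u. rewrite RtoC_plus. apply H2.
- destruct (expbd_mult _ _ Hp Hq) as [H1 [M [B H2]]].
  split; [apply (ccont_ext _ _ (fun y => eq_sym (RtoC_mult (peval p y) (peval q y))) H1)|].
  exists M, B. destruct H2 as [HM [HB H2]]. repeat split; try assumption.
  intros u. rewrite RtoC_mult. apply H2.
Qed.

Definition pgauss (p : pexp) (y : R) : R := peval p y * exp (- (PI * y ^ 2)).

(** Differentiation of [pgauss], using that [exp (- PI y^2)] has derivative
[- 2 PI y exp (- PI y^2)]. *)
Definition pgauss_der (p : pexp) : pexp := PA (pder p) (PM (PM (PC (- 2 * PI)) PX) p).

Lemma PI_gt_1 : 1 < PI.
Proof. assert (H := PI2_1). lra. Qed.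

Lemma is_derive_pgauss p y : is_derive (pgauss p) y (pgauss (pgauss_der p) y).
Proof.
eapply is_derive_eq.
- apply is_derive_Rmult; [apply is_derive_peval|].
  instantiate (1 := (- 2 * PI * y) * exp (- (PI * y ^ 2))). auto_derive; [trivial|simpl; ring].
- unfold pgauss, pgauss_der; simpl. ring.
Qed.

Lemma rapid_pgauss p : rapid (fun y => RtoC (pgauss p y)).
Proof.
apply rapid_ext with (fun y => RtoC (exp (- (PI * y ^ 2))) * RtoC (peval p y))%C.
{ intros y. unfold pgauss. rewrite RtoC_mult. ring. }
apply rapid_mult; [|apply expbd_peval].
split.
- apply ccont_RtoC. intros x. apply cont_of_derive. auto_derive; trivial.
- intros A. destruct (proj2 rapid_gauss A) as [M HM]. exists M. intros u. apply Rle_trans with (2 := HM u).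
  rewrite !Cmod_R, !Rabs_pos_eq by (left; apply exp_pos). apply exp_le_mono.
  assert (P := PI_gt_1). assert (Q := pow2_ge_0 u). nra.
Qed.

Lemma exp_pow v n : exp v ^ n = exp (INR n * v).
Proof.
induction n as [|n IH]; [simpl; rewrite Rmult_0_l, exp_0; reflexivity|].
rewrite S_INR, Rmult_plus_distr_r, exp_plus, Rmult_1_l, <- IH. simpl. ring.
Qed.

(** Choosing [m] separately on each side gives decay at both ends after
multiplication by an exponential. *)
Lemma pgauss_bound p (K : nat) : exists M, 0 <= M /\ forall v m, 0 <= m <= INR K -> Rabs (pgauss p (exp v)) <= M * exp (- m * v).
Proof.
destruct (rapid_bound _ 1 (rapid_pgauss p)) as [M [M0 HM]].
assert (F0 := INR_fact_lt_0 K).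
exists (M * (1 + INR (fact K))). split; [apply Rmult_le_pos; lra|]. intros v m Hm.
specialize (HM (exp v)). rewrite Cmod_R in HM.
assert (Ev := exp_pos v). rewrite (Rabs_pos_eq (exp v)) in HM by lra.
assert (Em := exp_pos (- m * v)).
replace (Ropp 1 * exp v) with (- exp v) in HM by ring.
destruct (Rle_dec v 0) as [L|L].
- apply Rle_trans with (1 := HM).
  assert (exp (- exp v) <= 1) by (rewrite <- exp_0; apply exp_le_mono; lra).
  assert (1 <= exp (- m * v)) by (rewrite <- exp_0; apply exp_le_mono; nra).
  rewrite Rmult_assoc. apply Rmult_le_compat_l; [exact M0|]. assert (P := exp_pos (- exp v)). nra.
- assert (P := pow_le_exp (exp v) K (Rlt_le _ _ Ev)).
  rewrite exp_pow in P.
  apply Rle_trans with (1 := HM). rewrite Rmult_assoc. apply Rmult_le_compat_l; [exact M0|].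
  rewrite exp_Ropp. apply Rle_trans with (INR (fact K) * exp (- (INR K * v))).
  + rewrite exp_Ropp. assert (Pk := exp_pos (INR K * v)). assert (Pe := exp_pos (exp v)).
    apply (Rmult_le_reg_r (exp (exp v) * exp (INR K * v))); [apply Rmult_lt_0_compat; assumption|].
    replace (/ exp (exp v) * (exp (exp v) * exp (INR K * v))) with (exp (INR K * v)) by (field; lra).
    replace (INR (fact K) * / exp (INR K * v) * (exp (exp v) * exp (INR K * v))) with (INR (fact K) * exp (exp v)) by (field; lra).
    exact P.
  + assert (exp (- (INR K * v)) <= exp (- m * v)) by (apply exp_le_mono; nra). nra.
Qed.

Fixpoint rsum (f : nat -> R) (n : nat) : R := match n with O => 0 | S m => rsum f m + f m end.

Lemma rsum_sum_n f n : rsum f (S n) = sum_n f n.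
Proof.
induction n as [|n IH]; [rewrite sum_O; simpl; ring|].
rewrite sum_Sn, <- IH. reflexivity.
Qed.

Lemma rsum_le f g n : (forall i, f i <= g i) -> rsum f n <= rsum g n.
Proof. intros H; induction n as [|n IH]; simpl; [lra|specialize (H n); lra]. Qed.

Lemma rsum_abs f n : Rabs (rsum f n) <= rsum (fun i => Rabs (f i)) n.
Proof.
induction n as [|n IH]; simpl; [rewrite Rabs_R0; lra|].
apply Rle_trans with (1 := Rabs_triang _ _). lra.
Qed.

Lemma rsum_scal c f n : rsum (fun i => c * f i) n = c * rsum f n.
Proof. induction n as [|n IH]; simpl; [ring|rewrite IH; ring]. Qed.

Lemma rsum_tele (F : nat -> R) n : rsum (fun i => F (S i) - F i) n = F n - F 0%nat.
Proof. induction n as [|n IH]; simpl; [ring|rewrite IH; ring]. Qed.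

Lemma rsum_head f n : rsum f (S n) = f 0%nat + rsum (fun i => f (S i)) n.
Proof. induction n as [|n IH]; [simpl; ring|]. change (rsum f (S (S n))) with (rsum f (S n) + f (S n)). rewrite IH. simpl. ring. Qed.

Lemma rsum_ext f g n : (forall i, f i = g i) -> rsum f n = rsum g n.
Proof. intros H; induction n as [|n IH]; simpl; [reflexivity|rewrite IH, H; reflexivity]. Qed.

(** Makes the sum of [wt] over a grid of step 1 telescope. *)
Lemma wt_le_atan y : wt y <= 3 * (atan (y + 1) - atan y).
Proof.
assert (H : RInt (fun _ => wt y) y (y + 1) <= RInt (fun t => 3 * wt t) y (y + 1)).
{ apply RInt_le; [lra|apply ex_RInt_const| |].
  - apply (ex_RInt_scal (V := R_NormedModule) wt). eexists; apply is_RInt_wt.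
  - intros t Ht. unfold wt.
    replace (3 * / (1 + t ^ 2)) with (/ ((1 + t ^ 2) / 3)) by (field; nra).
    apply Rinv_le_contravar; [nra|].
    assert (Q : 0 <= (2 * y - t) ^ 2) by apply pow2_ge_0. nra. }
rewrite (RInt_const (V := R_CompleteNormedModule)) in H.
assert (E : RInt (fun t => 3 * wt t) y (y + 1) = 3 * (atan (y + 1) - atan y)).
{ apply (is_RInt_unique (V := R_CompleteNormedModule)). apply (is_RInt_scal (V := R_NormedModule) wt), is_RInt_wt. }
rewrite E in H. unfold scal in H; simpl in H; unfold mult in H; simpl in H. lra.
Qed.

(** The grid [(Z + x) eps], truncated so that a shift of [x] by 1 drops one point and
adds one. *)
Definition grid_sum (h : R -> R) (eps : R) (N : nat) (x : R) : R :=
  rsum (fun i => h ((INR i - INR N + x) * eps)) (2 * N).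

(** Comparison of [wt (eps y)] with [wt y / eps^2] reduces the grid of step [eps] to
the grid of step 1. *)
Lemma grid_sum_bound h M eps N x : 0 <= M -> (forall y, Rabs (h y) <= M * wt y) -> 0 < eps <= 1 ->
  Rabs (grid_sum h eps N x) <= 3 * PI * M * / eps ^ 2.
Proof.
intros M0 HM He. assert (e2 : 0 < eps ^ 2) by (apply pow_lt; lra).
apply Rle_trans with (1 := rsum_abs _ _).
set (F := fun i : nat => atan (INR i - INR N + x)).
apply Rle_trans with (rsum (fun i => (3 * M * / eps ^ 2) * (F (S i) - F i)) (2 * N)).
- apply rsum_le. intros i. apply Rle_trans with (1 := HM _).
  set (y := INR i - INR N + x).
  assert (E : F (S i) - F i = atan (y + 1) - atan y).
  { unfold F. rewrite S_INR. unfold y. f_equal. f_equal. ring. }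
  rewrite E. assert (W := wt_le_atan y).
  replace (3 * M * / eps ^ 2 * (atan (y + 1) - atan y)) with (M * (/ eps ^ 2 * (3 * (atan (y + 1) - atan y)))) by ring.
  apply Rmult_le_compat_l; [exact M0|].
  apply Rle_trans with (/ eps ^ 2 * wt y).
  + unfold wt. rewrite <- Rinv_mult. apply Rinv_le_contravar; [apply Rmult_lt_0_compat; [exact e2|nra]|].
    rewrite Rpow_mult_distr. assert (eps ^ 2 <= 1) by nra. nra.
  + apply Rmult_le_compat_l; [left; apply Rinv_0_lt_compat, e2|exact W].
- rewrite rsum_scal, rsum_tele. unfold F.
  assert (B1 := atan_bound (INR (2 * N) - INR N + x)). assert (B2 := atan_bound (INR 0 - INR N + x)).
  replace (3 * PI * M * / eps ^ 2) with (3 * M * / eps ^ 2 * PI) by ring.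
  apply Rmult_le_compat_l; [|lra]. apply Rmult_le_pos; [lra|left; apply Rinv_0_lt_compat, e2].
Qed.

Lemma is_derive_grid_sum h h' eps N x : (forall y, is_derive h y (h' y)) -> is_derive (grid_sum h eps N) x (eps * grid_sum h' eps N x).
Proof.
intros H. unfold grid_sum. generalize (2 * N)%nat as n. induction n as [|n IH]; simpl.
- rewrite Rmult_0_r. apply (is_derive_const (K := R_AbsRing) (V := R_NormedModule)).
- rewrite Rmult_plus_distr_l. apply (is_derive_plus (K := R_AbsRing) (V := R_NormedModule)); [exact IH|].
  apply (is_derive_comp (K := R_AbsRing) (V := R_NormedModule) h (fun x => (INR n - INR N + x) * eps) x); [apply H|].
  auto_derive; [trivial|ring].
Qed.

(** Shifting the grid by one step replaces a single point; this is the truncated form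
of periodicity in the shift. *)
Lemma grid_sum_tele h eps N : grid_sum h eps N 1 - grid_sum h eps N 0 = h (INR N * eps) - h (- INR N * eps).
Proof.
unfold grid_sum. rewrite <- (Rplus_0_l (h (INR N * eps) - _)).
assert (E : forall f g n, rsum f n - rsum g n = rsum (fun i => f i - g i) n).
{ intros f g n; induction n as [|n IH]; simpl; [ring|rewrite <- IH; ring]. }
rewrite E.
rewrite (rsum_ext _ (fun i => h ((INR (S i) - INR N + 0) * eps) - h ((INR i - INR N + 0) * eps))).
- rewrite (rsum_tele (fun i => h ((INR i - INR N + 0) * eps))). rewrite Rplus_0_l. f_equal; [|f_equal]; f_equal.
  + rewrite mult_INR. simpl. ring.
  + simpl. ring.
- intros i. rewrite S_INR. do 2 f_equal. ring.
Qed.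

Section EulerMaclaurin.
Variable d : nat -> R -> R.
Hypothesis Hd : forall n y, is_derive (d n) y (d (S n) y).
Hypothesis Hb : forall n, exists M, 0 <= M /\ forall y, Rabs (d n y) <= M * wt y.

(** Every derivative gains a factor [eps].  The sum of [d (S k)] is the derivative of
the sum of [d k] up to the factor [eps]; the latter takes almost the same value at
0 and 1, so the former is almost 0 somewhere and is therefore bounded by its own
derivative, [eps] times the sum of [d (S (S k))].  The term [del] accounts for
the truncation of the grid. *)
Lemma Euler_Maclaurin j : forall k, exists M, 0 <= M /\ forall eps, 0 < eps <= 1 -> forall del, 0 < del ->
  exists N0, forall N, (N0 <= N)%nat -> forall x, 0 <= x <= 1 ->
    Rabs (grid_sum (d (S k)) eps N x) <= M * eps ^ j * / eps ^ 2 + del.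
Proof.
induction j as [|j IH]; intros k.
- destruct (Hb (S k)) as [M [M0 HM]]. exists (3 * PI * M).
  split; [assert (P := PI_RGT_0); apply Rmult_le_pos; lra|].
  intros eps He del Hdel. exists 0%nat. intros N _ x _.
  assert (B := grid_sum_bound (d (S k)) M eps N x M0 HM He). simpl pow at 1. rewrite Rmult_1_r. lra.
- destruct (IH (S k)) as [M [M0 HM]]. exists M. split; [exact M0|].
  intros eps He del Hdel.
  destruct (HM eps He (del / 2)) as [N1 H1]; [lra|].
  destruct (Hb k) as [B [B0 HB]].
  destruct (INR_unbounded ((2 * B / eps) / (del / 2) / eps)) as [N2 H2].
  exists (N1 + N2)%nat. intros N HN x Hx.
  specialize (H1 N ltac:(lia)).
  assert (HN2 : INR N2 <= INR N) by (apply le_INR; lia).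
  (* a point where the sum is small *)
  destruct (MVT_gen (grid_sum (d k) eps N) 0 1 (fun x => eps * grid_sum (d (S k)) eps N x)) as [x0 [Hx0 Ex0]].
  { intros; apply is_derive_grid_sum, Hd. }
  { intros z _. apply derivable_continuous_pt. eexists. apply is_derive_Reals, is_derive_grid_sum, Hd. }
  rewrite Rmin_left, Rmax_right in Hx0 by lra.
  rewrite grid_sum_tele, Rminus_0_r, Rmult_1_r in Ex0.
  assert (T : Rabs (grid_sum (d (S k)) eps N x0) <= del / 2).
  { assert (Pd : 0 <= 2 * B / eps / (del / 2) / eps).
    { unfold Rdiv. repeat apply Rmult_le_pos; try lra; left; apply Rinv_0_lt_compat; lra. }
    assert (Np : 0 < INR N) by lra.
    apply (Rmult_le_reg_l eps); [lra|].
    rewrite <- (Rabs_pos_eq eps) at 1 by lra. rewrite <- Rabs_mult, <- Ex0.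
    unfold Rminus. apply Rle_trans with (1 := Rabs_triang _ _). rewrite Rabs_Ropp.
    assert (W1 := HB (INR N * eps)). assert (W2 := HB (- INR N * eps)).
    replace (wt (- INR N * eps)) with (wt (INR N * eps)) in W2 by (unfold wt; f_equal; ring).
    apply Rle_trans with (2 * B * wt (INR N * eps)); [lra|].
    assert (Ne : 0 < INR N * eps) by (apply Rmult_lt_0_compat; lra).
    assert (W3 : wt (INR N * eps) <= / (INR N * eps)). { unfold wt. apply Rinv_le_contravar; [exact Ne|nra]. }
    apply Rle_trans with (2 * B * / (INR N * eps)); [apply Rmult_le_compat_l; lra|].
    apply (Rmult_le_reg_r (INR N * eps)); [exact Ne|]. rewrite Rmult_assoc, Rinv_l, Rmult_1_r by lra.
    apply Rle_trans with (eps * (del / 2) * (2 * B / eps / (del / 2) / eps * eps)); [right; field; lra|].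
    apply Rmult_le_compat_l; [apply Rmult_le_pos; lra|]. apply Rmult_le_compat_r; lra. }
  destruct (MVT_gen (grid_sum (d (S k)) eps N) x0 x (fun x => eps * grid_sum (d (S (S k))) eps N x)) as [x1 [Hx1 Ex1]].
  { intros; apply is_derive_grid_sum, Hd. }
  { intros z _. apply derivable_continuous_pt. eexists. apply is_derive_Reals, is_derive_grid_sum, Hd. }
  assert (Hx1' : 0 <= x1 <= 1).
  { destruct Hx1 as [Ha Hc]. split.
    - apply Rle_trans with (2 := Ha). apply Rmin_glb; lra.
    - apply Rle_trans with (1 := Hc). apply Rmax_lub; lra. }
  specialize (H1 x1 Hx1').
  replace (grid_sum (d (S k)) eps N x) with ((grid_sum (d (S k)) eps N x - grid_sum (d (S k)) eps N x0) + grid_sum (d (S k)) eps N x0) by ring.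
  apply Rle_trans with (1 := Rabs_triang _ _). rewrite Ex1, !Rabs_mult.
  assert (Ax : Rabs (x - x0) <= 1) by (apply Rabs_le; lra).
  rewrite (Rabs_pos_eq eps) by lra.
  assert (P0 := Rabs_pos (grid_sum (d (S (S k))) eps N x1)). assert (P1 := Rabs_pos (x - x0)).
  assert (K : eps * Rabs (grid_sum (d (S (S k))) eps N x1) * Rabs (x - x0) <= eps * (M * eps ^ j * / eps ^ 2 + del / 2)).
  { apply Rle_trans with (eps * Rabs (grid_sum (d (S (S k))) eps N x1) * 1).
    - apply Rmult_le_compat_l; [apply Rmult_le_pos; lra|exact Ax].
    - rewrite Rmult_1_r. apply Rmult_le_compat_l; lra. }
  apply Rle_trans with (eps * (M * eps ^ j * / eps ^ 2 + del / 2) + del / 2); [lra|].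
  change (eps ^ S j) with (eps * eps ^ j). replace (M * (eps * eps ^ j) * / eps ^ 2) with (eps * (M * eps ^ j * / eps ^ 2)) by ring.
  assert (eps * (del / 2) <= 1 * (del / 2)) by (apply Rmult_le_compat_r; lra). lra.
Qed.
End EulerMaclaurin.

Lemma grid_sum_even h eps N : (forall y, h (- y) = h y) -> h 0 = 0 ->
  grid_sum h eps N 0 = 2 * rsum (fun i => h (INR (S i) * eps)) N - h (INR N * eps).
Proof.
intros He H0. unfold grid_sum. induction N as [|N IH].
- simpl. rewrite Rmult_0_l, H0. ring.
- replace (2 * S N)%nat with (S (S (2 * N))) by lia. rewrite rsum_head.
  change (rsum ?f (S ?n)) with (rsum f n + f n). cbv beta.
  rewrite (rsum_ext _ (fun i => h ((INR i - INR N + 0) * eps))).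
  + rewrite IH. replace ((INR 0 - INR (S N) + 0) * eps) with (- (INR (S N) * eps)) by (change (INR 0) with 0; ring).
    rewrite He. replace ((INR (S (2 * N)) - INR (S N) + 0) * eps) with (INR N * eps).
    * change (rsum (fun i => h (INR (S i) * eps)) (S N)) with (rsum (fun i => h (INR (S i) * eps)) N + h (INR (S N) * eps)). ring.
    * rewrite !S_INR, mult_INR. simpl. ring.
  + intros i. f_equal. rewrite !S_INR. ring.
Qed.

(** A primitive of [qker]; its existence within the Schwartz functions says that
[qker] has integral 0. *)
Definition prim_q : pexp := PM (PC (- 2 * PI)) (PM PX (PM PX PX)).

(** The profile of [Phi]: each term of its series is [exp (u / 2) * qker (n exp u)]. *)
Definition qker (y : R) : R := pgauss (pgauss_der prim_q) y.

Lemma qker_eq y : qker y = (4 * PI ^ 2 * y ^ 4 - 6 * PI * y ^ 2) * exp (- (PI * y ^ 2)).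
Proof. unfold qker, pgauss; simpl. ring. Qed.

Fixpoint prim_q_der (n : nat) : pexp := match n with O => prim_q | S m => pgauss_der (prim_q_der m) end.

(** The grid sum of the even function [qker], which vanishes at 0, is twice the sum
over the positive points. *)
Lemma qker_sum_bound j : exists M, 0 <= M /\ forall eps l, 0 < eps <= 1 ->
  is_series (K := R_AbsRing) (V := R_NormedModule) (fun k => qker (INR (S k) * eps)) l -> Rabs l <= M * eps ^ j.
Proof.
destruct (Euler_Maclaurin (fun n => pgauss (prim_q_der n))) with (j := (j + 2)%nat) (k := 0%nat) as [M [M0 HM]].
- intros n y. apply is_derive_pgauss.
- intros n. destruct (rapid_tame _ (rapid_pgauss (prim_q_der n))) as [c Hc]. exists c. split; [apply (tame_nonneg _ _ Hc)|].
  intros y. rewrite <- Cmod_R. apply (proj2 Hc).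
- exists M. split; [exact M0|]. intros eps l He Hl.
  apply le_epsilon. intros del Hdel.
  destruct (HM eps He (del / 2)) as [N1 H1]; [lra|].
  destruct (Hl (ball l (mkposreal (del / 4) ltac:(lra))) (locally_ball _ _)) as [N2 H2].
  destruct (rapid_tame _ (rapid_pgauss (pgauss_der prim_q))) as [c Hc]. assert (c0 := tame_nonneg _ _ Hc).
  destruct (INR_unbounded (c / (del / 4) / eps)) as [N3 H3].
  set (n := (N1 + N2 + N3)%nat).
  specialize (H1 (S n) ltac:(unfold n; lia) 0 ltac:(lra)).
  specialize (H2 n ltac:(unfold n; lia)).
  unfold ball in H2; simpl in H2; unfold AbsRing_ball, abs, minus, plus, opp in H2; simpl in H2.
  change (pgauss (prim_q_der 1)) with qker in H1.
  rewrite grid_sum_even in H1.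
  2: { intros y. rewrite !qker_eq. f_equal; [ring|]. f_equal. ring. }
  2: { rewrite qker_eq. ring. }
  rewrite rsum_sum_n in H1.
  set (s := sum_n (fun k => qker (INR (S k) * eps)) n) in *.
  change (Rabs (s + - l) < del / 4) in H2.
  assert (Q : Rabs (qker (INR (S n) * eps)) <= del / 4).
  { rewrite <- Cmod_R. apply Rle_trans with (1 := proj2 Hc _).
    assert (H4 : INR N3 <= INR (S n)) by (apply le_INR; unfold n; lia).
    assert (Pd : 0 <= c / (del / 4) / eps). { unfold Rdiv. repeat apply Rmult_le_pos; try lra; left; apply Rinv_0_lt_compat; lra. }
    assert (Ne : 0 < INR (S n) * eps) by (apply Rmult_lt_0_compat; lra).
    assert (W3 : wt (INR (S n) * eps) <= / (INR (S n) * eps)). { unfold wt. apply Rinv_le_contravar; [exact Ne|nra]. }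
    apply Rle_trans with (c * / (INR (S n) * eps)); [apply Rmult_le_compat_l; lra|].
    apply (Rmult_le_reg_r (INR (S n) * eps)); [exact Ne|]. rewrite Rmult_assoc, Rinv_l, Rmult_1_r by lra.
    apply Rle_trans with ((del / 4) * (c / (del / 4) / eps * eps)); [right; field; lra|].
    apply Rmult_le_compat_l; [lra|]. apply Rmult_le_compat_r; lra. }
  assert (E : M * eps ^ (j + 2) * / eps ^ 2 = M * eps ^ j).
  { rewrite pow_add. field. lra. }
  rewrite E in H1.
  assert (B : 0 <= M * eps ^ j) by (apply Rmult_le_pos; [lra|apply pow_le; lra]).
  apply Rabs_le_between in H1. apply Rabs_le_between in Q. apply Rabs_def2 in H2.
  apply Rabs_le. lra.
Qed.

(** * The kernel Phi and the zeta function *)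

Definition lnS (k : nat) : R := ln (INR (S k)).

Lemma INR_S_pos k : 0 < INR (S k).
Proof. apply lt_0_INR; lia. Qed.

Lemma exp_lnS k : exp (lnS k) = INR (S k).
Proof. apply exp_ln, INR_S_pos. Qed.

Lemma lnS_nonneg k : 0 <= lnS k.
Proof.
unfold lnS. rewrite <- ln_1. destruct k as [|k]; [simpl; lra|].
left. apply ln_increasing; [lra|]. apply (lt_INR 1); lia.
Qed.

(** The integral test, with [x^(1 - p) / (p - 1)] as primitive. *)
Lemma ex_series_power p : 1 < p -> ex_series (fun k => exp (- p * lnS k)).
Proof.
intros Hp.
set (G := fun x => exp (- (p - 1) * ln x) / (p - 1)).
assert (DG : forall x, 0 < x -> is_derive G x (- exp (- p * ln x))).
{ intros x Hx. unfold G. auto_derive; [exact Hx|].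
  replace (exp (- p * ln x)) with (exp (- (p - 1) * ln x) * / x).
  - field. split; lra.
  - rewrite <- (exp_ln x Hx) at 2. rewrite <- exp_Ropp, <- exp_plus. f_equal. ring. }
assert (Step : forall k, exp (- p * lnS (S k)) <= G (INR (S k)) - G (INR (S (S k)))).
{ intros k. assert (P := INR_S_pos k). assert (ES := S_INR (S k)).
  destruct (MVT_gen G (INR (S k)) (INR (S (S k))) (fun x => - exp (- p * ln x))) as [c [Hc Ec]].
  - intros x Hx. rewrite ES, Rmin_left in Hx by lra. apply DG. lra.
  - intros x Hx. rewrite ES, Rmin_left in Hx by lra. apply derivable_continuous_pt. eexists. apply is_derive_Reals, DG. lra.
  - rewrite Rmin_left, Rmax_right in Hc by lra.
    replace (INR (S (S k)) - INR (S k)) with 1 in Ec by lra.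
    assert (L : exp (- p * lnS (S k)) <= exp (- p * ln c)).
    { apply exp_le_mono. unfold lnS. assert (ln c <= ln (INR (S (S k)))); [|nra].
      destruct (proj2 Hc) as [H|H]; [left; apply ln_increasing; lra|rewrite H; lra]. }
    lra. }
assert (Bd : forall n, sum_n (fun k => exp (- p * lnS k)) n <= 1 + G 1 - G (INR (S n))).
{ induction n as [|n IH].
  - rewrite sum_O. unfold lnS; simpl. rewrite ln_1, Rmult_0_r, exp_0. lra.
  - rewrite sum_Sn. unfold plus; simpl plus. specialize (Step n).
    change (sum_n (fun k => exp (- p * lnS k)) n + exp (- p * lnS (S n)) <= 1 + G 1 - G (INR (S (S n)))). lra. }
assert (L : ex_finite_lim_seq (sum_n (fun k => exp (- p * lnS k)))).
{ apply (ex_finite_lim_seq_incr _ (1 + G 1)).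
  - intros n. rewrite sum_Sn. unfold plus; simpl plus. assert (P := exp_pos (- p * lnS (S n))).
    change (sum_n (fun k => exp (- p * lnS k)) n <= sum_n (fun k => exp (- p * lnS k)) n + exp (- p * lnS (S n))). lra.
  - intros n. apply Rle_trans with (1 := Bd n).
    assert (0 < G (INR (S n))); [|lra]. unfold G. apply Rdiv_lt_0_compat; [apply exp_pos|lra]. }
destruct L as [l Hl]. exists l. exact Hl.
Qed.

Definition Phi_term0 (u : R) : R := exp (u / 2) * qker (exp u).
Definition Phi_term (k : nat) (u : R) : R := exp (u / 2) * qker (INR (S k) * exp u).

(** In the variable [u] the dilation by [n] is a translation by [ln n]. *)
Lemma Phi_term_shift k u : Phi_term k u = exp (- lnS k / 2) * Phi_term0 (u + lnS k).
Proof.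
unfold Phi_term, Phi_term0. rewrite (exp_plus u), exp_lnS, <- Rmult_assoc, <- exp_plus.
f_equal; [f_equal; field|f_equal; ring].
Qed.

Lemma Phi_eq u : Phi u = Series (fun k => Phi_term k u).
Proof.
unfold Phi. rewrite <- Series_scal_l. apply Series_ext. intros k. cbv zeta.
unfold Phi_term. rewrite qker_eq.
set (n := INR (S k)). replace (exp (9 * u / 2)) with (exp (u / 2) * exp u ^ 4).
- replace (exp (5 * u / 2)) with (exp (u / 2) * exp u ^ 2).
  + replace (exp (2 * u)) with (exp u ^ 2).
    * replace (PI * (n * exp u) ^ 2) with (PI * n ^ 2 * exp u ^ 2) by ring. ring.
    * simpl. rewrite Rmult_1_r, <- exp_plus. f_equal; ring.
  + simpl. rewrite Rmult_1_r, <- !exp_plus. f_equal; field.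
- simpl. rewrite Rmult_1_r, <- !exp_plus. f_equal; field.
Qed.

Lemma cont_Phi_term0 x : continuous Phi_term0 x.
Proof.
apply cont_of_derive. unfold Phi_term0.
eexists. apply is_derive_Rmult.
- instantiate (1 := exp (x / 2) / 2). auto_derive; [trivial|simpl; match goal with |- ?a = ?b => change (@eq R a b) end; unfold Rdiv; ring].
- apply (is_derive_comp (K := R_AbsRing) (V := R_NormedModule) qker exp x); [apply is_derive_pgauss|apply is_derive_exp].
Qed.

Lemma cont_Phi_term k x : continuous (Phi_term k) x.
Proof.
apply (continuous_ext (fun u => exp (- lnS k / 2) * Phi_term0 (u + lnS k))).
- intros; symmetry; apply Phi_term_shift.
- apply (continuous_mult (K := R_AbsRing)); [apply continuous_const|].
  apply (continuous_comp (fun u => u + lnS k) Phi_term0); [|apply cont_Phi_term0].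
  apply (continuous_plus (V := R_NormedModule)); [apply continuous_id|apply continuous_const].
Qed.

Lemma two_sided_wt dl u : 0 < dl <= 1 -> exp (- dl * Rabs u) <= 4 / dl ^ 2 * wt u.
Proof.
intros Hd. replace (- dl * Rabs u) with (- (dl * Rabs u)) by ring. rewrite exp_Ropp. unfold wt.
assert (d2 : 0 < dl ^ 2) by (apply pow_lt; lra).
assert (d1 : dl ^ 2 <= 1) by nra.
replace (4 / dl ^ 2 * / (1 + u ^ 2)) with (/ (dl ^ 2 * (1 + u ^ 2) / 4)) by (field; split; nra).
apply Rinv_le_contravar; [nra|].
replace (exp (dl * Rabs u)) with (exp (dl * Rabs u / 2) * exp (dl * Rabs u / 2)) by (rewrite <- exp_plus; f_equal; lra).
assert (Pa := Rabs_pos u). assert (Q := exp_ineq1_le (dl * Rabs u / 2)).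
assert (A0 : 0 <= dl * Rabs u / 2) by nra.
rewrite <- (pow2_abs u). nra.
Qed.

(** The decay in [L] makes the translates summable; the weight makes them integrable.
The bound is that of [pgauss_bound] with exponent [p] for [u <= 0] and exponent
[sg + 1] for [u >= 0]. *)
Lemma pgauss_two_sided P sg p : 0 <= p < sg -> exists c, 0 <= c /\ forall L u, 0 <= L ->
  exp (sg * u) * Rabs (pgauss P (exp (u + L))) <= exp (- p * L) * c * wt u.
Proof.
intros Hp. set (dl := Rmin (sg - p) 1).
assert (D1 : dl <= sg - p) by apply Rmin_l. assert (D2 : dl <= 1) by apply Rmin_r.
assert (D0 : 0 < dl) by (apply Rmin_glb_lt; lra).
destruct (INR_unbounded (sg + 1)) as [K HK].
destruct (pgauss_bound P K) as [M [M0 HM]].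
exists (M * (4 / dl ^ 2)). split.
{ apply Rmult_le_pos; [exact M0|]. left; apply Rdiv_lt_0_compat; [lra|apply pow_lt; lra]. }
intros L u L0.
apply Rle_trans with (M * exp (- p * L) * exp (- dl * Rabs u)).
- destruct (Rle_dec u 0) as [Hu|Hu]; [rewrite (Rabs_left1 u) by lra|rewrite (Rabs_pos_eq u) by lra].
  + apply Rle_trans with (exp (sg * u) * (M * exp (- p * (u + L)))).
    * apply Rmult_le_compat_l; [left; apply exp_pos|]. apply HM. lra.
    * rewrite Rmult_comm, !Rmult_assoc, <- !exp_plus. apply Rmult_le_compat_l; [exact M0|]. apply exp_le_mono. nra.
  + apply Rle_trans with (exp (sg * u) * (M * exp (- (sg + 1) * (u + L)))).
    * apply Rmult_le_compat_l; [left; apply exp_pos|]. apply HM. lra.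
    * rewrite Rmult_comm, !Rmult_assoc, <- !exp_plus. apply Rmult_le_compat_l; [exact M0|]. apply exp_le_mono. nra.
- replace (exp (- p * L) * (M * (4 / dl ^ 2)) * wt u) with (M * exp (- p * L) * (4 / dl ^ 2 * wt u)) by ring.
  apply Rmult_le_compat_l; [apply Rmult_le_pos; [exact M0|left; apply exp_pos]|]. apply two_sided_wt. lra.
Qed.

Section Halfplane.
Variable s : C.
Hypothesis Hs : 1 < Re s.

(** Any number strictly between 1 and [Re s] would do: the series of [n^(- p)]
converges, and decay is left over for the integral. *)
Let p := (1 + Re s) / 2.

Definition zeta_term (k : nat) (u : R) : C := (RtoC (Phi_term k u) * Cexp ((s - / 2) * RtoC u))%C.

Lemma Re_half : Re (s - / 2)%C = Re s - / 2.
Proof.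
unfold Cminus. rewrite re_plus, re_opp. rewrite <- RtoC_inv by lra. simpl. ring.
Qed.

Lemma zeta_term_bound : exists c, 0 <= c /\ forall k, tame (zeta_term k) (exp (- p * lnS k) * c).
Proof.
destruct (pgauss_two_sided (pgauss_der prim_q) (Re s) p) as [c [c0 Hc]]; [unfold p; lra|].
exists c. split; [exact c0|]. intros k. split.
- apply ccont_mult; [apply ccont_RtoC, cont_Phi_term|]. apply ccont_Cexp, ccont_mult; [apply ccont_const|apply ccont_id].
- intros u. unfold zeta_term. rewrite Cmod_mult, Cmod_R, Cmod_Cexp, re_scal_r, Re_half.
  unfold Phi_term. rewrite Rabs_mult, (Rabs_pos_eq (exp (u / 2))) by (left; apply exp_pos).
  replace (INR (S k) * exp u) with (exp (u + lnS k)) by (rewrite exp_plus, exp_lnS; ring).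
  apply Rle_trans with (2 := Hc _ u (lnS_nonneg k)). right.
  rewrite (Rmult_comm (exp (u / 2))), Rmult_assoc, <- exp_plus, Rmult_comm. do 2 f_equal. field.
Qed.

Lemma zeta_term_series :
  (forall u, csum (fun k => zeta_term k u) (RtoC (Phi u) * Cexp ((s - / 2) * RtoC u))%C) /\
  (exists c, tame (fun u => RtoC (Phi u) * Cexp ((s - / 2) * RtoC u))%C c) /\
  (forall u, is_series (K := R_AbsRing) (V := R_NormedModule) (fun k => Phi_term k u) (Phi u)) /\
  csum (fun k => CRInt_line (zeta_term k)) (CRInt_line (fun u => RtoC (Phi u) * Cexp ((s - / 2) * RtoC u))%C).
Proof.
destruct zeta_term_bound as [c [c0 Hc]].
assert (Hb : ex_series (fun k => exp (- p * lnS k) * c)).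
{ apply ex_series_scal_Rr, ex_series_power. unfold p; lra. }
destruct (line_series zeta_term _ Hc Hb) as [F [H1 [H2 H3]]].
assert (S1 : forall u, is_series (K := R_AbsRing) (V := R_NormedModule) (fun k => Phi_term k u) (Phi u)).
{ intros u. rewrite Phi_eq. apply Series_correct.
  assert (H := csum_scal (/ Cexp ((s - / 2) * RtoC u)) _ _ (H1 u)). apply csum_fst in H.
  eexists. refine (is_series_ext (K := R_AbsRing) (V := R_NormedModule) _ (fun k => Phi_term k u) _ _ H).
  intros k. unfold zeta_term.
  replace (/ Cexp ((s - / 2) * u) * (Phi_term k u * Cexp ((s - / 2) * u)))%C with (RtoC (Phi_term k u)); [reflexivity|].
  field. apply Cexp_nz. }
assert (E : forall u, F u = (RtoC (Phi u) * Cexp ((s - / 2) * RtoC u))%C).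
{ intros u. set (e := Cexp ((s - / 2) * RtoC u)).
  assert (H := csum_scal (/ e)%C _ _ (H1 u)).
  assert (He : e <> 0) by apply Cexp_nz.
  assert (H' : csum (fun k => RtoC (Phi_term k u)) (/ e * F u)%C).
  { revert H. apply csum_ext. intros k. unfold zeta_term. fold e. field. exact He. }
  assert (Q := csum_fst _ _ H'). simpl in Q.
  assert (R1 : fst (/ e * F u)%C = Phi u).
  { apply is_series_unique in Q. specialize (S1 u). apply is_series_unique in S1.
    rewrite <- S1. symmetry. exact Q. }
  assert (R2 : snd (/ e * F u)%C = 0).
  { assert (H'' := csum_scal (-Ci)%C _ _ H'). apply csum_fst in H''.
    apply is_series_unique in H''. transitivity (fst (- Ci * (/ e * F u))%C); [simpl; ring|].
    rewrite <- H''. rewrite (Series_ext _ (fun _ => 0 * 0)).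
    - rewrite Series_scal_l. ring.
    - intros k. simpl. ring. }
  replace (F u) with (e * (/ e * F u))%C by (field; exact He).
  rewrite (surjective_pairing (/ e * F u)%C), R1, R2. fold (RtoC (Phi u)). ring. }
split; [|split; [|split]].
- intros u. rewrite <- E. apply H1.
- exists (Series (fun k => exp (- p * lnS k) * c)). apply (tame_ext _ _ _ E), H2.
- exact S1.
- rewrite <- (line_ext _ _ E). exact H3.
Qed.

(** The translation by [ln n] produces the factor [n^(- s)]. *)
Lemma zeta_term_shift k u : (Rcpow (INR (S k)) (- s) * zeta_term 0 (u + lnS k))%C = zeta_term k u.
Proof.
unfold zeta_term, Rcpow. fold (lnS k).
rewrite (Phi_term_shift k), (Phi_term_shift 0).
replace (lnS 0) with 0 by (unfold lnS; simpl; rewrite ln_1; reflexivity).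
rewrite Rplus_0_r. replace (- 0 / 2) with 0 by field. rewrite exp_0, Rmult_1_l.
rewrite RtoC_plus, (RtoC_mult (exp (- lnS k / 2))), <- Cexp_RtoC.
set (ph := RtoC (Phi_term0 (u + lnS k))).
replace (Cexp (- s * lnS k) * (ph * Cexp ((s - / 2) * (u + lnS k))))%C with
  (ph * (Cexp (- s * lnS k) * Cexp ((s - / 2) * (u + lnS k))))%C by ring.
replace (Cexp (- lnS k / 2)%R * ph * Cexp ((s - / 2) * u))%C with (ph * (Cexp (- lnS k / 2)%R * Cexp ((s - / 2) * u)))%C by ring.
rewrite <- !Cexp_plus. do 2 f_equal.
unfold Rdiv. rewrite RtoC_mult, RtoC_opp, RtoC_inv by lra. field.
Qed.

Lemma line_zeta_term k : CRInt_line (zeta_term k) = (CRInt_line (zeta_term 0) * Rcpow (INR (S k)) (- s))%C.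
Proof.
destruct zeta_term_bound as [c [c0 Hc]].
assert (NZ : Rcpow (INR (S k)) (- s) <> 0) by apply Cexp_nz.
rewrite Cmult_comm.
assert (E : CRInt_line (fun x => (1 * zeta_term 0 (1 * x + lnS k)%R)%C) = CRInt_line (zeta_term 0)).
{ eapply (line_comp_lin (zeta_term 0) _ 1 (lnS k)); [exact (Hc 0%nat)|lra|].
  apply (tame_ext (fun x => / Rcpow (INR (S k)) (- s) * zeta_term k x)%C).
  - intros x. rewrite <- zeta_term_shift. rewrite Rmult_1_l. field. exact NZ.
  - apply tame_scal, Hc. }
rewrite <- E.
transitivity (CRInt_line (fun x => Rcpow (INR (S k)) (- s) * (/ Rcpow (INR (S k)) (- s) * zeta_term k x))%C).
- apply line_ext. intros x. field. exact NZ.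
- rewrite (line_scal _ _ _ (tame_scal _ _ _ (Hc k))). f_equal. apply line_ext. intros x.
  rewrite <- zeta_term_shift, Rmult_1_l. field. exact NZ.
Qed.

Lemma laplace_Phi_zeta :
  CRInt_line (fun u => RtoC (Phi u) * Cexp ((s - / 2) * RtoC u))%C = (CRInt_line (zeta_term 0) * Czeta s)%C.
Proof.
destruct zeta_term_series as [_ [_ [_ H]]].
destruct (csum_dominated (fun k => Rcpow (INR (S k)) (- s)) (fun k => exp (- Re s * lnS k))) as [Z [HZ _]].
- intros k. unfold Rcpow. rewrite Cmod_Cexp, re_scal_r, re_opp. apply Rle_refl.
- apply ex_series_power, Hs.
- unfold Czeta. rewrite (CSeries_eq _ _ HZ).
  apply (csum_unique _ _ _ H). apply (csum_ext (fun k => CRInt_line (zeta_term 0) * Rcpow (INR (S k)) (- s))%C).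
  + intros k. symmetry. apply line_zeta_term.
  + apply csum_scal, HZ.
Qed.
End Halfplane.

Lemma Phi_series u : is_series (K := R_AbsRing) (V := R_NormedModule) (fun k => Phi_term k u) (Phi u).
Proof. apply (zeta_term_series 2). simpl; lra. Qed.

Lemma cont_Phi : ccont (fun u => RtoC (Phi u)).
Proof.
destruct (zeta_term_series 2) as [_ [[c [Hc _]] _]]; [simpl; lra|].
apply (ccont_ext (fun u => RtoC (Phi u) * Cexp ((2 - / 2) * RtoC u) * Cexp (- (2 - / 2) * RtoC u))%C).
- intros u. rewrite <- Cmult_assoc, <- Cexp_plus.
  replace ((2 - / 2) * u + - (2 - / 2) * u)%C with (RtoC 0) by ring. rewrite Cexp_0. ring.
- apply ccont_mult; [exact Hc|]. apply ccont_Cexp, ccont_mult; [apply ccont_const|apply ccont_id].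
Qed.

(** Termwise for [u >= 0], by [qker_sum_bound] with [eps = exp u] for [u <= 0]. *)
Lemma rapid_Phi : rapid (fun u => RtoC (Phi u)).
Proof.
split; [apply cont_Phi|]. intros A.
destruct (INR_unbounded (Rmax A 0 + 2)) as [K HK].
assert (HA : A <= Rmax A 0) by apply Rmax_l. assert (H0 : 0 <= Rmax A 0) by apply Rmax_r.
destruct (pgauss_bound (pgauss_der prim_q) K) as [M [M0 HM]].
destruct (qker_sum_bound K) as [M' [M0' HM']].
assert (E2 : ex_series (fun k => exp (Ropp 2 * lnS k))) by (apply ex_series_power; lra).
set (Sg := Series (fun k => exp (Ropp 2 * lnS k))).
assert (Sg0 : 0 <= Sg).
{ apply Rle_trans with (2 := sum_n_le_Series _ 0 (fun k => Rlt_le _ _ (exp_pos _)) E2). rewrite sum_O. left; apply exp_pos. }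
exists (M * Sg + M'). intros u. rewrite Cmod_R.
assert (Pe : 0 < exp (- A * Rabs u)) by apply exp_pos.
destruct (Rle_dec u 0) as [L|L].
- rewrite (Rabs_left1 u) by lra. rewrite (Rabs_left1 u) in Pe by lra.
  assert (Sq : is_series (K := R_AbsRing) (V := R_NormedModule) (fun k => qker (INR (S k) * exp u)) (exp (- (u / 2)) * Phi u)).
  { apply (is_series_ext (fun k => exp (- (u / 2)) * Phi_term k u)).
    - intros k. unfold Phi_term. rewrite <- Rmult_assoc, <- exp_plus. replace (- (u / 2) + u / 2) with 0 by ring. rewrite exp_0. Rring.
    - exact (is_series_scal_l (K := R_AbsRing) (V := R_NormedModule) (exp (- (u / 2))) _ _ (Phi_series u)). }
  assert (B : Rabs (exp (- (u / 2)) * Phi u) <= M' * exp u ^ K).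
  { apply HM'; [|exact Sq]. split; [apply exp_pos|]. rewrite <- exp_0. apply exp_le_mono, L. }
  rewrite Rabs_mult, (Rabs_pos_eq (exp _)) in B by (left; apply exp_pos).
  rewrite exp_pow in B.
  assert (B2 : Rabs (Phi u) <= M' * exp (- A * - u)).
  { assert (Pz := exp_pos (- (u / 2))). apply (Rmult_le_reg_l (exp (- (u / 2)))); [exact Pz|].
    apply Rle_trans with (1 := B). replace (exp (- (u / 2)) * (M' * exp (- A * - u))) with (M' * (exp (- (u / 2)) * exp (- A * - u))) by ring.
    rewrite <- exp_plus. apply Rmult_le_compat_l; [exact M0'|]. apply exp_le_mono. nra. }
  apply Rle_trans with (1 := B2). apply Rmult_le_compat_r; [lra|]. nra.
- rewrite (Rabs_pos_eq u) in * by lra.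
  assert (Bn : forall k, Rabs (Phi_term k u) <= exp (Ropp 2 * lnS k) * (M * exp (- A * u))).
  { intros k. unfold Phi_term. rewrite Rabs_mult, (Rabs_pos_eq (exp (u / 2))) by (left; apply exp_pos).
    replace (INR (S k) * exp u) with (exp (u + lnS k)) by (rewrite exp_plus, exp_lnS; ring).
    assert (L0 := lnS_nonneg k).
    apply Rle_trans with (exp (u / 2) * (M * exp (- (Rmax A 0 + 2) * (u + lnS k)))).
    - apply Rmult_le_compat_l; [left; apply exp_pos|]. apply HM. lra.
    - replace (exp (u / 2) * (M * exp (- (Rmax A 0 + 2) * (u + lnS k)))) with (M * (exp (u / 2) * exp (- (Rmax A 0 + 2) * (u + lnS k)))) by ring.
      replace (exp (Ropp 2 * lnS k) * (M * exp (- A * u))) with (M * (exp (Ropp 2 * lnS k) * exp (- A * u))) by ring.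
      rewrite <- !exp_plus. apply Rmult_le_compat_l; [exact M0|]. apply exp_le_mono. nra. }
  assert (E3 : ex_series (fun k => exp (Ropp 2 * lnS k) * (M * exp (- A * u)))) by (apply ex_series_scal_Rr, E2).
  rewrite Phi_eq.
  apply Rle_trans with (Series (fun k => exp (Ropp 2 * lnS k) * (M * exp (- A * u)))).
  + apply Rle_trans with (Series (fun k => Rabs (Phi_term k u))).
    * apply Series_Rabs. apply (ex_series_le (K := R_AbsRing) (V := R_CompleteNormedModule) _ (fun k => exp (Ropp 2 * lnS k) * (M * exp (- A * u)))).
      -- intros k. change (Rabs (Rabs (Phi_term k u)) <= exp (Ropp 2 * lnS k) * (M * exp (- A * u))). rewrite Rabs_Rabsolu. apply Bn.
      -- exact E3.
    * apply Series_le; [|exact E3]. intros k. split; [apply Rabs_pos|apply Bn].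
  + rewrite Series_scal_r. fold Sg. assert (0 <= M * Sg) by (apply Rmult_le_pos; assumption). nra.
Qed.

(** * The integral formula for xi *)

Lemma ccont_continuous f x : ccont f -> continuous (U := C_R_NormedModule) f x.
Proof.
intros H. destruct (H x) as [H1 H2]. apply filterlim_locally. intros eps.
generalize (filter_and _ _ (proj1 (filterlim_locally (fun y => fst (f y)) (fst (f x))) H1 eps)
  (proj1 (filterlim_locally (fun y => snd (f y)) (snd (f x))) H2 eps)).
apply filter_imp. intros y [B1 B2]. split; [exact B1|exact B2].
Qed.

(** Up to a constant factor and a substitution, the integrand of Euler's integral,
with a polynomial factor to allow for differentiation. *)
Definition euler_int (s : C) (P : pexp) (u : R) : C := (RtoC (pgauss P (exp u)) * Cexp (s * RtoC u))%C.

Lemma is_derive_pgauss_exp P u : is_derive (fun u => pgauss P (exp u)) u (pgauss (PM PX (pgauss_der P)) (exp u)).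
Proof.
eapply is_derive_eq.
- apply (is_derive_comp (K := R_AbsRing) (V := R_NormedModule) (pgauss P) exp u); [apply is_derive_pgauss|apply is_derive_exp].
- unfold scal; simpl; unfold mult; simpl. unfold pgauss; simpl. ring.
Qed.

Lemma cderive_euler_int s P u : cderive (euler_int s P) u (euler_int s (PM PX (pgauss_der P)) u + s * euler_int s P u)%C.
Proof.
unfold euler_int. eapply cderive_eq.
- apply cderive_mult; [apply cderive_RtoC, is_derive_pgauss_exp|apply cderive_Cexp, cderive_mult; [apply cderive_const|apply cderive_id]].
- cbv beta. ring.
Qed.

Lemma euler_int_tame s P : 0 < Re s -> exists c, tame (euler_int s P) c.
Proof.
intros Hs. destruct (pgauss_two_sided P (Re s) 0) as [c [_ Hc]]; [lra|].
exists c. split; [apply (cderive_ccont _ _ (cderive_euler_int s P))|]. intros u. unfold euler_int.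
rewrite Cmod_mult, Cmod_R, Cmod_Cexp, re_scal_r, Rmult_comm.
specialize (Hc 0 u (Rle_refl 0)). rewrite Rplus_0_r, Rmult_0_r, exp_0, Rmult_1_l in Hc. exact Hc.
Qed.

(** Integration by parts for [theta = y d/dy], which is [d/du] in the variable [y = exp u]. *)
Lemma line_euler_int_theta s P : 0 < Re s ->
  CRInt_line (euler_int s (PM PX (pgauss_der P))) = (- (s * CRInt_line (euler_int s P)))%C.
Proof.
intros Hs.
assert (E := line_FTC2 (euler_int s P) (euler_int s (PM PX (pgauss_der P))) (euler_int s P) 1 s (euler_int_tame s _ Hs) (euler_int_tame s _ Hs) (euler_int_tame s _ Hs)).
rewrite Cmult_1_l in E. apply Ceq_minus. rewrite <- E.
- ring.
- intros x. rewrite Cmult_1_l. apply cderive_euler_int.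
Qed.

(** [qker] is [theta^2 + theta] applied to [exp (- PI y^2)].  Each [theta] becomes [- s]
under the integral, and [s^2 - s = s (s - 1)]. *)
Lemma line_zeta_term0 s : 1 < Re s ->
  CRInt_line (zeta_term s 0) = (s * (s - 1) * CRInt_line (euler_int s (PC 1)))%C.
Proof.
intros Hs. assert (H0 : 0 < Re s) by lra.
set (P1 := PM PX (pgauss_der (PC 1))). set (P2 := PM PX (pgauss_der P1)).
destruct (euler_int_tame s P1 H0) as [c1 T1]. destruct (euler_int_tame s P2 H0) as [c2 T2].
transitivity (CRInt_line (fun u => euler_int s P2 u + euler_int s P1 u)%C).
- apply line_ext. intros u. unfold zeta_term, euler_int, Phi_term.
  rewrite <- Cmult_plus_distr_r, <- RtoC_plus.
  replace (pgauss P2 (exp u) + pgauss P1 (exp u)) with (qker (exp u)).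
  2: { rewrite qker_eq. unfold pgauss; simpl. ring. }
  replace (INR 1 * exp u) with (exp u) by (simpl; ring).
  rewrite RtoC_mult, <- Cexp_RtoC.
  replace (Cexp (u / 2)%R * qker (exp u) * Cexp ((s - / 2) * u))%C with (qker (exp u) * (Cexp (u / 2)%R * Cexp ((s - / 2) * u)))%C by ring.
  rewrite <- Cexp_plus. do 2 f_equal. rewrite RtoC_div by lra. field.
- rewrite (line_plus _ _ _ _ T2 T1). unfold P2. rewrite (line_euler_int_theta s P1 H0). unfold P1.
  rewrite (line_euler_int_theta s (PC 1) H0). ring.
Qed.

(** The substitution [x = PI exp (2 v)]. *)
Lemma CGamma_eq s : 0 < Re s ->
  CGamma (s / 2) = (2 * Rcpow PI (s / 2) * CRInt_line (euler_int s (PC 1)))%C.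
Proof.
intros Hs. destruct (euler_int_tame s (PC 1) Hs) as [c0 T0].
set (H := fun v => ((2 * Rcpow PI (s / 2)) * euler_int s (PC 1) v)%C).
assert (TH := tame_scal (2 * Rcpow PI (s / 2)) _ _ T0). fold H in TH.
set (c := Cmod (2 * Rcpow PI (s / 2)) * c0) in *.
rewrite <- (line_scal _ _ _ T0). fold H.
unfold CGamma. apply (is_RInt_gen_unique (V := C_R_CompleteNormedModule)).
assert (PP := PI_RGT_0).
set (g := fun x => (ln x - ln PI) / 2).
assert (Dg : forall x, 0 < x -> is_derive g x (/ (2 * x))).
{ intros x Hx. unfold g. auto_derive; [exact Hx|]. field. lra. }
assert (IR : forall a b, 0 < a -> a <= b ->
  is_RInt (V := C_R_NormedModule) (fun x => (Rcpow x (s / 2 - 1) * RtoC (exp (- x)))%C) a b (cint H (g a) (g b))).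
{ intros a b Ha Hab.
  assert (K := is_RInt_comp (V := C_R_CompleteNormedModule) H g (fun x => / (2 * x)) a b).
  rewrite Rmin_left, Rmax_right in K by lra.
  rewrite (is_RInt_unique (V := C_R_CompleteNormedModule) H (g a) (g b) (cint H (g a) (g b))) in K
    by (apply cint_correct; exact (proj1 TH)).
  apply (is_RInt_ext (V := C_R_NormedModule) (fun y => scal (/ (2 * y)) (H (g y)))).
  - rewrite Rmin_left, Rmax_right by lra. intros x Hx.
    rewrite scal_R_Cmult. unfold H, euler_int, pgauss, Rcpow; simpl peval. rewrite Rmult_1_l.
    assert (E1 : PI * exp (g x) ^ 2 = x).
    { replace (exp (g x) ^ 2) with (exp (ln x - ln PI)).
      - unfold Rminus. rewrite exp_plus, exp_Ropp, !exp_ln by lra. field. lra.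
      - simpl. rewrite Rmult_1_r, <- exp_plus. f_equal. unfold g. field. }
    rewrite E1.
    assert (E2 : (Cexp (s / 2 * ln PI) * Cexp (s * g x))%C = Cexp (s / 2 * ln x)).
    { rewrite <- Cexp_plus. f_equal. unfold g. rewrite RtoC_div, RtoC_minus by lra. field. }
    assert (E3 : Cexp ((s / 2 - 1) * ln x) = (Cexp (s / 2 * ln x) * / x)%C).
    { replace ((s / 2 - 1) * ln x)%C with (s / 2 * ln x + RtoC (- ln x))%C by (rewrite RtoC_opp; ring).
      rewrite Cexp_plus, Cexp_RtoC, exp_Ropp, exp_ln, RtoC_inv by lra. reflexivity. }
    rewrite E3, <- E2. rewrite RtoC_inv, RtoC_mult by lra. match goal with |- ?a = ?b => change (@eq C a b) end. field.
    intros Q; apply RtoC_inj in Q; lra.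
  - apply K.
    + intros x Hx. apply ccont_continuous. exact (proj1 TH).
    + intros x Hx. split; [apply Dg; lra|].
      apply cont_of_derive. auto_derive. lra. }
intros P [eps HP].
destruct (small_tail c (eps / 2) (tame_nonneg _ _ TH) (is_pos_div_2 eps)) as [A [HA HB]].
specialize (HB A (Rle_refl A)).
assert (ga : forall x, 0 < x -> x < PI * exp (- (2 * A)) -> g x <= - A).
{ intros x Hx Hx2. unfold g. assert (L := ln_increasing _ _ Hx Hx2). rewrite ln_mult, ln_exp in L by (try exact PP; apply exp_pos). lra. }
assert (gb : forall x, PI * exp (2 * A) < x -> A <= g x).
{ intros x Hx. unfold g. assert (L := ln_increasing _ _ (Rmult_lt_0_compat _ _ PP (exp_pos (2 * A))) Hx).
  rewrite ln_mult, ln_exp in L by (try exact PP; apply exp_pos). lra. }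
assert (Pe : 0 < PI * exp (- (2 * A))) by (apply Rmult_lt_0_compat; [exact PP|apply exp_pos]).
assert (Ple : PI * exp (- (2 * A)) <= PI * exp (2 * A)) by (apply Rmult_le_compat_l; [lra|apply exp_le_mono; lra]).
apply (Filter_prod _ _ _ (fun x => 0 < x /\ x < PI * exp (- (2 * A))) (fun x => PI * exp (2 * A) < x)).
- exists (mkposreal _ Pe). intros y Hy Hy0. split; [exact Hy0|].
  unfold ball in Hy; simpl in Hy; unfold AbsRing_ball, abs, minus, plus, opp in Hy; simpl in Hy.
  rewrite Ropp_0, Rplus_0_r, Rabs_pos_eq in Hy by lra. exact Hy.
- exists (PI * exp (2 * A)). intros x Hx; exact Hx.
- intros a b [Ha1 Ha2] Hb. exists (cint H (g a) (g b)). simpl. split; [apply IR; lra|].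
  apply HP. apply C_NormedModule_mixin_compat1. change (Cmod (cint H (g a) (g b) - CRInt_line H) < eps).
  assert (K1 := cint_tame_tail H c A (g a) (g b) TH HA (ga a Ha1 Ha2) (gb b Hb)).
  assert (K2 := line_tail H c A TH HA).
  replace (cint H (g a) (g b) - CRInt_line H)%C with ((cint H (g a) (g b) - cint H (- A) A) + - (CRInt_line H - cint H (- A) A))%C by ring.
  apply Rle_lt_trans with (1 := Cmod_triangle _ _). rewrite Cmod_opp. lra.
Qed.

Definition xi_fourier (s : C) : C := laplace (fun u => RtoC (Phi u)) (s - / 2)%C.

Lemma hol_xi_fourier s : hol xi_fourier s (laplace (fun u => RtoC (Phi u) * RtoC u)%C (s - / 2)%C).
Proof.
eapply hol_eq.
- apply (hol_comp (laplace (fun u => RtoC (Phi u))) (fun s => s - / 2)%C).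
  + apply (hol_plus (fun s => s)); [apply hol_id|apply hol_const].
  + apply hol_laplace, rapid_Phi.
- cbv beta; ring.
Qed.

Lemma is_xi_xi_fourier : is_xi xi_fourier.
Proof.
split.
- intros z. eexists. apply hol_is_C_derive, hol_xi_fourier.
- intros s Hs. unfold xi_fourier, laplace. rewrite (laplace_Phi_zeta s Hs), (line_zeta_term0 s Hs), (CGamma_eq s) by lra.
  assert (E : (Rcpow PI (- (s / 2)) * Rcpow PI (s / 2))%C = 1).
  { unfold Rcpow. rewrite <- Cexp_plus. rewrite <- Cexp_0. f_equal. ring. }
  transitivity (/ 2 * 2 * s * (s - 1) * (Rcpow PI (- (s / 2)) * Rcpow PI (s / 2)) * CRInt_line (euler_int s (PC 1)) * Czeta s)%C.
  + rewrite E. field.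
  + ring.
Qed.

Lemma holo_entire f : entire f -> holo f.
Proof. intros H z. destruct (H z) as [l Hl]. exists l. apply is_C_derive_hol, Hl. Qed.

(** The right-hand side shows that an entire extension exists, so that [xi] is one;
unique continuation identifies the two. *)
Theorem xi_eq s : xi s = xi_fourier s.
Proof.
assert (X : is_xi xi) by (unfold xi; apply epsilon_spec; exists xi_fourier; apply is_xi_xi_fourier).
destruct X as [X1 X2]. destruct is_xi_xi_fourier as [Y1 Y2].
apply holo_entire in X1. apply holo_entire in Y1.
apply Ceq_minus. apply (entire_zero_halfplane (fun s => xi s - xi_fourier s)%C).
- intros z. destruct (X1 z) as [l1 H1]. destruct (Y1 z) as [l2 H2]. eexists.
  apply hol_minus; eassumption.
- intros z Hz. rewrite (X2 z Hz), (Y2 z Hz). ring.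
Qed.

Theorem Xi_eq t : Xi t = laplace (fun u => RtoC (Phi u)) (Ci * t)%C.
Proof.
unfold Xi. rewrite xi_eq. unfold xi_fourier. f_equal. ring.
Qed.

(** * Hermite polynomials *)

(** Two consecutive Hermite polynomials, to run the three-term recurrence. *)
Fixpoint herm_pair (n : nat) (z : C) : C * C :=
  match n with
  | O => (RtoC 1, (2 * z)%C)
  | S m => let (a, b) := herm_pair m z in (b, (2 * z * b - 2 * INR (S m) * a)%C)
  end.
Definition herm (n : nat) (z : C) : C := fst (herm_pair n z).

Lemma herm_pair_snd n z : snd (herm_pair n z) = herm (S n) z.
Proof. unfold herm; simpl. destruct (herm_pair n z); reflexivity. Qed.

Lemma herm_0 z : herm 0 z = 1.
Proof. reflexivity. Qed.

Lemma herm_1 z : herm 1 z = (2 * z)%C.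
Proof. reflexivity. Qed.

Lemma herm_SS n z : herm (S (S n)) z = (2 * z * herm (S n) z - 2 * INR (S n) * herm n z)%C.
Proof.
rewrite <- herm_pair_snd. rewrite <- (herm_pair_snd n). unfold herm. cbn [herm_pair]. destruct (herm_pair n z); reflexivity.
Qed.

Lemma nat_ind2 (P : nat -> Prop) : P 0%nat -> P 1%nat -> (forall n, P n -> P (S n) -> P (S (S n))) -> forall n, P n.
Proof. intros H0 H1 HS n. assert (P n /\ P (S n)); [|tauto]. induction n as [|n [A B]]; split; auto. Qed.

(** [H_n' = 2 n H_(n-1)], from the recurrence by induction. *)
Lemma hol_herm n z : hol (herm (S n)) z (2 * INR (S n) * herm n z)%C.
Proof.
revert n. apply (nat_ind2 (fun n => hol (herm (S n)) z (2 * INR (S n) * herm n z)%C)).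
- apply (hol_ext (fun z => 2 * z)%C); [intros; reflexivity|]. eapply hol_eq.
  + apply hol_mult; [apply hol_const|apply hol_id].
  + rewrite herm_0. simpl INR. ring.
- apply (hol_ext (fun z => (2 * z) * (2 * z) + (- (2 * 1)))%C).
  + intros y. rewrite (herm_SS 0), herm_0, herm_1. simpl INR. ring.
  + eapply hol_eq.
    * apply hol_plus; [|apply hol_const]. apply hol_mult; (apply hol_mult; [apply hol_const|apply hol_id]).
    * rewrite herm_1. cbv beta. rewrite !S_INR. simpl INR. rewrite !RtoC_plus. ring.
- intros n IH1 IH2.
  apply (hol_ext (fun z => (2 * z) * herm (S (S n)) z + (- (2 * INR (S (S n)))) * herm (S n) z)%C).
  + intros y. rewrite (herm_SS (S n)). ring.
  + eapply hol_eq.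
    * apply hol_plus; [apply hol_mult; [apply hol_mult; [apply hol_const|apply hol_id]|exact IH2]|].
      apply hol_mult; [apply hol_const|exact IH1].
    * cbv beta. rewrite (herm_SS n). rewrite !(S_INR (S (S n))), !(S_INR (S n)), !RtoC_plus. ring.
Qed.

(** [d/dz (H_n exp (- z^2)) = - H_(n+1) exp (- z^2)], since [H_(n+1) = 2 z H_n - H_n']. *)
Lemma iter_C_derive n : Nat.iter n C_derive (fun w : C => Cexp (- w ^ 2)) =
  (fun z => (-(1)) ^ n * herm n z * Cexp (- z ^ 2))%C.
Proof.
induction n as [|n IH].
- apply functional_extensionality. intros z. rewrite herm_0. simpl. ring.
- transitivity (C_derive (Nat.iter n C_derive (fun w : C => Cexp (- w ^ 2)))); [reflexivity|].
  rewrite IH. apply functional_extensionality. intros z.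
  apply is_C_derive_unique, hol_is_C_derive.
  assert (DE : hol (fun z => Cexp (- z ^ 2)) z (Cexp (- z ^ 2) * (- (2 * z)))%C).
  { apply (hol_comp Cexp (fun z => - z ^ 2)%C); [|apply hol_Cexp].
    apply (hol_ext (fun z => (-(1)) * (z * z))%C); [intros; simpl; ring|].
    eapply hol_eq; [apply hol_mult; [apply hol_const|apply hol_mult; apply hol_id]|cbv beta; ring]. }
  destruct n as [|n].
  + apply (hol_ext (fun z => Cexp (- z ^ 2))); [intros; rewrite herm_0; simpl; ring|].
    eapply hol_eq; [exact DE|]. rewrite herm_1. simpl. ring.
  + eapply hol_eq.
    * apply hol_mult; [apply hol_mult; [apply hol_const|apply hol_herm]|exact DE].
    * cbv beta. rewrite (herm_SS n), !Cpow_S. ring.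
Qed.

Lemma Hermite_eq n z : Hermite n z = herm n z.
Proof.
unfold Hermite. rewrite iter_C_derive.
assert (E1 : ((-(1)) ^ n * (-(1)) ^ n)%C = 1).
{ rewrite <- Cpow_mult_l. replace (- (1) * - (1))%C with (RtoC 1) by ring. apply Cpow_1_l. }
assert (E2 : (Cexp (z ^ 2) * Cexp (- z ^ 2))%C = 1).
{ rewrite <- Cexp_plus, <- Cexp_0. f_equal. ring. }
replace (RtoC (-1)) with (- (1))%C by (rewrite <- RtoC_opp; reflexivity).
transitivity (((-(1)) ^ n * (-(1)) ^ n) * (Cexp (z ^ 2) * Cexp (- z ^ 2)) * herm n z)%C; [ring|].
rewrite E1, E2. ring.
Qed.

(** The integrand of [H_n(z) = 2^n / sqrt PI * int (z + i u)^n exp (- u^2) du]. *)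
Definition herm_integrand (n : nat) (z : C) (u : R) : C := (RtoC (exp (- u ^ 2)) * (z + Ci * RtoC u) ^ n)%C.

Lemma rapid_herm_integrand n z : rapid (herm_integrand n z).
Proof.
apply rapid_mult; [apply rapid_gauss|]. apply expbd_pow, expbd_plus; [apply expbd_const|].
apply expbd_mult; [apply expbd_const|apply expbd_id].
Qed.

Lemma line_herm_integrand_rec1 z : CRInt_line (herm_integrand 1 z) = (z * CRInt_line (herm_integrand 0 z))%C.
Proof.
apply Ceq_minus.
rewrite <- (line_FTC2 (fun u => RtoC (exp (- u ^ 2)) * - (Ci * / 2))%C (herm_integrand 1 z) (herm_integrand 0 z) 1 (- z)).
- ring.
- apply rapid_tame, rapid_mult; [apply rapid_gauss|apply expbd_const].
- apply rapid_tame, rapid_herm_integrand.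
- apply rapid_tame, rapid_herm_integrand.
- intros x. eapply cderive_eq; [apply cderive_mult; [apply cderive_gauss|apply cderive_const]|]. unfold herm_integrand. simpl. field.
Qed.

(** The difference of the two sides is the integral of the derivative of
[- (i / 2) (z + i u)^(n+1) exp (- u^2)]. *)
Lemma line_herm_integrand_rec n z : CRInt_line (herm_integrand (S (S n)) z) =
  (z * CRInt_line (herm_integrand (S n) z) - INR (S n) / 2 * CRInt_line (herm_integrand n z))%C.
Proof.
destruct (rapid_tame _ (rapid_herm_integrand n z)) as [c0 T0]. destruct (rapid_tame _ (rapid_herm_integrand (S n) z)) as [c1 T1].
assert (Ta := tame_scal (INR (S n) / 2)%C _ _ T0). assert (Tb := tame_scal (- z) _ _ T1).
apply Ceq_minus.
rewrite <- (line_FTC2 (fun u => herm_integrand (S n) z u * - (Ci * / 2))%C (herm_integrand (S (S n)) z)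
  (fun u => (- z) * herm_integrand (S n) z u + (INR (S n) / 2)%C * herm_integrand n z u)%C 1 1).
- rewrite (line_plus _ _ _ _ Tb Ta), (line_scal _ _ _ T0), (line_scal _ _ _ T1). ring.
- apply rapid_tame, rapid_mult; [apply rapid_herm_integrand|apply expbd_const].
- apply rapid_tame, rapid_herm_integrand.
- eexists. exact (tame_plus _ _ _ _ Tb Ta).
- intros x. eapply cderive_eq.
  + apply cderive_mult; [|apply cderive_const]. unfold herm_integrand. apply cderive_mult; [apply cderive_gauss|].
    apply cderive_pow. apply cderive_plus; [apply cderive_const|]. apply cderive_mult; [apply cderive_const|apply cderive_id].
  + cbv beta. unfold herm_integrand. rewrite !Cpow_S.
    set (g := RtoC (exp (- x ^ 2))). set (v := ((z + Ci * x) ^ n)%C).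
    transitivity (g * v * (Ci * x) * (z + Ci * x) + (- (Ci * Ci)) * (INR (S n) / 2) * g * v)%C.
    * field.
    * rewrite Ci2. field.
Qed.

Lemma sqrt_PI_nz : RtoC (sqrt PI) <> 0.
Proof. intros E; apply RtoC_inj in E. assert (P := sqrt_lt_R0 _ PI_RGT_0). lra. Qed.

Lemma herm_integral n z : (RtoC (sqrt PI) * herm n z)%C = (2 ^ n * CRInt_line (herm_integrand n z))%C.
Proof.
assert (I0 : CRInt_line (herm_integrand 0 z) = RtoC (sqrt PI)).
{ rewrite <- gauss_integral. apply line_ext. intros u. unfold herm_integrand. simpl. ring. }
revert n. apply (nat_ind2 (fun n => (RtoC (sqrt PI) * herm n z)%C = (2 ^ n * CRInt_line (herm_integrand n z))%C)).
- rewrite herm_0, I0. simpl. ring.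
- rewrite herm_1, line_herm_integrand_rec1, I0. simpl. ring.
- intros n H0 H1. rewrite herm_SS, line_herm_integrand_rec.
  transitivity (2 * z * (RtoC (sqrt PI) * herm (S n) z) - 2 * INR (S n) * (RtoC (sqrt PI) * herm n z))%C; [ring|].
  rewrite H0, H1, !Cpow_S. field.
Qed.

(** The norm of [H_n] in [L^2(exp (- x^2) dx)], up to the factor [PI^(1/4)]. *)
Definition herm_norm (n : nat) : R := sqrt (2 ^ n * INR (fact n)).

Lemma herm_norm_sq n : herm_norm n * herm_norm n = 2 ^ n * INR (fact n).
Proof. apply sqrt_sqrt. apply Rmult_le_pos; [apply pow_le; lra|apply pos_INR]. Qed.

Lemma herm_norm_pos n : 0 < herm_norm n.
Proof. apply sqrt_lt_R0. apply Rmult_lt_0_compat; [apply pow_lt; lra|apply INR_fact_lt_0]. Qed.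

(** The square of this inequality bounds one term of the series of [exp (2 k x^2)]. *)
Lemma pow_le_herm_norm k x n : 0 < k -> 0 <= x ->
  2 ^ n * x ^ n <= herm_norm n * sqrt (/ k) ^ n * exp (k * x ^ 2).
Proof.
intros Hk Hx.
assert (P := pow_le_exp (2 * k * x ^ 2) n ltac:(assert (0 <= x ^ 2) by apply pow2_ge_0; nra)).
assert (S0 := sqrt_pos (/ k)).
assert (Sk : sqrt (/ k) * sqrt (/ k) = / k) by (apply sqrt_sqrt; left; apply Rinv_0_lt_compat, Hk).
assert (H0 := herm_norm_pos n). assert (E0 := exp_pos (k * x ^ 2)).
assert (R0 : 0 <= herm_norm n * sqrt (/ k) ^ n * exp (k * x ^ 2)).
{ apply Rmult_le_pos; [apply Rmult_le_pos; [lra|apply pow_le, S0]|lra]. }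
apply Rsqr_incr_0_var; [|exact R0]. unfold Rsqr.
replace (herm_norm n * sqrt (/ k) ^ n * exp (k * x ^ 2) * (herm_norm n * sqrt (/ k) ^ n * exp (k * x ^ 2))) with
  ((herm_norm n * herm_norm n) * (sqrt (/ k) ^ n * sqrt (/ k) ^ n) * (exp (k * x ^ 2) * exp (k * x ^ 2))) by ring.
rewrite herm_norm_sq, <- (Rpow_mult_distr (sqrt (/ k))), Sk, <- exp_plus.
replace (k * x ^ 2 + k * x ^ 2) with (2 * k * x ^ 2) by ring.
assert (K0 : 0 < (/ k) ^ n) by (apply pow_lt, Rinv_0_lt_compat, Hk).
assert (E : 2 ^ n * x ^ n * (2 ^ n * x ^ n) = 2 ^ n * (/ k) ^ n * (2 * k * x ^ 2) ^ n).
{ rewrite <- !Rpow_mult_distr. f_equal. field. lra. }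
rewrite E.
replace (2 ^ n * INR (fact n) * (/ k) ^ n * exp (2 * k * x ^ 2)) with (2 ^ n * (/ k) ^ n * (INR (fact n) * exp (2 * k * x ^ 2))) by ring.
apply Rmult_le_compat_l; [|exact P]. apply Rmult_le_pos; [apply pow_le; lra|lra].
Qed.

Lemma exp_neg_quad eta u : 0 < eta <= 1 -> exp (- eta * u ^ 2) <= / eta * wt u.
Proof.
intros He. replace (- eta * u ^ 2) with (- (eta * u ^ 2)) by ring. rewrite exp_Ropp. unfold wt.
rewrite <- Rinv_mult. assert (U := pow2_ge_0 u).
apply Rinv_le_contravar; [nra|]. assert (Q := exp_ineq1_le (eta * u ^ 2)). nra.
Qed.

(** Inserting [pow_le_herm_norm] into the integral representation: since [k < 1], the
Gaussian [exp (- u^2)] dominates [exp (k (b + u)^2)], and [exp (k a^2)] leaves room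
under the weight [exp (- a^2)]. *)
Lemma herm_bound k b : 0 < k < 1 -> exists M, 0 <= M /\ forall n a,
  Cmod (herm n (a, b)) <= M * (herm_norm n * sqrt (/ k) ^ n * exp (k * a ^ 2)).
Proof.
intros Hk. set (eta := (1 - k) / 2). assert (e0 : 0 < eta <= 1) by (unfold eta; lra).
set (M := exp (k * b ^ 2 + b ^ 2 / eta) * / eta).
assert (PP := PI_RGT_0). assert (SP := sqrt_lt_R0 _ PP).
exists (M * PI / sqrt PI).
assert (M0 : 0 <= M).
{ apply Rmult_le_pos; [left; apply exp_pos|left; apply Rinv_0_lt_compat; lra]. }
split. { apply Rmult_le_pos; [apply Rmult_le_pos; lra|left; apply Rinv_0_lt_compat, SP]. }
intros n a.
set (G := herm_norm n * sqrt (/ k) ^ n).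
assert (G0 : 0 <= G). { apply Rmult_le_pos; [left; apply herm_norm_pos|apply pow_le, sqrt_pos]. }
assert (T : tame (fun u => 2 ^ n * herm_integrand n (a, b) u)%C (G * exp (k * a ^ 2) * M)).
{ split; [apply ccont_mult; [apply ccont_const|apply rapid_herm_integrand]|]. intros u. unfold herm_integrand.
  rewrite !Cmod_mult, !Cmod_pow, !Cmod_R. rewrite (Rabs_pos_eq 2) by lra. rewrite (Rabs_pos_eq (exp _)) by (left; apply exp_pos).
  set (x := Cmod ((a, b) + Ci * u)).
  assert (x0 : 0 <= x) by apply Cmod_ge_0.
  assert (x2 : x ^ 2 = a ^ 2 + (b + u) ^ 2).
  { unfold x. rewrite Cmod2_alt. simpl. ring. }
  assert (P := pow_le_herm_norm k x n (proj1 Hk) x0). fold G in P.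
  replace (2 ^ n * (exp (- u ^ 2) * x ^ n)) with (2 ^ n * x ^ n * exp (- u ^ 2)) by ring.
  apply Rle_trans with (G * exp (k * x ^ 2) * exp (- u ^ 2)).
  { apply Rmult_le_compat_r; [left; apply exp_pos|exact P]. }
  rewrite x2. replace (G * exp (k * a ^ 2) * M * wt u) with (G * exp (k * a ^ 2) * exp (k * b ^ 2 + b ^ 2 / eta) * (/ eta * wt u)) by (unfold M; ring).
  apply Rle_trans with (G * exp (k * a ^ 2) * exp (k * b ^ 2 + b ^ 2 / eta) * exp (- eta * u ^ 2)).
  - rewrite !Rmult_assoc. rewrite <- !exp_plus. apply Rmult_le_compat_l; [exact G0|]. apply exp_le_mono.
    assert (Q : 2 * k * b * u <= eta * u ^ 2 + b ^ 2 / eta).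
    { assert (Q0 : 0 <= (eta * u - k * b) ^ 2 / eta).
      { unfold Rdiv. apply Rmult_le_pos; [apply pow2_ge_0|left; apply Rinv_0_lt_compat; lra]. }
      replace ((eta * u - k * b) ^ 2 / eta) with (eta * u ^ 2 - 2 * k * b * u + k ^ 2 * (b ^ 2 / eta)) in Q0 by (field; lra).
      assert (B0 : 0 <= b ^ 2 / eta). { unfold Rdiv. apply Rmult_le_pos; [apply pow2_ge_0|left; apply Rinv_0_lt_compat; lra]. }
      assert (k ^ 2 <= 1) by nra. nra. }
    assert (eta = (1 - k) / 2) by reflexivity. nra.
  - apply Rmult_le_compat_l; [|apply exp_neg_quad, e0].
    apply Rmult_le_pos; [apply Rmult_le_pos; [exact G0|]|]; left; apply exp_pos. }
assert (B := line_bound _ _ T). destruct (rapid_tame _ (rapid_herm_integrand n (a, b))) as [c0 T0].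
rewrite (line_scal _ _ _ T0), <- herm_integral, Cmod_mult, Cmod_R, (Rabs_pos_eq (sqrt PI)) in B by lra.
apply (Rmult_le_reg_l (sqrt PI)); [exact SP|]. apply Rle_trans with (1 := B).
right. fold G. field. lra.
Qed.

Definition herm_fun (n : nat) (u : R) : C := (RtoC (exp (- u ^ 2)) * herm n (RtoC u))%C.

Lemma expbd_herm n : expbd (fun u => herm n (RtoC u)).
Proof.
revert n. apply (nat_ind2 (fun n => expbd (fun u => herm n (RtoC u)))).
- exact (expbd_const 1).
- exact (expbd_mult _ _ (expbd_const 2) expbd_id).
- intros n H0 H1.
  assert (K := expbd_plus _ _ (expbd_mult _ _ (expbd_mult _ _ (expbd_const 2) expbd_id) H1) (expbd_mult _ _ (expbd_const (- (2 * INR (S n)))%C) H0)).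
  replace (fun u => herm (S (S n)) (RtoC u)) with (fun u : R => 2 * u * herm (S n) u + - (2 * INR (S n)) * herm n u)%C; [exact K|].
  apply functional_extensionality. intros u. rewrite herm_SS. ring.
Qed.

Lemma rapid_herm_fun n : rapid (herm_fun n).
Proof. apply rapid_mult; [apply rapid_gauss|apply expbd_herm]. Qed.

Lemma cderive_herm n u : cderive (fun u => herm n (RtoC u)) u (2 * RtoC u * herm n u - herm (S n) u)%C.
Proof.
assert (K : forall l, hol (herm n) (RtoC u) l -> cderive (fun u => herm n (RtoC u)) u l).
{ intros l Hl.
  apply (cderive_ext (fun s : R => herm n (0 + s * 1)%C)); [intros; f_equal; ring|].
  replace l with (l * 1)%C by ring. apply hol_cderive. replace (0 + u * 1)%C with (RtoC u) by ring. exact Hl. }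
destruct n as [|n].
- eapply cderive_eq; [apply K; apply (hol_const 1)|]. rewrite herm_0, herm_1. ring.
- eapply cderive_eq; [apply K; apply hol_herm|]. rewrite (herm_SS n). ring.
Qed.

Lemma cderive_herm_fun n u : cderive (herm_fun n) u (- herm_fun (S n) u)%C.
Proof.
unfold herm_fun. eapply cderive_eq; [apply cderive_mult; [apply cderive_gauss|apply cderive_herm]|]. cbv beta. ring.
Qed.

(** As each [herm_fun] is minus the derivative of the preceding one, integration by
parts multiplies the transform by [s]. *)
Lemma laplace_herm_fun n s : laplace (herm_fun n) s = (s ^ n * (sqrt PI * Cexp (s ^ 2 / 4)))%C.
Proof.
induction n as [|n IH].
- rewrite <- gauss_laplace. rewrite Cmult_1_l. apply line_ext. intros u. unfold herm_fun. rewrite herm_0. ring.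
- assert (RL : forall m, exists c, tame (fun u => herm_fun m u * Cexp (s * RtoC u))%C c)
    by (intros m; apply rapid_tame, rapid_laplace, rapid_herm_fun).
  rewrite Cpow_S, <- Cmult_assoc, <- IH. symmetry. apply Ceq_minus.
  rewrite <- (line_FTC2 (fun u => herm_fun n u * Cexp (s * RtoC u))%C _ _ s (-(1)) (RL n) (RL n) (RL (S n))).
  + unfold laplace. ring.
  + intros x. eapply cderive_eq; [apply cderive_mult; [apply cderive_herm_fun|apply cderive_Cexp, cderive_mult; [apply cderive_const|apply cderive_id]]|]. cbv beta. ring.
Qed.

(** Summing the exponential series under the integral representation leaves a
Gaussian integral.  The bound [(4 |z| v)^n <= n! exp (4 |z| v)], with [v = |t + i u|],
provides the summable constants [2^(- n)]. *)
Lemma herm_generating t z : csum (fun n => herm n t * z ^ n / INR (fact n))%C (Cexp (2 * t * z - z ^ 2)).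
Proof.
set (B := 4 * Cmod z).
destruct (rapid_bound _ (B + 1) rapid_gauss) as [M [M0 HM]].
assert (B0 : 0 <= B) by (unfold B; assert (K := Cmod_ge_0 z); lra).
set (f := fun n u => ((2 * z) ^ n / INR (fact n) * herm_integrand n t u)%C).
set (c := exp (B * Cmod t) * M * 4).
assert (Hf : forall n, tame (f n) ((/ 2) ^ n * c)).
{ intros n. split; [apply ccont_mult; [apply ccont_const|apply rapid_herm_integrand]|]. intros u.
  unfold f, herm_integrand, Cdiv. rewrite !Cmod_mult, Cmod_inv by apply INR_fact_C. rewrite !Cmod_pow, Cmod_mult, !Cmod_R.
  assert (F0 := INR_fact_lt_0 n). rewrite (Rabs_pos_eq 2), (Rabs_pos_eq (INR _)) by lra.
  rewrite Rabs_pos_eq by (left; apply exp_pos).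
  set (v := Cmod (t + Ci * u)). assert (v0 : 0 <= v) by apply Cmod_ge_0.
  assert (P := pow_le_exp (B * v) n ltac:(nra)).
  assert (vb : v <= Cmod t + Rabs u).
  { unfold v. apply Rle_trans with (1 := Cmod_triangle _ _). rewrite Cmod_mult, Cmod_Ci, Cmod_R. lra. }
  assert (P2 : exp (B * v) <= exp (B * Cmod t) * exp (B * Rabs u)) by (rewrite <- exp_plus; apply exp_le_mono; nra).
  assert (E : (2 * Cmod z) ^ n * / INR (fact n) * (exp (- u ^ 2) * v ^ n) = (/ 2) ^ n * / INR (fact n) * exp (- u ^ 2) * (B * v) ^ n).
  { replace (B * v) with (2 * (2 * Cmod z * v)) by (unfold B; ring). rewrite !Rpow_mult_distr.
    replace ((/ 2) ^ n) with (/ 2 ^ n) by (symmetry; apply pow_inv). field.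
    split; [lra|apply pow_nonzero; lra]. }
  rewrite E.
  assert (g0 : 0 < exp (- u ^ 2)) by apply exp_pos. assert (h0 : 0 < (/ 2) ^ n) by (apply pow_lt; lra).
  apply Rle_trans with ((/ 2) ^ n * / INR (fact n) * exp (- u ^ 2) * (INR (fact n) * (exp (B * Cmod t) * exp (B * Rabs u)))).
  { apply Rmult_le_compat_l.
    - apply Rmult_le_pos; [apply Rmult_le_pos; [lra|left; apply Rinv_0_lt_compat, F0]|lra].
    - apply Rle_trans with (1 := P). apply Rmult_le_compat_l; lra. }
  specialize (HM u). rewrite Cmod_R, Rabs_pos_eq in HM by lra.
  apply Rle_trans with ((/ 2) ^ n * exp (B * Cmod t) * exp (B * Rabs u) * (M * exp (- (B + 1) * Rabs u))).
  { apply Rle_trans with ((/ 2) ^ n * exp (B * Cmod t) * exp (B * Rabs u) * exp (- u ^ 2)); [right; field; lra|].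
    apply Rmult_le_compat_l; [|exact HM]. apply Rmult_le_pos; [apply Rmult_le_pos; [lra|]|]; left; apply exp_pos. }
  replace ((/ 2) ^ n * exp (B * Cmod t) * exp (B * Rabs u) * (M * exp (- (B + 1) * Rabs u))) with
    ((/ 2) ^ n * exp (B * Cmod t) * M * (exp (B * Rabs u) * exp (- (B + 1) * Rabs u))) by ring.
  rewrite <- exp_plus. replace (B * Rabs u + - (B + 1) * Rabs u) with (Ropp 1 * Rabs u) by ring.
  assert (W := two_sided_wt 1 u ltac:(lra)). replace (4 / 1 ^ 2) with 4 in W by field.
  unfold c. replace ((/ 2) ^ n * (exp (B * Cmod t) * M * 4) * wt u) with ((/ 2) ^ n * exp (B * Cmod t) * M * (4 * wt u)) by ring.
  apply Rmult_le_compat_l; [|exact W]. apply Rmult_le_pos; [apply Rmult_le_pos; [lra|left; apply exp_pos]|exact M0]. }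
assert (Hs : ex_series (fun n => (/ 2) ^ n * c)).
{ apply ex_series_scal_Rr. exists (/ (1 - / 2)). apply is_series_geom. rewrite Rabs_pos_eq; lra. }
destruct (line_series f _ Hf Hs) as [F [H1 [H2 H3]]].
assert (EF : forall u, F u = (RtoC (exp (- u ^ 2)) * Cexp (2 * z * (t + Ci * u)))%C).
{ intros u. apply (csum_unique _ _ _ (H1 u)).
  apply (csum_ext (fun n => RtoC (exp (- u ^ 2)) * ((2 * z * (t + Ci * u)) ^ n / INR (fact n)))%C).
  - intros n. unfold f, herm_integrand. rewrite (Cpow_mult_l (2 * z)). unfold Cdiv. ring.
  - apply csum_scal, Cexp_series. }
assert (EL : CRInt_line F = (sqrt PI * Cexp (2 * t * z - z ^ 2))%C).
{ transitivity (CRInt_line (fun u => Cexp (2 * z * t) * (RtoC (exp (- u ^ 2)) * Cexp ((2 * z * Ci) * RtoC u)))%C).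
  - apply line_ext. intros u. rewrite EF. replace (2 * z * (t + Ci * u))%C with (2 * z * t + 2 * z * Ci * u)%C by ring.
    rewrite Cexp_plus. ring.
  - destruct (rapid_tame _ (rapid_laplace _ (2 * z * Ci)%C rapid_gauss)) as [c0 T0].
    rewrite (line_scal _ _ _ T0).
    change (Cexp (2 * z * t) * laplace (fun u => RtoC (exp (- u ^ 2))) (2 * z * Ci) = sqrt PI * Cexp (2 * t * z - z ^ 2))%C.
    rewrite gauss_laplace.
    replace (Cexp (2 * z * t) * (sqrt PI * Cexp ((2 * z * Ci) ^ 2 / 4)))%C with
      (sqrt PI * (Cexp (2 * z * t) * Cexp ((2 * z * Ci) ^ 2 / 4)))%C by ring.
    rewrite <- Cexp_plus. do 2 f_equal.
    transitivity (2 * t * z + (Ci * Ci) * (z * z))%C; [simpl; field|]. rewrite Ci2. simpl. ring. }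
rewrite EL in H3.
apply (csum_scal (/ sqrt PI)%C) in H3.
replace (/ sqrt PI * (sqrt PI * Cexp (2 * t * z - z ^ 2)))%C with (Cexp (2 * t * z - z ^ 2)) in H3 by (field; apply sqrt_PI_nz).
revert H3. apply csum_ext. intros n. unfold f.
destruct (rapid_tame _ (rapid_herm_integrand n t)) as [c0 T0]. rewrite (line_scal _ _ _ T0).
rewrite (Cpow_mult_l 2 z).
transitivity (/ sqrt PI * (z ^ n / INR (fact n)) * (2 ^ n * CRInt_line (herm_integrand n t)))%C; [unfold Cdiv; ring|].
rewrite <- herm_integral. field. split; [apply INR_fact_C|apply sqrt_PI_nz].
Qed.

(** * Comparison of the two flows *)

Lemma cont2_fun1 (f : R -> R) : (forall x, continuous f x) -> cont2 (fun x _ => f x).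
Proof.
intros H x y. apply (continuity_1d_2d_pt_comp f (fun u _ => u)); [|apply continuity_2d_pt_id1].
apply continuity_pt_filterlim, H.
Qed.

Lemma ccont2_fst f : ccont f -> ccont2 (fun x _ => f x).
Proof.
intros H. split; [apply (cont2_fun1 (fun x => fst (f x)))|apply (cont2_fun1 (fun x => snd (f x)))]; intros x; apply H.
Qed.

Lemma ccont2_snd f : ccont f -> ccont2 (fun _ y => f y).
Proof. intros H. apply (ccont2_swap (fun x _ => f x)), ccont2_fst, H. Qed.

Lemma ccont2_mult f g : ccont2 f -> ccont2 g -> ccont2 (fun x y => f x y * g x y)%C.
Proof.
intros [H1 H2] [H3 H4]. split; intros x y; simpl.
- apply continuity_2d_pt_minus; apply continuity_2d_pt_mult; auto.
- apply continuity_2d_pt_plus; apply continuity_2d_pt_mult; auto.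
Qed.

Lemma ccont2_Cexp f : ccont2 f -> ccont2 (fun x y => Cexp (f x y)).
Proof.
intros [H1 H2].
split; intros x y; unfold Cexp, Re, Im; simpl; apply continuity_2d_pt_mult.
- apply (continuity_1d_2d_pt_comp exp); [apply derivable_continuous_pt, derivable_pt_exp|apply H1].
- apply (continuity_1d_2d_pt_comp cos); [apply continuity_cos|apply H2].
- apply (continuity_1d_2d_pt_comp exp); [apply derivable_continuous_pt, derivable_pt_exp|apply H1].
- apply (continuity_1d_2d_pt_comp sin); [apply continuity_sin|apply H2].
Qed.

Lemma Cmod_Cexp_i (z : C) : Re z = 0 -> Cmod (Cexp z) = 1.
Proof. intros H. rewrite Cmod_Cexp, H. apply exp_0. Qed.

(** The multiplication formula for the Fourier transform, by Fubini's theorem. *)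
Lemma Fourier_exchange k1 k2 : rapid k1 -> rapid k2 ->
  CRInt_line (fun y : R => k1 y * laplace k2 (Ci * y))%C = CRInt_line (fun x : R => k2 x * laplace k1 (Ci * x))%C.
Proof.
intros R1 R2. destruct (rapid_tame _ R1) as [c1 T1]. destruct (rapid_tame _ R2) as [c2 T2].
assert (Re0 : forall x y : R, Re (Ci * x * y)%C = 0) by (intros; simpl; ring).
assert (TE : forall k c (x : R), tame k c -> tame (fun y : R => k y * Cexp (Ci * x * y))%C c).
{ intros k c x [H1 H2]. split.
  - apply ccont_mult; [exact H1|]. apply ccont_Cexp, ccont_mult; [apply ccont_const|apply ccont_id].
  - intros u. rewrite Cmod_mult, Cmod_Cexp_i, Rmult_1_r by apply Re0. apply H2. }
set (F := fun y x : R => (k1 y * (k2 x * Cexp (Ci * y * x)))%C).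
assert (C2F : ccont2 F).
{ apply ccont2_mult; [apply ccont2_fst, R1|]. apply ccont2_mult; [apply ccont2_snd, R2|].
  apply ccont2_Cexp. apply ccont2_mult; [|apply ccont2_snd, ccont_id]. apply (ccont2_fst (fun y : R => Ci * y)%C).
  apply ccont_mult; [apply ccont_const|apply ccont_id]. }
assert (Bd : forall y x, Cmod (F y x) <= (c1 * c2) * (wt y * wt x)).
{ intros y x. unfold F. rewrite !Cmod_mult, Cmod_Cexp_i, Rmult_1_r by apply Re0.
  replace (c1 * c2 * (wt y * wt x)) with ((c1 * wt y) * (c2 * wt x)) by ring.
  apply Rmult_le_compat; try apply Cmod_ge_0; [apply T1|apply T2]. }
transitivity (CRInt_line (fun y => CRInt_line (fun x => F y x))).
- apply line_ext. intros y. unfold F. symmetry. apply (line_scal _ _ _ (TE _ _ y T2)).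
- rewrite (Fubini_line F (c1 * c2) C2F Bd).
  apply line_ext. intros x. unfold laplace. rewrite <- (line_scal _ _ _ (TE _ _ x T1)).
  apply line_ext. intros y. unfold F. replace (Ci * y * x)%C with (Ci * x * y)%C by ring. ring.
Qed.

Lemma Xi_real_bounded : ccont (fun tau : R => Xi tau) /\ exists B, 0 <= B /\ forall tau : R, Cmod (Xi tau) <= B.
Proof.
split.
- apply (ccont_ext (fun tau : R => laplace (fun u => RtoC (Phi u)) (0 + tau * Ci)%C)).
  + intros x. rewrite Xi_eq. f_equal. ring.
  + apply (cderive_ccont _ (fun tau => laplace (fun u => RtoC (Phi u) * RtoC u) (0 + tau * Ci) * Ci)%C). intros x.
    apply hol_cderive, hol_laplace, rapid_Phi.
- destruct (rapid_tame _ rapid_Phi) as [c [Hc1 Hc2]]. exists (c * PI).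
  assert (T : tame (fun u => RtoC (Phi u)) c) by (split; assumption).
  split; [apply Rmult_le_pos; [apply (tame_nonneg _ _ T)|left; apply PI_RGT_0]|].
  intros tau. rewrite Xi_eq. apply line_bound. split.
  + apply ccont_mult; [exact Hc1|]. apply ccont_Cexp, ccont_mult; [apply ccont_const|apply ccont_id].
  + intros u. rewrite Cmod_mult, Cmod_Cexp_i, Rmult_1_r; [apply Hc2|]. simpl; ring.
Qed.

Section Flow.
Variables (r : R) (t : C).
Hypothesis Hr : 0 < r < 1.

(** Any number strictly between [r] and 1 would do. *)
Let k := (1 + r) / 2.
Let th := r / k.

Lemma k_range : 0 < k < 1 /\ r < k.
Proof. unfold k; lra. Qed.

Lemma th_range : 0 <= th < 1.
Proof.
destruct k_range as [K1 K2]. unfold th. split.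
- left; apply Rdiv_lt_0_compat; lra.
- apply (Rmult_lt_reg_r k); [lra|]. replace (r / k * k) with r by (field; lra). lra.
Qed.

(** The factor of [H_n(tau)] in the Poisson kernel at [(t, tau)]. *)
Definition kcoef (n : nat) : C := (r ^ n / (sqrt PI * 2 ^ n * INR (fact n)) * herm n t)%C.

Lemma herm_norm_C n : (RtoC (herm_norm n) * RtoC (herm_norm n))%C = (2 ^ n * INR (fact n))%C.
Proof. rewrite <- RtoC_mult, herm_norm_sq, RtoC_mult, RtoC_pow. reflexivity. Qed.

(** The division by [2^n n!] in the kernel is shared equally between [H_n(t)] and the
other factor, which accounts for the factor [herm_norm n]. *)
Lemma kcoef_bound : exists M, 0 <= M /\ forall n, Cmod (kcoef n) * herm_norm n <= M * (r ^ n * sqrt (/ k) ^ n).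
Proof.
destruct k_range as [K1 K2].
destruct (herm_bound k (Im t) K1) as [M [M0 HM]].
assert (PP := PI_RGT_0). assert (SP := sqrt_lt_R0 _ PP).
exists (M * exp (k * Re t ^ 2) / sqrt PI). split.
{ apply Rmult_le_pos; [apply Rmult_le_pos; [lra|left; apply exp_pos]|left; apply Rinv_0_lt_compat, SP]. }
intros n. specialize (HM n (Re t)).
replace ((Re t, Im t) : C) with t in HM by (destruct t; reflexivity).
assert (H0 := herm_norm_pos n). assert (H2 := herm_norm_sq n).
assert (P2 : 0 < 2 ^ n) by (apply pow_lt; lra). assert (F0 := INR_fact_lt_0 n).
assert (DD : 0 < sqrt PI * (herm_norm n * herm_norm n)) by (repeat apply Rmult_lt_0_compat; assumption).
assert (Q : (r ^ n / (sqrt PI * 2 ^ n * INR (fact n)))%C = RtoC (r ^ n / (sqrt PI * (herm_norm n * herm_norm n)))).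
{ rewrite RtoC_div by (apply Rgt_not_eq, DD). rewrite !RtoC_mult, herm_norm_C, RtoC_pow. f_equal. ring. }
unfold kcoef. rewrite Q, Cmod_mult, Cmod_R.
assert (r0 : 0 < r ^ n) by (apply pow_lt; lra).
assert (D0 : 0 < r ^ n / (sqrt PI * (herm_norm n * herm_norm n))) by (apply Rdiv_lt_0_compat; assumption).
rewrite Rabs_pos_eq by lra.
apply Rle_trans with (r ^ n / (sqrt PI * (herm_norm n * herm_norm n)) * (M * (herm_norm n * sqrt (/ k) ^ n * exp (k * Re t ^ 2))) * herm_norm n).
- apply Rmult_le_compat_r; [lra|]. apply Rmult_le_compat_l; [lra|exact HM].
- right. field. split; lra.
Qed.

Lemma sqrt_k_ge1 n : 1 <= sqrt (/ k) ^ n.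
Proof.
destruct k_range as [K1 K2]. apply pow_R1_Rle. rewrite <- sqrt_1. apply sqrt_le_1; [lra|left; apply Rinv_0_lt_compat; lra|].
rewrite <- Rinv_1. apply Rinv_le_contravar; lra.
Qed.

Lemma th_pow n : r ^ n * sqrt (/ k) ^ n * sqrt (/ k) ^ n = th ^ n.
Proof.
destruct k_range as [K1 K2]. rewrite Rmult_assoc, <- !Rpow_mult_distr. f_equal.
rewrite sqrt_sqrt by (left; apply Rinv_0_lt_compat; lra). reflexivity.
Qed.

Lemma th_series c : ex_series (fun n => th ^ n * c).
Proof.
apply ex_series_scal_Rr. exists (/ (1 - th)). apply is_series_geom. assert (H := th_range). rewrite Rabs_pos_eq; lra.
Qed.

(** [H_n(t)] and [H_n(tau)] each cost [k^(- n / 2)]; against [r^n] the series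
still converges like [th^n]. *)
Lemma kernel_term_bound : exists M, 0 <= M /\
  forall n (tau : R), Cmod (kcoef n * herm n tau * RtoC (exp (- tau ^ 2))) <= th ^ n * M * wt tau.
Proof.
destruct k_range as [K1 K2].
destruct kcoef_bound as [M1 [M10 H1]]. destruct (herm_bound k 0 K1) as [M2 [M20 H2]].
assert (ik : 0 < / (1 - k)) by (apply Rinv_0_lt_compat; lra).
exists (M1 * M2 * / (1 - k)). split; [apply Rmult_le_pos; [apply Rmult_le_pos; assumption|lra]|].
intros n tau. rewrite !Cmod_mult, Cmod_R, Rabs_pos_eq by (left; apply exp_pos).
specialize (H1 n). specialize (H2 n tau). change ((tau, 0) : C) with (RtoC tau) in H2.
assert (S0 : 0 <= sqrt (/ k) ^ n) by (apply pow_le, sqrt_pos).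
assert (Pe := exp_pos (- tau ^ 2)). assert (Pk := exp_pos (k * tau ^ 2)).
assert (Pc := Cmod_ge_0 (kcoef n)).
apply Rle_trans with (Cmod (kcoef n) * (M2 * (herm_norm n * sqrt (/ k) ^ n * exp (k * tau ^ 2))) * exp (- tau ^ 2)).
{ apply Rmult_le_compat_r; [lra|]. apply Rmult_le_compat_l; assumption. }
replace (Cmod (kcoef n) * (M2 * (herm_norm n * sqrt (/ k) ^ n * exp (k * tau ^ 2))) * exp (- tau ^ 2)) with
  ((Cmod (kcoef n) * herm_norm n) * (M2 * sqrt (/ k) ^ n * (exp (k * tau ^ 2) * exp (- tau ^ 2)))) by ring.
rewrite <- exp_plus. replace (k * tau ^ 2 + - tau ^ 2) with (- (1 - k) * tau ^ 2) by ring.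
assert (W := exp_neg_quad (1 - k) tau ltac:(lra)).
apply Rle_trans with (M1 * (r ^ n * sqrt (/ k) ^ n) * (M2 * sqrt (/ k) ^ n * (/ (1 - k) * wt tau))).
- apply Rmult_le_compat; [apply Rmult_le_pos; [lra|left; apply herm_norm_pos]| |exact H1|].
  + apply Rmult_le_pos; [apply Rmult_le_pos; lra|left; apply exp_pos].
  + apply Rmult_le_compat_l; [apply Rmult_le_pos; lra|exact W].
- right. rewrite <- th_pow. ring.
Qed.

Lemma kernel_series (tau : R) :
  csum (fun n => kcoef n * herm n tau)%C (Hermite_Poisson_kernel r t tau).
Proof.
destruct kernel_term_bound as [M [M0 HM]].
destruct (csum_dominated (fun n => kcoef n * herm n tau * RtoC (exp (- tau ^ 2)))%C (fun n => th ^ n * (M * wt tau))) as [l [Hl _]].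
- intros n. apply Rle_trans with (1 := HM n tau). right; ring.
- apply th_series.
- assert (E0 : RtoC (exp (- tau ^ 2)) <> 0) by (intros E; apply RtoC_inj in E; assert (P := exp_pos (- tau ^ 2)); lra).
  apply (csum_scal (/ RtoC (exp (- tau ^ 2)))%C) in Hl.
  assert (Hk : csum (fun n => kcoef n * herm n tau)%C (/ RtoC (exp (- tau ^ 2)) * l)%C).
  { revert Hl. apply csum_ext. intros n. field. exact E0. }
  unfold Hermite_Poisson_kernel.
  erewrite CSeries_eq; [exact Hk|].
  revert Hk. apply csum_ext. intros n. rewrite !Hermite_eq. reflexivity.
Qed.

Lemma gauss_i (x : R) : ((Ci * x) ^ 2 / 4)%C = RtoC (- (x ^ 2 / 4)).
Proof.
rewrite RtoC_opp, RtoC_div, RtoC_pow by lra. simpl.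
transitivity ((Ci * Ci) * (x * x) / 4)%C; [field|rewrite Ci2; field].
Qed.

Lemma tame_Fourier_Phi n : exists c,
  tame (fun x : R => RtoC (Phi x) * ((Ci * x) ^ n * (sqrt PI * Cexp ((Ci * x) ^ 2 / 4))))%C c.
Proof.
destruct (rapid_tame (fun x : R => RtoC (Phi x) * (Ci * x) ^ n)%C) as [c [H1 H2]].
{ apply rapid_mult; [apply rapid_Phi|]. apply expbd_pow, expbd_mult; [apply expbd_const|apply expbd_id]. }
exists (c * sqrt PI). split.
- apply ccont_mult; [apply cont_Phi|]. apply ccont_mult; [apply ccont_pow, ccont_mult; [apply ccont_const|apply ccont_id]|].
  apply ccont_mult; [apply ccont_const|]. apply ccont_Cexp. apply ccont_mult; [|apply ccont_const]. apply ccont_pow, ccont_mult; [apply ccont_const|apply ccont_id].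
- intros x. rewrite Cmult_assoc, Cmod_mult. replace (c * sqrt PI * wt x) with (c * wt x * sqrt PI) by ring.
  apply Rmult_le_compat; try apply Cmod_ge_0; [apply H2|].
  rewrite Cmod_mult, Cmod_R, Rabs_pos_eq by apply sqrt_pos. rewrite <- (Rmult_1_r (sqrt PI)) at 2.
  apply Rmult_le_compat_l; [apply sqrt_pos|]. rewrite Cmod_Cexp, <- exp_0. apply exp_le_mono.
  rewrite gauss_i. change (- (x ^ 2 / 4) <= 0). assert (Q := pow2_ge_0 x). lra.
Qed.

(** The [n]-th term of the Poisson flow after Fourier transformation of the Hermite
function. *)
Definition flow_term (n : nat) (x : R) : C :=
  (kcoef n * (RtoC (Phi x) * ((Ci * x) ^ n * (sqrt PI * Cexp ((Ci * x) ^ 2 / 4)))))%C.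

(** [Fourier_exchange] moves the transform from [Phi] to the Hermite function. *)
Lemma line_kernel_term n :
  CRInt_line (fun tau : R => kcoef n * (herm_fun n tau * Xi tau))%C = CRInt_line (flow_term n).
Proof.
assert (E : CRInt_line (fun tau : R => herm_fun n tau * Xi tau)%C =
  CRInt_line (fun x : R => RtoC (Phi x) * ((Ci * x) ^ n * (sqrt PI * Cexp ((Ci * x) ^ 2 / 4))))%C).
{ transitivity (CRInt_line (fun tau : R => herm_fun n tau * laplace (fun u => RtoC (Phi u)) (Ci * tau))%C).
  - apply line_ext. intros tau. rewrite Xi_eq. reflexivity.
  - rewrite (Fourier_exchange (herm_fun n) _ (rapid_herm_fun n) rapid_Phi). apply line_ext. intros x. rewrite laplace_herm_fun. reflexivity. }
destruct Xi_real_bounded as [XC [B [B0 HB]]].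
destruct (rapid_tame _ (rapid_herm_fun n)) as [c [Hc1 Hc2]].
assert (T : tame (fun tau : R => herm_fun n tau * Xi tau)%C (c * B)).
{ split; [apply ccont_mult; assumption|]. intros u. rewrite Cmod_mult.
  replace (c * B * wt u) with (c * wt u * B) by ring. apply Rmult_le_compat; try apply Cmod_ge_0; auto. }
rewrite (line_scal _ _ _ T), E. unfold flow_term. symmetry.
destruct (tame_Fourier_Phi n) as [c' T'].
apply (line_scal _ _ _ T').
Qed.

(** Here [|x|^n exp (- x^2 / 4)] is at most [herm_norm n], and one
factor [k^(- n / 2)] is enough. *)
Lemma flow_term_bound : exists M, 0 <= M /\ forall n, tame (flow_term n) (th ^ n * M).
Proof.
destruct kcoef_bound as [M1 [M10 H1]]. destruct (rapid_tame _ rapid_Phi) as [c T].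
assert (c0 := tame_nonneg _ _ T). destruct T as [TC TB].
exists (sqrt PI * M1 * c). split; [apply Rmult_le_pos; [apply Rmult_le_pos; [apply sqrt_pos|assumption]|exact c0]|].
intros n. split.
- destruct (tame_Fourier_Phi n) as [c' T']. apply ccont_mult; [apply ccont_const|apply T'].
- intros x. unfold flow_term. rewrite gauss_i, Cexp_RtoC, !Cmod_mult, Cmod_pow, Cmod_mult.
  rewrite Cmod_Ci, Rmult_1_l. rewrite (Cmod_R (sqrt PI)), (Cmod_R (exp _)), (Cmod_R x).
  rewrite (Rabs_pos_eq (sqrt PI)) by apply sqrt_pos. rewrite (Rabs_pos_eq (exp _)) by (left; apply exp_pos).
  specialize (H1 n). specialize (TB x).
  assert (P : Rabs x ^ n * exp (- (x ^ 2 / 4)) <= herm_norm n).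
  { assert (Pn := pow_le_herm_norm 1 (Rabs x / 2) n Rlt_0_1 ltac:(assert (Q := Rabs_pos x); lra)).
    rewrite Rinv_1, sqrt_1, pow1, Rmult_1_r, <- Rpow_mult_distr in Pn.
    replace (2 * (Rabs x / 2)) with (Rabs x) in Pn by field.
    replace (1 * (Rabs x / 2) ^ 2) with (x ^ 2 / 4) in Pn by (rewrite <- (pow2_abs x); field).
    rewrite exp_Ropp. assert (Pe := exp_pos (x ^ 2 / 4)).
    apply (Rmult_le_reg_r (exp (x ^ 2 / 4))); [exact Pe|]. rewrite Rmult_assoc, Rinv_l, Rmult_1_r by lra. exact Pn. }
  assert (S1 := sqrt_k_ge1 n). assert (r0 : 0 < r ^ n) by (apply pow_lt; lra).
  assert (Pc := Cmod_ge_0 (kcoef n)). assert (Ph := Cmod_ge_0 (RtoC (Phi x))).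
  assert (SP := sqrt_pos PI).
  assert (X0 : 0 <= Rabs x ^ n * exp (- (x ^ 2 / 4))) by (apply Rmult_le_pos; [apply pow_le, Rabs_pos|left; apply exp_pos]).
  replace (Cmod (kcoef n) * (Cmod (RtoC (Phi x)) * (Rabs x ^ n * (sqrt PI * exp (- (x ^ 2 / 4)))))) with
    (sqrt PI * (Cmod (kcoef n) * (Rabs x ^ n * exp (- (x ^ 2 / 4)))) * Cmod (RtoC (Phi x))) by ring.
  replace (th ^ n * (sqrt PI * M1 * c) * wt x) with (sqrt PI * (M1 * th ^ n) * (c * wt x)) by ring.
  apply Rmult_le_compat; [| |  |exact TB].
  + apply Rmult_le_pos; [exact SP|]. apply Rmult_le_pos; assumption.
  + exact Ph.
  + apply Rmult_le_compat_l; [exact SP|].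
    apply Rle_trans with (Cmod (kcoef n) * herm_norm n); [apply Rmult_le_compat_l; assumption|].
    apply Rle_trans with (1 := H1). apply Rmult_le_compat_l; [exact M10|].
    rewrite <- th_pow. rewrite <- (Rmult_1_r (r ^ n * sqrt (/ k) ^ n)) at 1.
    apply Rmult_le_compat_l; [apply Rmult_le_pos; lra|exact S1].
Qed.

(** The generating function at [z = i r x / 2]. *)
Lemma flow_term_sum (x : R) : csum (fun n => flow_term n x)
  (exp ((r ^ 2 - 1) / 4 * x ^ 2) * Phi x * Cexp (Ci * (r * t) * x))%C.
Proof.
assert (G := herm_generating t (Ci * r * x / 2)%C).
apply (csum_scal (RtoC (Phi x) * Cexp ((Ci * x) ^ 2 / 4))%C) in G.
replace (RtoC (Phi x) * Cexp ((Ci * x) ^ 2 / 4) * Cexp (2 * t * (Ci * r * x / 2) - (Ci * r * x / 2) ^ 2))%C with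
  (exp ((r ^ 2 - 1) / 4 * x ^ 2) * Phi x * Cexp (Ci * (r * t) * x))%C in G.
- revert G. apply csum_ext. intros n. unfold flow_term, kcoef, Cdiv.
  assert (F0 := INR_fact_C n).
  assert (P2 : (RtoC 2 ^ n)%C <> 0) by (apply Cpow_nz; intros E; apply RtoC_inj in E; lra).
  assert (SN := sqrt_PI_nz).
  replace (Ci * r * x * / 2)%C with (r * (Ci * x) * / 2)%C by ring.
  rewrite (Cpow_mult_l (r * (Ci * x))), (Cpow_mult_l r), Cpow_inv by (intros E; apply RtoC_inj in E; lra).
  set (e := Cexp _). set (h := herm n t). set (p := ((Ci * x) ^ n)%C).
  revert F0 P2 SN. generalize (RtoC (INR (fact n))) (RtoC 2 ^ n)%C (RtoC (sqrt PI)) (RtoC r ^ n)%C. intros a b c d Ha Hb Hc.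
  field. repeat split; assumption.
- rewrite <- (Cexp_RtoC ((r ^ 2 - 1) / 4 * x ^ 2)).
  transitivity (RtoC (Phi x) * (Cexp ((r ^ 2 - 1) / 4 * x ^ 2)%R * Cexp (Ci * (r * t) * x)))%C; [ring|].
  rewrite <- (Cmult_assoc (RtoC (Phi x))), <- !Cexp_plus. do 2 f_equal.
  transitivity ((- (Ci * Ci)) * ((r ^ 2 - 1) / 4 * x ^ 2) + Ci * (r * t) * x)%C.
  + rewrite Ci2, RtoC_mult, RtoC_div, RtoC_minus, !RtoC_pow by lra. ring.
  + simpl. field.
Qed.

Lemma Poisson_flow_lt_1 : Xi_Hermite_Poisson r t = Xi_flow ((r ^ 2 - 1) / 4) (r * t)%C.
Proof.
unfold Xi_Hermite_Poisson. destruct (Req_EM_T r 1) as [E|_]; [lra|].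
destruct kernel_term_bound as [M [M0 HM]]. destruct Xi_real_bounded as [XC [B [B0 HB]]].
set (f := fun n (tau : R) => (kcoef n * (herm_fun n tau * Xi tau))%C).
assert (Hf : forall n, tame (f n) (th ^ n * (M * B))).
{ intros n. split.
  - apply ccont_mult; [apply ccont_const|]. apply ccont_mult; [apply rapid_herm_fun|exact XC].
  - intros tau. unfold f, herm_fun.
    replace (kcoef n * (RtoC (exp (- tau ^ 2)) * herm n tau * Xi tau))%C with ((kcoef n * herm n tau * RtoC (exp (- tau ^ 2))) * Xi tau)%C by ring.
    rewrite Cmod_mult. replace (th ^ n * (M * B) * wt tau) with (th ^ n * M * wt tau * B) by ring.
    apply Rmult_le_compat; try apply Cmod_ge_0; auto. }
destruct (line_series f _ Hf (th_series _)) as [F [H1 [_ H3]]].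
destruct flow_term_bound as [M' [M0' HM']].
destruct (line_series flow_term _ HM' (th_series _)) as [G [G1 [_ G3]]].
transitivity (CRInt_line F); [|transitivity (CRInt_line G)].
- apply line_ext. intros tau. apply (csum_unique (fun n => f n tau)); [|apply H1].
  assert (K := csum_scal (Xi tau * RtoC (exp (- tau ^ 2)))%C _ _ (kernel_series tau)).
  replace (Xi tau * RtoC (exp (- tau ^ 2)) * Hermite_Poisson_kernel r t tau)%C with
    (Hermite_Poisson_kernel r t tau * Xi tau * RtoC (exp (- tau ^ 2)))%C in K by ring.
  revert K. apply csum_ext. intros n. unfold f, herm_fun. ring.
- apply (csum_unique _ _ _ H3). revert G3. apply csum_ext. intros n. symmetry. apply line_kernel_term.
- apply line_ext. intros x. apply (csum_unique (fun n => flow_term n x)); [apply G1|apply flow_term_sum].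
Qed.
End Flow.

Theorem theorem2p9 (r : R) (t : C) (hr : 0 < r <= 1) :
  Xi_Hermite_Poisson r t = Xi_flow ((r ^ 2 - 1) / 4) (r * t)%C.
Proof.
destruct (Rlt_le_dec r 1) as [L|L]; [apply Poisson_flow_lt_1; lra|].
assert (E : r = 1) by lra. subst r.
unfold Xi_Hermite_Poisson. destruct (Req_EM_T 1 1) as [_|N]; [|lra].
rewrite Xi_eq. apply line_ext. intros x.
replace ((1 ^ 2 - 1) / 4 * x ^ 2) with 0 by field. rewrite exp_0.
replace (Ci * (1 * t) * x)%C with (Ci * t * x)%C by ring. ring.
Qed.
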